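(* Let $\{M(t)\}_{t\ge0}$ be a GCP which performs $k$ kinds of jumps of amplitude $1,\dots,k$ with positive rates $\lambda_1,\dots,\lambda_k$, let $0<p<1$, and let $\{M_1(t)\}_{t\ge0}$ and $\{M_2(t)\}_{t\ge0}$ be the Type II split components of $\{M(t)\}_{t\ge0}$ obtained with flips of a $p$-coin. Then $\{M_1(t)\}_{t\ge0}$ is a GCP which performs $k$ kinds of jumps of size $j_1\in\{1,\dots,k\}$ with reduced rates $$\sum_{j=j_1}^{k}\binom{j}{j_1}p^{j_1}(1-p)^{j-j_1}\lambda_j,$$ and $\{M_2(t)\}_{t\ge0}$ is a GCP which performs $k$ kinds of jumps of size $j_2\in\{1,\dots,k\}$ with positive rates $$\sum_{j=j_2}^{k}\binom{j}{j_2}(1-p)^{j_2}p^{j-j_2}\lambda_j.$$ Moreover, the covariance of $M_1(t)$ and $M_2(t)$ is $$\operatorname{Cov}(M_1(t),M_2(t))=\sum_{j=1}^{k}\ \sum_{\substack{j_1+j_2=j\\ j_1,j_2\ge0}}\binom{j}{j_1}p^{j_1}(1-p)^{j_2}j_1j_2\lambda_jt,$$ which is zero only if $j_1=0$ or $j_2=0$ (in every term of the sum). Therefore, in Type II splitting the split components $\{M_1(t)\}_{t\ge0}$ and $\{M_2(t)\}_{t\ge0}$ are not independent. They are independent provided the jumps are instead split according to Type I splitting.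
   Context: A counting process is an $\mathbb{N}_0$-valued process with nondecreasing right-continuous paths. A generalized counting process (GCP) performing $k$ kinds of jumps of amplitude $1,2,\dots,k$ with positive rates $\lambda_1,\dots,\lambda_k$ is a counting process $\{M(t)\}_{t\ge0}$ with $M(0)=0$ and independent and stationary increments such that, as $h\to0^+$, $\mathrm{Pr}\{M(t+h)=n+j\mid M(t)=n\}$ equals $1-\sum_{i=1}^k\lambda_i h+o(h)$ for $j=0$, $\lambda_jh+o(h)$ for $1\le j\le k$, and $o(h)$ for $j\ge k+1$. A $p$-coin is a coin in which head appears with probability $p$. All coin flips below are independent of each other and of $\{M(t)\}_{t\ge0}$. Type II splitting with a $p$-coin: whenever a jump of size $j\in\{1,\dots,k\}$ is registered in $\{M(t)\}_{t\ge0}$, the $p$-coin is flipped $j$ times. If $j_1$ heads and $j_2=j-j_1$ tails appear, then a jump of size $j_1$ is registered in $\{M_1(t)\}_{t\ge0}$ and a jump of size $j_2$ is registered in $\{M_2(t)\}_{t\ge0}$ (size $0$ means no jump). Thus simultaneous jumps in the two components are possible. Type I splitting with a $p$-coin: whenever a jump of size $j\in\{1,\dots,k\}$ is registered in $\{M(t)\}_{t\ge0}$, the $p$-coin is flipped once. If head appears, the whole jump of size $j$ is registered in the first component $\{M_1(t)\}_{t\ge0}$; otherwise the whole jump is registered in the second component $\{M_2(t)\}_{t\ge0}$.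
   Formalization: Non-independence of the Type II components is stated for k ≥ 2, since for k = 1 each jump gets a single flip and the components are independent; the claim that the covariance is zero only if j1 = 0 or j2 = 0 is stated for t > 0, since at t = 0 the covariance vanishes. *)

(* Defs.v *)
From HB Require Import structures.
From mathcomp Require Import all_boot all_order all_algebra finmap.
From mathcomp Require Import all_classical all_reals all_analysis.

Set Implicit Arguments.
Unset Strict Implicit.
Unset Printing Implicit Defensive.

Import Order.TTheory GRing.Theory Num.Theory.
Import numFieldNormedType.Exports.

Local Open Scope classical_set_scope.
Local Open Scope ring_scope.

Section independence.
Context d (T : measurableType d) (R : realType) (P : probability T R).

Definition mutually_independent (I : eqType) d' (U : measurableType d')
    (X : I -> T -> U) : Prop :=
  forall (s : seq I) (B : I -> set U),
    uniq s -> (forall i, measurable (B i)) ->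
    P (\big[setI/setT]_(i <- s) (X i @^-1` B i)) =
    (\prod_(i <- s) P (X i @^-1` B i))%E.

(* the sigma-algebra generated by the variables X i, i in D *)
Definition sigma_process (I : Type) (D : set I) d' (U : measurableType d')
    (X : I -> T -> U) : set (set T) :=
  <<s [set X i @^-1` B | i in D & B in @measurable d' U] >>.

Definition independent_processes
    (I1 : Type) (D1 : set I1) d1 (U1 : measurableType d1) (X1 : I1 -> T -> U1)
    (I2 : Type) (D2 : set I2) d2 (U2 : measurableType d2) (X2 : I2 -> T -> U2)
    : Prop :=
  forall A B, sigma_process D1 X1 A -> sigma_process D2 X2 B ->
    P (A `&` B) = (P A * P B)%E.

Definition cond_prob (A B : set T) : R := fine (P (A `&` B)) / fine (P B).

End independence.

(* Processes are indexed by all of R; only the times t >= 0 are meaningful,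
   and nothing below depends on the values at negative times. *)
Definition nonneg_times (R : realType) : set R := [set t | 0 <= t].
Arguments nonneg_times {R}.

Section counting_processes.
Context d (T : measurableType d) (R : realType) (P : probability T R).

Record counting_process (M : R -> T -> nat) : Prop := {
  cp_measurable : forall t : R, 0 <= t -> measurable_fun setT (M t);
  cp_nondecreasing : forall w (s t : R), 0 <= s -> s <= t -> (M s w <= M t w)%N;
  cp_right_continuous : forall w (t : R), 0 <= t ->
    M s w @[s --> t^'+] --> M t w }.

(* Truncated subtraction on nat is harmless: paths are nondecreasing.  A finite
   set of time points extends to an infinite nondecreasing sequence. *)
Definition independent_increments (M : R -> T -> nat) : Prop :=
  forall t : nat -> R, 0 <= t 0%N -> (forall i, t i <= t i.+1) ->
    mutually_independent P (fun (i : nat) w => (M (t i.+1) w - M (t i) w)%N).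

Definition stationary_increments (M : R -> T -> nat) : Prop :=
  forall s t h : R, 0 <= s -> 0 <= t -> 0 <= h -> forall B : set nat,
    P [set w | B (M (s + h)%R w - M s w)%N] =
    P [set w | B (M (t + h)%R w - M t w)%N].

(* Generalized counting process with jump sizes 1, ..., k; only the values
   lam 1, ..., lam k of the rate function are used.  Conditional probabilities
   given M t = n are considered only when that event has positive
   probability. *)
Record is_GCP (k : nat) (lam : nat -> R) (M : R -> T -> nat) : Prop := {
  gcp_k_gt0 : (0 < k)%N;
  gcp_rate_gt0 : forall j : nat, (1 <= j <= k)%N -> 0 < lam j;
  gcp_counting : counting_process M;
  gcp_start : forall w, M 0 w = 0%N;
  gcp_independent : independent_increments M;
  gcp_stationary : stationary_increments M;
  gcp_no_jump : forall (t : R) (n : nat), 0 <= t ->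
    P [set w | M t w = n] != 0%E -> forall h : R,
    cond_prob P [set w | M (t + h) w = n] [set w | M t w = n]
    = 1 - (\sum_(1 <= i < k.+1) lam i) * h +o_(h \near 0^'+) h;
  gcp_jump : forall (t : R) (n j : nat), 0 <= t -> (1 <= j <= k)%N ->
    P [set w | M t w = n] != 0%E -> forall h : R,
    cond_prob P [set w | M (t + h) w = (n + j)%N] [set w | M t w = n]
    = lam j * h +o_(h \near 0^'+) h;
  gcp_large_jump : forall (t : R) (n j : nat), 0 <= t -> (k < j)%N ->
    P [set w | M t w = n] != 0%E -> forall h : R,
    cond_prob P [set w | M (t + h) w = (n + j)%N] [set w | M t w = n]
    =o_(h \near 0^'+) h }.

(* Independent flips of a p-coin, also independent of M; true is head. *)
Record coin_flips (p : R) (M : R -> T -> nat) (I : eqType)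
    (xi : I -> T -> bool) : Prop := {
  flip_measurable : forall i, measurable_fun setT (xi i);
  flip_head : forall i, P [set w | xi i w = true] = p%:E;
  flip_independent : mutually_independent P xi;
  flip_process_independent :
    independent_processes P nonneg_times M [set: I] xi }.

End counting_processes.

Section splitting.
Context (R : realType).

Section paths.
Variable f : R -> nat.

Definition jump_size (s : R) : nat := (f s - lim (f u @[u --> s^'-]))%N.

Definition jump_times (t : R) : set R :=
  [set s | 0 < s <= t /\ (0 < jump_size s)%N].

(* The number of jumps in ]0, s]: if s is the time of the m-th jump,
   its rank is m. *)
Definition jump_rank (s : R) : nat := #|` fset_set (jump_times s)|.

End paths.

Context d (T : measurableType d).

(* Type II: at the m-th jump, of size j, the flips xi (m, 0), ..., xi (m, j - 1)
   are made, and the component of side b (true: heads, first component; false: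
   tails, second component) jumps by the number of flips with outcome b.
   Nondecreasing right-continuous integer-valued paths have finitely many jumps
   in ]0, t], so that the sum over the jump times is a genuine finite sum. *)
Definition typeII_component (b : bool) (M : R -> T -> nat)
    (xi : nat * nat -> T -> bool) (t : R) (w : T) : nat :=
  let f := fun s => M s w in
  \big[addn/0%N]_(s \in jump_times f t)
    (\sum_(i < jump_size f s) (xi (jump_rank f s, nat_of_ord i) w == b))%N.

(* Type I: at the m-th jump the single flip eta m is made, and the whole jump
   goes to the component given by its outcome. *)
Definition typeI_component (b : bool) (M : R -> T -> nat)
    (eta : nat -> T -> bool) (t : R) (w : T) : nat :=
  let f := fun s => M s w in
  \big[addn/0%N]_(s \in jump_times f t)
    (if eta (jump_rank f s) w == b then jump_size f s else 0%N).

End splitting.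

(* Main.v *)
Require Import Defs.
From HB Require Import structures.
From mathcomp Require Import all_boot all_order all_algebra finmap.
From mathcomp Require Import all_classical all_reals all_analysis.
From mathcomp Require Import measurable_realfun.
From mathcomp Require Import zify ring lra.

Set Implicit Arguments.
Unset Strict Implicit.
Unset Printing Implicit Defensive.

Import Order.TTheory GRing.Theory Num.Theory.
Import numFieldNormedType.Exports.

Local Open Scope classical_set_scope.
Local Open Scope ring_scope.

(* Sampling the path of M along a grid with n cells, all cells contain at most
   one jump for n large enough (depending on the path), and then the split
   components at the nodes are sums over the cells of a splitting of the
   increment of M in the cell.  The increments are independent and the flips
   used in different cells are different, so that the split cell increments are
   independent pairs of law mu_h(a, b) = P(M(h) = a + b) W(a + b, a), where
   W(j, a) is the probability that a out of j go to the first component.  Hence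
   the joint law of the split increments over disjoint intervals is the product
   of the limits of the n-fold convolutions of mu_{h/n}.

   Type II: by Vandermonde's identity, the n-fold convolution of mu_{h/n} is
   mu_h itself; this gives independent stationary increments, the rates, and
   P(M1(h) = M2(h) = 1) of order h against a product of order h^2.  For the
   covariance, cell increments larger than k are truncated to 0: the truncated
   sums lie below M1 and M2, they differ from them with vanishing probability,
   and their moments are explicit.

   Type I: mu_h differs from the product of its marginals by at most
   4 P(M(h) > 0)^2 in l^1 norm, which is o(1/n) for h/n in place of h; hence the
   limit is a product law. *)

(** * Nat-valued monotone right-continuous paths *)

(** The flips are indexed by the rank of a jump, which is random and depends on the path of [M], so
    the independence of flips and process cannot be applied directly to the components. On a grid it
    can: once all cell increments are prescribed, the ranks become fixed numbers (the count of
    nonzero cells so far), and distinct nonempty cells get distinct ranks. No distributional or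
    measurability statement about the jump times themselves is then required; the measurability of
    the components comes from the pointwise limit.

    The definition of a GCP provides no moments, so expectations cannot be computed by summing
    against the law of [M]. The truncation at k keeps exactly the sizes whose rates are known and
    makes every approximating moment a finite sum. For Type I the limit law is never computed: the 2
    by 2 minors of a product law vanish, this survives the limit, and vanishing minors already mean
    independence. *)

Section path.
Variables (R : realType) (f : R -> nat).
Hypothesis f_mono : forall s t : R, 0 <= s -> s <= t -> (f s <= f t)%N.
Hypothesis f_rc : forall t : R, 0 <= t -> f s @[s --> t^'+] --> f t.

Lemma right_constant (t : R) : 0 <= t ->
  exists2 e, 0 < e & forall s, t <= s < t + e -> f s = f t.
Proof.
move=> t0; have /discrete_cvg := f_rc t0; rewrite /= => H.
have [e /= e0 He] := H; exists e => // s /andP[]; rewrite le_eqVlt => /predU1P[->//|ts se].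
apply: (He s) => //=.
by rewrite ltr_norml; apply/andP; split; lra.
Qed.

(** The values of [f] on [0, t[ are bounded by [f t], so a largest one is attained at some u.
    Monotonicity then keeps [f] constant on [u, t[, and the left limit inside [jump_size] is
    [f u]. *)
Lemma left_constant (t : R) : 0 < t -> exists u, [/\ 0 <= u < t,
  forall s, u <= s < t -> f s = f u & jump_size f t = (f t - f u)%N].
Proof.
move=> t0.
pose Q := fun n => `[< exists2 s, 0 <= s < t & f s = n >].
have exQ : exists n, Q n by exists (f 0); apply/asboolP; exists 0; rewrite ?lexx.
have ubQ n : Q n -> (n <= f t)%N.
  by move=> /asboolP[s /andP[s0 /ltW st] <-]; exact: f_mono.
case: (ex_maxnP exQ ubQ) => c /asboolP[u /andP[u0 ut] uc] cmax; exists u.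
have uconst s : u <= s < t -> f s = f u.
  move=> /andP[us st]; apply/eqP; rewrite eqn_leq (f_mono u0 us) andbT uc.
  by apply: cmax; apply/asboolP; exists s => //; rewrite st (le_trans u0).
split => //; first by rewrite u0.
rewrite /jump_size; congr (_ - _)%N; apply: lim_near_cst.
  exact: discrete_hausdorff.
near=> s; apply: uconst; apply/andP; split; near: s.
- exact: nbhs_left_ge.
- exact: nbhs_left_lt.
Unshelve. all: by end_near. Qed.

(** If [f] exceeded [f u] somewhere in ]u, v], consider the infimum s of such points. Right
    continuity makes [f] exceed [f u] at s itself, while just before s it still equals [f u]: there
    is a jump at s. *)
Lemma no_jump_constant (u v : R) : 0 <= u -> u <= v ->
  (forall s, u < s <= v -> jump_size f s = 0%N) -> f u = f v.
Proof.
move=> u0 uv nojump; apply/eqP; rewrite eqn_leq (f_mono u0 uv) leqNgt.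
apply/negP => fuv.
pose S := [set x | u <= x /\ (f u < f x)%N].
have Sv : S v by [].
have lbS : lbound S u by move=> x [].
have hiS : has_inf S by split; [exists v|exists u].
pose s := inf S.
have us : u <= s by apply: lb_le_inf => //; exists v.
have sv : s <= v by apply: ge_inf => //; exists u.
have [e e0 He] := right_constant (le_trans u0 us).
have [x [ux fux] xse] := inf_adherent e0 hiS.
have sx : s <= x by apply: ge_inf => //; exists u.
have fs : (f u < f s)%N by rewrite -(He x) // sx.
have us' : u < s.
  by rewrite lt_neqAle us andbT; apply: contraTneq fs => <-; rewrite ltnn.
have [u' [/andP[u'0 u's] u'c js]] := left_constant (le_lt_trans u0 us').
have := nojump s; rewrite us' sv => /(_ isT); rewrite js.
suff -> : f u' = f u by lia.
(* This point lies in [u', s[, where [f] is constant, and in [u, s[, where [f] still has the value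
   [f u]. *)
have xs' : Num.max u u' < s by rewrite gt_max us'.
rewrite -(u'c (Num.max u u')) ?le_max ?lexx ?orbT//.
have um : u <= Num.max u u' by rewrite le_max lexx.
apply/eqP; rewrite eqn_leq (f_mono u0 um) andbT leqNgt; apply/negP => h.
have : s <= Num.max u u'.
  by apply: ge_inf; [exists u|split => //; rewrite le_max lexx].
by rewrite leNgt xs'.
Qed.

Lemma jump_lt (s s' : R) : 0 < s -> s < s' -> (0 < jump_size f s')%N ->
  (f s < f s')%N.
Proof.
move=> s0 ss'; have [u [/andP[u0 us] uc ->]] := left_constant (lt_trans s0 ss').
have : (f s <= f u)%N.
  rewrite -(uc (Num.max s u)) ?gt_max ?le_max ?ss' ?us ?lexx ?orbT//.
  by apply: f_mono; [exact: ltW|rewrite le_max lexx].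
lia.
Qed.

(** By [jump_lt], [f] is injective on its jump times, and its values there are at most [f t]. *)
Lemma jump_times_finite (t : R) : finite_set (jump_times f t).
Proof.
have inj : {in jump_times f t &, injective f}.
  move=> s s'; rewrite !inE => -[/andP[s0 _] js] [/andP[s'0 _] js'] ff.
  case: (ltgtP s s') => // ss'.
  - by have := jump_lt s0 ss' js'; rewrite ff ltnn.
  - by have := jump_lt s'0 ss' js; rewrite ff ltnn.
rewrite -(eq_finite_set (inj_card_eq inj)).
apply: (@sub_finite_set _ _ `I_(f t).+1); last exact: finite_II.
by move=> _ [s [/andP[/ltW s0 st] _] <-] /=; rewrite ltnS; exact: f_mono.
Qed.

(** Common form of both kinds of split components: [phi m j] is the part of the m-th jump, of size
    j, that goes to the component. *)
Definition path_sum (phi : nat -> nat -> nat) (t : R) : nat :=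
  \big[addn/0%N]_(s \in jump_times f t) phi (jump_rank f s) (jump_size f s).

Lemma jump_times_sub (u v : R) : u <= v -> jump_times f u `<=` jump_times f v.
Proof.
by move=> uv s [/andP[s0 su] js]; split => //; rewrite s0 (le_trans su).
Qed.

Lemma path_sum_mono phi (u v : R) : u <= v -> (path_sum phi u <= path_sum phi v)%N.
Proof.
move=> uv; rewrite /path_sum.
rewrite -[in X in (_ <= X)%N](setDUK (jump_times_sub uv)).
rewrite fsbigU0 ?leq_addr//; first exact: jump_times_finite.
- by apply: finite_setD; exact: jump_times_finite.
- by move=> s [? []].
Qed.

Lemma path_sum_rc phi (t : R) : 0 <= t ->
  path_sum phi s @[s --> t^'+] --> path_sum phi t.
Proof.
move=> t0; apply: cvg_near_cst.
have [e e0 He] := right_constant t0.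
near=> s; rewrite /path_sum; congr (\big[_/_]_(i \in _) _).
have st : t < s by near: s; exact: nbhs_right_gt.
have se : s < t + e by near: s; apply: nbhs_right_lt; rewrite ltrDl.
apply/seteqP; split; last exact/jump_times_sub/ltW.
move=> x [/andP[x0 xs] jx]; split => //; rewrite x0 /= leNgt; apply/negP => tx.
have [u [/andP[u0 ux] uc jE]] := left_constant x0.
move: jx; rewrite jE (He x) ?(ltW tx) ?(le_lt_trans xs)//.
rewrite -(uc (Num.max t u)) ?gt_max ?le_max ?tx ?ux ?lexx ?orbT//.
rewrite (He (Num.max t u)) ?subnn// le_max lexx/=.
by rewrite (@lt_trans _ _ x)// ?gt_max ?tx// (le_lt_trans xs).
Unshelve. all: by end_near. Qed.

Lemma path_sum_start phi : path_sum phi 0 = 0%N.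
Proof.
rewrite /path_sum (_ : jump_times f 0 = set0) ?fsbig_set0//.
by apply/seteqP; split => // s [/andP[s0 s0'] _]; move: s0'; rewrite leNgt s0.
Qed.

(** A single jump in ]u, v] has size [f v - f u] and rank [jump_rank f v]. In a cell without a jump
    the increment is 0 and [phi m 0 = 0] makes the added term vanish. *)
Lemma path_sum_cell phi (u v : R) : 0 <= u -> u <= v ->
  (forall m, phi m 0%N = 0%N) ->
  (forall s s', jump_times f v s -> jump_times f v s' -> u < s -> u < s' ->
     s = s') ->
  jump_rank f v = (jump_rank f u + (0 < f v - f u))%N /\
  path_sum phi v = (path_sum phi u + phi (jump_rank f v) (f v - f u))%N.
Proof.
move=> u0 uv phi0 uniq.
have [[s [Js us]]|nojump] := pselect (exists s, jump_times f v s /\ u < s).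
- have [/andP[s0 sv] js] := Js.
  have Ju : jump_times f s = s |` jump_times f u.
    apply/seteqP; split => x /=.
      move=> [/andP[x0 xs] jx]; have [xu|ux] := leP x u; [right|left].
        by split => //; rewrite x0.
      by apply: uniq => //; split => //; rewrite x0 (le_trans xs).
    by move=> [->|[/andP[x0 xu] jx]]; split => //; rewrite ?s0 ?lexx// x0 (le_trans xu (ltW us)).
  have Jv : jump_times f v = jump_times f s.
    apply/seteqP; split; last exact: jump_times_sub.
    rewrite Ju => x [/andP[x0 xv] jx]; have [xu|ux] := leP x u; [right|left].
      by split => //; rewrite x0.
    by apply: uniq => //; split => //; rewrite x0.
  have sNu : s \notin fset_set (jump_times f u).
    rewrite in_fset_set; last exact: jump_times_finite.
    by rewrite notin_setE => -[/andP[_]]; rewrite leNgt us.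
  have fE : (f v - f u)%N = jump_size f s.
    have [a [/andP[a0 a_s] ac jE]] := left_constant s0.
    have fsv : f s = f v.
      apply: no_jump_constant => //; first exact: ltW.
      move=> x /andP[sx xv]; apply/eqP; rewrite -leqn0 leqNgt; apply/negP => jx.
      have := uniq x s; rewrite us (lt_trans us sx) => /(_ _ Js isT isT) xs.
      suff xE : x = s by rewrite xE ltxx in sx.
      by apply: xs; split => //; rewrite (lt_trans s0 sx).
    rewrite jE fsv; congr (_ - _)%N.
    rewrite -(ac (Num.max u a)) ?gt_max ?le_max ?us ?a_s ?lexx ?orbT//.
    apply: no_jump_constant; rewrite ?le_max ?lexx//.
    move=> x /andP[ux xa]; apply/eqP; rewrite -leqn0 leqNgt; apply/negP => jx.
    have xs : x < s by rewrite (le_lt_trans xa)// gt_max us.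
    have := uniq x s; rewrite ux us => /(_ _ Js isT isT) xs'.
    suff xE : x = s by rewrite xE ltxx in xs.
    apply: xs'; split => //.
    by rewrite (le_lt_trans u0 ux) (le_trans (ltW xs)).
  have rE : jump_rank f v = (jump_rank f u + 1)%N.
    rewrite /jump_rank Jv Ju fset_setU1; last exact: jump_times_finite.
    by rewrite cardfsU1 sNu addnC.
  rewrite fE js rE; split => //.
  rewrite /path_sum Jv Ju fsbigU0 ?fsbig_set1//.
  + by rewrite [LHS]addnC -rE; congr (_ + phi _ _)%N; rewrite /jump_rank Jv.
  + exact: jump_times_finite.
  + by move=> x [-> /= [/andP[_]]]; rewrite leNgt us.
- have Jv : jump_times f v = jump_times f u.
    apply/seteqP; split; last exact: jump_times_sub.
    move=> x Jx; have [/andP[x0 xv] jx] := Jx; split => //; rewrite x0 leNgt.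
    by apply/negP => ux; apply: nojump; exists x.
  have -> : f v = f u.
    symmetry; apply: no_jump_constant => // s /andP[us sv].
    apply/eqP; rewrite -leqn0 leqNgt; apply/negP => js.
    by apply: nojump; exists s; split => //; split => //; rewrite (le_lt_trans u0 us).
  by rewrite subnn phi0 !addn0 /jump_rank /path_sum Jv.
Qed.

Definition grid_inc (tau : nat -> R) (i : nat) : nat := (f (tau i.+1) - f (tau i))%N.

(** When each cell holds at most one jump, this is the rank of the jump in cell i. It is a function
    of the cell increments alone, so prescribing them fixes which flips are used. *)
Definition grid_rank (tau : nat -> R) (i : nat) : nat :=
  (\sum_(i' < i.+1) (0 < grid_inc tau i'))%N.

Lemma path_sum_grid phi (tau : nat -> R) (N : nat) :
  tau 0%N = 0 -> (forall i, tau i <= tau i.+1) -> (forall m, phi m 0%N = 0%N) ->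
  (forall i s s', (i < N)%N -> jump_times f (tau i.+1) s ->
     jump_times f (tau i.+1) s' -> tau i < s -> tau i < s' -> s = s') ->
  path_sum phi (tau N) = (\sum_(i < N) phi (grid_rank tau i) (grid_inc tau i))%N.
Proof.
move=> tau0 tauS phi0 uniq.
have tau_ge0 i : 0 <= tau i.
  by elim: i => [|i IH]; rewrite ?tau0// (le_trans IH).
(* The rank is carried through the induction, because the contribution of the next cell depends on
   it. *)
suff : forall n, (n <= N)%N ->
    jump_rank f (tau n) = (\sum_(i' < n) (0 < grid_inc tau i'))%N /\
    path_sum phi (tau n) =
      (\sum_(i < n) phi (grid_rank tau i) (grid_inc tau i))%N by move=> /(_ N (leqnn N)) [].
elim=> [_|n IH nN].
  rewrite !big_ord0 tau0 path_sum_start; split => //.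
  rewrite /jump_rank (_ : jump_times f 0 = set0) ?fset_set0//.
  by apply/seteqP; split => // s [/andP[s0 s0'] _]; move: s0'; rewrite leNgt s0.
have [rE sE] := IH (ltnW nN).
have [rE' sE'] := path_sum_cell (tau_ge0 n) (tauS n) phi0 (fun s s' => uniq n s s' nN).
by rewrite sE' rE' sE rE /grid_rank !big_ord_recr.
Qed.

Lemma seq_min_gap (l : seq R) :
  exists2 e, 0 < e & {in l &, forall x y, x != y -> e <= `|x - y|}.
Proof.
elim: l => [|a l [e e0 He]]; first by exists 1.
have [e' e'0 He'] : exists2 e', 0 < e' & {in l, forall x, x != a -> e' <= `|x - a|}.
  elim: l {e0 He} => [|b l [e' e'0 He']]; first by exists 1.
  have [->|ba] := eqVneq b a.
    by exists e' => // x; rewrite inE => /predU1P[->|/He'//]; rewrite eqxx.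
  exists (Num.min e' `|b - a|); first by rewrite lt_min e'0 normr_gt0 subr_eq0.
  move=> x; rewrite inE => /predU1P[->|/He' h] xa; first by rewrite ge_min lexx orbT.
  by rewrite ge_min h.
exists (Num.min e e'); first by rewrite lt_min e0.
move=> x y; rewrite !inE => /predU1P[->|xl] /predU1P[->|yl]; rewrite ?eqxx//.
- by move=> ya; rewrite distrC ge_min He' ?orbT// eq_sym.
- by move=> xa; rewrite ge_min He' ?orbT.
- by move=> xy; rewrite ge_min He.
Qed.

Lemma jump_min_gap (t : R) : exists2 e, 0 < e &
  forall s s', jump_times f t s -> jump_times f t s' -> `|s - s'| < e -> s = s'.
Proof.
have [e e0 He] := seq_min_gap (fset_set (jump_times f t)).
exists e => // s s' Js Js'; apply: contraPeq => ss'.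
apply/negP; rewrite -leNgt; apply: He => //.
- by rewrite in_fset_set ?inE//; exact: jump_times_finite.
- by rewrite in_fset_set ?inE//; exact: jump_times_finite.
Qed.

End path.

(** * Grids refining a sequence of times *)

Section grid.
Variables (R : realType) (s : nat -> R).

(** Node j (n + 1) + r is the r-th point of the division of [s j, s (j + 1)] into n + 1 equal cells.
    With one sequence of nodes for all intervals, the increments over several intervals are
    consecutive blocks, of equal length, of one independent sequence. *)
Definition grid (n i : nat) : R :=
  s (i %/ n.+1)%N
  + (s (i %/ n.+1).+1 - s (i %/ n.+1)%N) * (i %% n.+1)%:R / n.+1%:R.

(** The value r = n + 1, which is the first node of the next block, is included so that the last
    cell of a block needs no separate treatment in [grid_step]. *)
Lemma gridE n j r : (r <= n.+1)%N ->
  grid n (j * n.+1 + r) = s j + (s j.+1 - s j) * r%:R / n.+1%:R.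
Proof.
rewrite leq_eqVlt => /predU1P[->|rn]; last first.
  by rewrite /grid divnMDl// modnMDl divn_small// modn_small// addn0.
have -> : (j * n.+1 + n.+1 = j.+1 * n.+1)%N by rewrite mulSn addnC.
rewrite /grid mulnK// modnMl mulr0 mul0r addr0 mulfK ?pnatr_eq0//; ring.
Qed.

Lemma grid_block n j : grid n (j * n.+1) = s j.
Proof. by have := @gridE n j 0 isT; rewrite addn0 mulr0 mul0r addr0. Qed.

Lemma grid_step n i : grid n i.+1 - grid n i =
  (s (i %/ n.+1).+1 - s (i %/ n.+1)%N) / n.+1%:R.
Proof.
have rn := ltn_pmod i (ltn0Sn n).
rewrite {1 2}(divn_eq i n.+1) -addnS !gridE ?(ltnW rn)// -natr1.
rewrite mulrDr mulrDl mulr1; ring.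
Qed.

Hypothesis sS : forall j, s j <= s j.+1.

Lemma grid_mono n i : grid n i <= grid n i.+1.
Proof. by rewrite -subr_ge0 grid_step divr_ge0// subr_ge0. Qed.

Lemma times_mono i j : (i <= j)%N -> s i <= s j.
Proof. by move=> /subnKC <-; elim: (j - i)%N => [|k IH]; rewrite ?addn0// addnS (le_trans IH). Qed.

End grid.

Section path_grid.
Variables (R : realType) (f : R -> nat).
Hypothesis f_mono : forall s t : R, 0 <= s -> s <= t -> (f s <= f t)%N.
Hypothesis f_rc : forall t : R, 0 <= t -> f s @[s --> t^'+] --> f t.
Variable (s : nat -> R).
Hypotheses (s0 : s 0%N = 0) (sS : forall j, s j <= s j.+1).

(** The mesh before [s J] is at most [s J / n.+1], so it drops below the smallest gap e between
    jumps as soon as n exceeds [s J / e]. The bound N depends on the jumps only; it is chosen before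
    [phi] and serves both components. *)
Lemma path_sum_grid_eventually (J : nat) : exists N, forall n, (N <= n)%N ->
  forall phi : nat -> nat -> nat, (forall m, phi m 0%N = 0%N) ->
  forall j, (j <= J)%N -> path_sum f phi (s j) =
    (\sum_(i < j * n.+1)
       phi (grid_rank f (grid s n) i) (grid_inc f (grid s n) i))%N.
Proof.
have [e e0 He] := jump_min_gap f_mono (s J).
have [N HN] : exists N : nat, s J / e < N%:R.
  exists (Num.bound (s J / e)); apply: le_lt_trans (archi_boundP _); rewrite ?ler_norm//.
  by rewrite divr_ge0 ?(ltW e0)// -s0 times_mono.
exists N => n Nn phi phi0 j jJ.
rewrite -{1}(grid_block s n j); apply: path_sum_grid => //.
- by have := grid_block s n 0; rewrite mul0n s0.
- exact: grid_mono.
move=> i x x' ij Jx Jx' ux ux'.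
have iJ : ((i %/ n.+1).+1 <= J)%N by rewrite (leq_trans _ jJ)// ltn_divLR.
have gJ : grid s n i.+1 <= s J.
  rewrite -(grid_block s n J) times_mono//; first exact: grid_mono.
  by rewrite (leq_trans ij)// leq_mul2r jJ orbT.
apply: He; try exact: (jump_times_sub gJ).
have : grid s n i.+1 - grid s n i < e.
  rewrite grid_step ltr_pdivrMr ?ltr0n// (@le_lt_trans _ _ (s J))//.
    rewrite (le_trans _ (times_mono sS iJ))// gerBl -s0 times_mono//.
  rewrite mulrC -ltr_pdivrMr// (lt_le_trans HN)// ler_nat.
  exact: leqW.
have [/andP[_ h] _] := Jx; have [/andP[_ h'] _] := Jx'.
by move=> {}He; rewrite ltr_norml; apply/andP; split; lra.
Qed.

End path_grid.

(** For [phi m j = j] the grid sum telescopes. Applied to the two parts of every jump, this will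
    give that the components add up to [M]. *)
Lemma path_sum_size (R : realType) (f : R -> nat)
  (f_mono : forall s t : R, 0 <= s -> s <= t -> (f s <= f t)%N)
  (f_rc : forall t : R, 0 <= t -> f s @[s --> t^'+] --> f t) (t : R) : 0 <= t ->
  path_sum f (fun _ j => j) t = (f t - f 0%R)%N.
Proof.
move=> t0; pose s := fun n : nat => if n is 0%N then 0 else t.
have sS j : s j <= s j.+1 by case: j.
have [N /(_ N (leqnn N) (fun _ j => j) (fun=> erefl) 1%N isT)] :=
  path_sum_grid_eventually f_mono f_rc (erefl : s 0%N = 0) sS 1.
rewrite -[path_sum _ _ _]/(path_sum f (fun _ j => j) t) => ->.
have -> : f t = f (grid s N (1 * N.+1)) by rewrite grid_block.
have g0 : grid s N 0 = 0 by have := grid_block s N 0; rewrite mul0n.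
rewrite -g0; elim: (1 * N.+1)%N => [|n IH]; first by rewrite big_ord0 subnn.
have gm := grid_mono sS N.
have h1 : (f (grid s N n) <= f (grid s N n.+1))%N.
  by apply: f_mono => //; rewrite -[X in X <= _]g0; exact: times_mono.
have h0 : (f (grid s N 0) <= f (grid s N n))%N.
  by apply: f_mono; [rewrite g0|exact: times_mono].
rewrite big_ord_recr /= IH /grid_inc; lia.
Qed.

(** * Countably-valued random variables *)

Section discrete.
Context d (T : measurableType d).

(** For a countable codomain, measurable fibres give measurability with respect to all subsets;
    pairs and finite sequences are thus handled without choosing sigma-algebras on them. *)
Definition discrete (U : Type) (V : T -> U) : Prop :=
  forall u, measurable [set w | V w = u].

Lemma discrete_pre (U : countType) (V : T -> U) (B : set U) :
  discrete V -> measurable [set w | B (V w)].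
Proof.
move=> mV.
rewrite (_ : [set w | B (V w)] =
    \bigcup_u (if `[< B u >] then [set w | V w = u] else set0)).
  apply: countable_bigcupT_measurable => [|u]; first exact: countableP.
  by case: ifP => // _; exact: mV.
apply/seteqP; split => w /=.
  by move=> Bw; exists (V w) => //; case: asboolP.
by move=> [u _]; case: asboolP => // Bu ->.
Qed.

(** The random index is frozen on each of its countably many fibres. This covers flips whose index
    is a random rank. *)
Lemma discrete_bind (U : countType) (U' : Type) (V : T -> U) (G : U -> T -> U') :
  discrete V -> (forall u, discrete (G u)) -> discrete (fun w => G (V w) w).
Proof.
move=> mV mG u'.
rewrite (_ : [set w | G (V w) w = u'] =
    \bigcup_u ([set w | V w = u] `&` [set w | G u w = u'])).
  apply: countable_bigcupT_measurable => [|u]; first exact: countableP.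
  by apply: measurableI; [exact: mV|exact: mG].
apply/seteqP; split => w /=.
  by move=> <-; exists (V w).
by move=> [u _ [/= ->]].
Qed.

Lemma discrete_cst (U : Type) (u : U) : discrete (fun=> u).
Proof.
move=> u'; have [->|uu'] := pselect (u = u').
  by rewrite (_ : [set w | _] = setT) //; apply/seteqP; split.
by rewrite (_ : [set w | _] = set0) //; apply/seteqP; split => // w /= /uu'.
Qed.

Lemma discrete_comp (U : countType) (U' : Type) (V : T -> U) (g : U -> U') :
  discrete V -> discrete (fun w => g (V w)).
Proof. by move=> mV; exact: (@discrete_bind _ _ V (fun u _ => g u) mV (fun u => discrete_cst (g u))). Qed.

Lemma discrete_comp2 (U1 U2 : countType) (U' : Type) (V1 : T -> U1)
    (V2 : T -> U2) (g : U1 -> U2 -> U') :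
  discrete V1 -> discrete V2 -> discrete (fun w => g (V1 w) (V2 w)).
Proof.
move=> m1 m2.
exact: (@discrete_bind _ _ V1 (fun u w => g u (V2 w)) m1
  (fun u => discrete_comp (g u) m2)).
Qed.

Lemma discrete_map (U : countType) (V : nat -> T -> U) (s : seq nat) :
  (forall i, i \in s -> discrete (V i)) -> discrete (fun w => [seq V i w | i <- s]).
Proof.
elim: s => [|a s IH] mV; first exact: discrete_cst.
apply: discrete_comp2; first by apply: mV; rewrite inE eqxx.
by apply: IH => i si; apply: mV; rewrite inE si orbT.
Qed.

Lemma discrete_sum (N : nat) (V : nat -> T -> nat) :
  (forall i, (i < N)%N -> discrete (V i)) ->
  discrete (fun w => (\sum_(i < N) V i w)%N).
Proof.
elim: N => [|N IH] mV.
  rewrite (_ : (fun w => _) = fun=> 0%N); first exact: discrete_cst.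
  by apply/funext => w; rewrite big_ord0.
rewrite (_ : (fun w => _) = fun w => ((\sum_(i < N) V i w) + V N w)%N).
  apply: discrete_comp2; last exact: mV.
  by apply: IH => i iN; apply: mV; exact: ltnW.
by apply/funext => w; rewrite big_ord_recr.
Qed.

Lemma discrete_forall (N : nat) (U : countType) (V : nat -> T -> U)
    (B : nat -> set U) : (forall i, discrete (V i)) ->
  measurable [set w | forall i, (i < N)%N -> B i (V i w)].
Proof.
move=> mV; rewrite (_ : [set w | _] =
    \bigcap_(i in [set i | (i < N)%N]) [set w | B i (V i w)]).
  by apply: bigcap_measurableType => i _; exact: discrete_pre.
by apply/seteqP; split => w /= h i; exact: h.
Qed.

Lemma discrete_measurable_fun (V : T -> nat) : discrete V -> measurable_fun setT V.
Proof. by move=> mV _ B _; rewrite setTI; exact: discrete_pre. Qed.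

Lemma measurable_fun_discrete (V : T -> nat) : measurable_fun setT V -> discrete V.
Proof. by move=> mV u; have := mV measurableT [set u] I; rewrite setTI. Qed.

End discrete.

Section pr.
Context d (T : measurableType d) (R : realType) (P : probability T R).

Definition pr (A : set T) : R := fine (P A).

Lemma prE A : measurable A -> P A = (pr A)%:E.
Proof. by move=> mA; rewrite fineK// fin_num_measure. Qed.

Lemma pr_ge0 A : 0 <= pr A.
Proof. exact/fine_ge0/measure_ge0. Qed.

Lemma pr_le1 A : measurable A -> pr A <= 1.
Proof. by move=> mA; rewrite -lee_fin -prE// probability_le1. Qed.

Lemma pr_setT : pr setT = 1.
Proof. by rewrite /pr probability_setT. Qed.

Lemma pr_set0 : pr set0 = 0.
Proof. by rewrite /pr measure0. Qed.

Lemma pr_le A B : measurable A -> measurable B -> A `<=` B -> pr A <= pr B.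
Proof. by move=> mA mB AB; rewrite -lee_fin -!prE// le_measure// inE. Qed.

Lemma pr_fin_disj (I : finType) (A : set T) (B : I -> set T) :
  (forall i, measurable (B i)) -> (forall w, A w <-> exists i, B i w) ->
  (forall i j w, B i w -> B j w -> i = j) -> pr A = \sum_i pr (B i).
Proof.
move=> mB AB tB.
have -> : A = \bigcup_i B i.
  by apply/seteqP; split => w; rewrite AB; [move=> [i Bi]; exists i|move=> [i _ Bi]; exists i].
have fT : finite_set [set: I] by exact: finite_finset.
rewrite /pr measure_fin_bigcup//; last by move=> i j _ _ [w [Bi Bj]]; exact: (tB i j w).
rewrite fsbig_finite//= (perm_big (index_enum I)) /=; last first.
  apply: uniq_perm; [exact: fset_uniq|exact: index_enum_uniq|].
  by move=> i; rewrite mem_index_enum in_fset_set// mem_set.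
under eq_bigr do rewrite prE//.
by rewrite sumEFin.
Qed.

Lemma prU A B : measurable A -> measurable B -> A `&` B = set0 ->
  pr (A `|` B) = pr A + pr B.
Proof.
move=> mA mB AB0; rewrite (@pr_fin_disj _ _ (fun b : bool => if b then A else B)).
- by rewrite big_bool.
- by case.
- move=> w; split; first by move=> [Aw|Bw]; [exists true|exists false].
  by move=> [[] h]; [left|right].
- have h w : A w -> B w -> False by move=> Aw Bw; rewrite -[False]/(set0 w) -AB0.
  by move=> [] [] w // h1 h2; exfalso; exact: (h w).
Qed.

Lemma prC A : measurable A -> pr (~` A) = 1 - pr A.
Proof.
move=> mA; have := prU mA (measurableC mA) (setICr A).
by rewrite setUv pr_setT => ->; rewrite addrC addKr.
Qed.

Lemma pr_setD A B : measurable A -> measurable B -> B `<=` A ->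
  pr (A `\` B) = pr A - pr B.
Proof.
move=> mA mB BA; rewrite -[in pr A](setDUK BA) prU//; first by ring.
- exact: measurableD.
- by apply/seteqP; split => w // [? []].
Qed.

(** Both sides are countable sums over the atoms in B, and the constant c moves inside the sum. This
    is the passage from identities on atoms to identities on arbitrary sets. *)
Lemma pr_atoms (U : countType) (V V' : T -> U) (C C' : set T) (c : R)
    (B : set U) : discrete V -> discrete V' -> measurable C -> measurable C' ->
  0 <= c ->
  (forall u, pr (C `&` [set w | V w = u]) = c * pr (C' `&` [set w | V' w = u])) ->
  pr (C `&` [set w | B (V w)]) = c * pr (C' `&` [set w | B (V' w)]).
Proof.
move=> mV mV' mC mC' c0 H.
(* The atoms are numbered by [pickle]; numbers that encode no element, or an element outside B,
   stand for the empty event. *)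
pose F (W : T -> U) n := if pickle_inv n is Some u then
  (if `[< B u >] then [set w | W w = u] else set0) else set0 : set T.
have mF W n : discrete W -> measurable (F W n).
  by move=> mW; rewrite /F; case: pickle_inv => // u; case: ifP.
have FE W D : D `&` [set w | B (W w)] = \bigcup_n (D `&` F W n).
  apply/seteqP; split => w /=.
    move=> [Dw Bw]; exists (choice.pickle (W w)) => //; split => //.
    by rewrite /F pickleK_inv; case: asboolP.
  move=> [n _ [Dw]]; rewrite /F; case: pickle_inv => // u.
  by case: asboolP => // Bu /= ->.
have tF W D : trivIset setT (fun n => D `&` F W n).
  move=> i j _ _ [w [[_ h1] [_ h2]]]; move: h1 h2; rewrite /F.
  case Ei: (pickle_inv i) => [u|//]; case: ifP => // _.
  case Ej: (pickle_inv j) => [v|//]; case: ifP => // _ /= uE vE.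
  have := @pickle_invK U i; have := @pickle_invK U j.
  by rewrite Ei Ej /= -uE -vE => -> ->.
have ser W D : discrete W -> measurable D ->
    P (D `&` [set w | B (W w)]) = \big[+%E/0%E]_(0 <= n <oo) P (D `&` F W n).
  move=> mW mD; rewrite FE measure_semi_bigcup//.
  - by move=> n; apply: measurableI => //; exact: mF.
  - by apply: bigcup_measurable => n _; apply: measurableI => //; exact: mF.
have mB W : discrete W -> measurable [set w | B (W w)] by exact: discrete_pre.
apply: EFin_inj; rewrite EFinM -!prE; do ?[exact: measurableI| by apply: measurableI => //; exact: mB].
rewrite !ser// -nneseriesZl//; apply: eq_eseriesr => n _.
rewrite !prE -?EFinM; do ?[by apply: measurableI => //; exact: mF].
congr (_%:E); rewrite /F; case: pickle_inv => [u|]; last by rewrite !setI0 pr_set0 mulr0.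
by case: ifP => _ //; rewrite !setI0 pr_set0 mulr0.
Qed.

Lemma pr_law_eq (U : countType) (V V' : T -> U) (B : set U) :
  discrete V -> discrete V' ->
  (forall u, pr [set w | V w = u] = pr [set w | V' w = u]) ->
  pr [set w | B (V w)] = pr [set w | B (V' w)].
Proof.
move=> mV mV' H.
have := @pr_atoms _ V V' setT setT 1 B mV mV' measurableT measurableT ler01.
by rewrite !setTI mul1r; apply => u; rewrite !setTI mul1r.
Qed.

Lemma pr_indep_atoms (U : countType) (V : T -> U) (C : set T) (B : set U) :
  discrete V -> measurable C ->
  (forall u, pr (C `&` [set w | V w = u]) = pr C * pr [set w | V w = u]) ->
  pr (C `&` [set w | B (V w)]) = pr C * pr [set w | B (V w)].
Proof.
move=> mV mC H.
have := @pr_atoms _ V V C setT (pr C) B mV mV mC measurableT (pr_ge0 C).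
by rewrite setTI; apply => u; rewrite setTI.
Qed.

(** Each [E n] lies between the intersection and the union of the later events, and both converge to
    A, from below and from above. The measurability of A is part of the result. *)
Lemma pr_lim (E : nat -> set T) (A : set T) : (forall n, measurable (E n)) ->
  (forall w, exists N, forall n, (N <= n)%N -> (E n w <-> A w)) ->
  measurable A /\ pr (E n) @[n --> \oo] --> pr A.
Proof.
move=> mE EA.
pose L := fun N => \bigcap_(n in [set n | (N <= n)%N]) E n.
pose Sp := fun N => \bigcup_(n in [set n | (N <= n)%N]) E n.
have mI N : measurable (L N) by exact: bigcap_measurableType.
have mS N : measurable (Sp N) by exact: bigcup_measurable.
have AI : A = \bigcup_N L N.
  apply/seteqP; split => w.
    by move=> Aw; have [N HN] := EA w; exists N => // n /= Nn; apply/HN.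
  move=> [N _ Iw]; have [N' HN'] := EA w; apply/(HN' (maxn N N')); first exact: leq_maxr.
  by apply: Iw => /=; exact: leq_maxl.
have AS : A = \bigcap_N Sp N.
  apply/seteqP; split => w.
    move=> Aw N _; have [N' HN'] := EA w; exists (maxn N N') => /=; first exact: leq_maxl.
    by apply/HN'; first exact: leq_maxr.
  move=> Sw; have [N HN] := EA w; have [n /= Nn] := Sw N I; by move/(HN _ Nn).
have mA : measurable A by rewrite AI; exact: bigcup_measurable.
split => //.
suff : P (E n) @[n --> \oo] --> P A.
  by rewrite [P A]prE// => /fine_cvgP[].
apply: (@squeeze_cvge _ _ _ _ (P \o L) _ (P \o Sp)).
- near=> n; apply/andP; split; apply: le_measure; rewrite ?inE//.
    by apply: bigcap_inf => /=.
  by move=> w Ew; exists n => /=.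
- rewrite AI; apply: nondecreasing_cvg_mu => //; first by rewrite -AI.
  move=> m n mn; apply/subsetPset => w Iw k /= nk; apply: Iw => /=; exact: leq_trans nk.
- rewrite AS; apply: nonincreasing_cvg_mu => //; last 2 first.
  + by rewrite -AS.
  + move=> m n mn; apply/subsetPset => w [k /= nk Ek]; exists k => //=; exact: leq_trans nk.
  + by rewrite (le_lt_trans (probability_le1 _ _)) ?ltry.
Unshelve. all: by end_near. Qed.

End pr.

(** * Sums of independent pairs *)

Section convolution.
Context (R : realType).
Implicit Types (m F : nat * nat -> R) (y : nat * nat).

Definition pair_conv m F y : R :=
  \sum_(a < y.1.+1) \sum_(b < y.2.+1)
    F (val a, val b) * m (y.1 - a, y.2 - b)%N.

Fixpoint pair_convn m (r : nat) : nat * nat -> R :=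
  if r is r'.+1 then pair_conv m (pair_convn m r') else fun y => (y == (0%N, 0%N))%:R.

End convolution.

Section block_sums.
Context d (T : measurableType d) (R : realType) (P : probability T R).
Variables (V : nat -> T -> nat * nat) (m : nat -> nat * nat -> R).
Hypothesis V_discrete : forall i, discrete (V i).
Hypothesis V_atoms : forall N (y : nat -> nat * nat),
  pr P [set w | forall i, (i < N)%N -> V i w = y i] = \prod_(i < N) m i (y i).

Definition block_sum (N r : nat) (w : T) : nat * nat :=
  ((\sum_(i < r) (V (N + i) w).1)%N, (\sum_(i < r) (V (N + i) w).2)%N).

Lemma block_sum_discrete N r : discrete (block_sum N r).
Proof.
apply: discrete_comp2.
- apply: (@discrete_sum _ _ r (fun i w => (V (N + i) w).1)) => i _; exact: discrete_comp.
- apply: (@discrete_sum _ _ r (fun i w => (V (N + i) w).2)) => i _; exact: discrete_comp.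
Qed.

(* [E] is an event of weight [e] independent of [V N], [V N.+1], ... *)
Definition before (N : nat) (E : set T) (e : R) : Prop :=
  measurable E /\ forall K (y : nat -> nat * nat),
    pr P (E `&` [set w | forall i, (N <= i < N + K)%N -> V i w = y i]) =
    e * \prod_(N <= i < N + K) m i (y i).

Lemma cyl_measurable (N K : nat) (y : nat -> nat * nat) :
  measurable [set w | forall i, (N <= i < N + K)%N -> V i w = y i].
Proof.
rewrite (_ : [set w | _] =
    [set w | forall i, (i < N + K)%N -> (fun v => (N <= i)%N -> v = y i) (V i w)]).
  exact: (@discrete_forall _ _ _ _ V (fun i v => (N <= i)%N -> v = y i)).
apply/seteqP; split => w /= h i.
- by move=> iN Ni; apply: h; rewrite Ni.
- by move=> /andP[Ni iN]; exact: h.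
Qed.

(** Conditioning on the sum of the first r terms turns one more term into one more convolution. The
    arbitrary past event E allows consecutive blocks to be chained. *)
Lemma before_block (m0 : nat * nat -> R) N r E e y :
  (forall i, (N <= i < N + r)%N -> m i = m0) ->
  before N E e ->
  before (N + r) (E `&` [set w | block_sum N r w = y]) (e * pair_convn m0 r y).
Proof.
move=> mm0 [mE HE]; split; first by apply: measurableI => //; exact: block_sum_discrete.
elim: r mm0 y => [|r IH] mm0 y K z.
  have bs0 w : block_sum N 0 w = (0, 0)%N by rewrite /block_sum !big_ord0.
  rewrite /= addn0; have [->|y0] := eqVneq y (0, 0)%N.
    rewrite mulr1 -HE; congr pr; apply/seteqP; split => w /=.
      by move=> [[? _] ?].
    by move=> [? ?]; rewrite bs0.
  rewrite mulr0 mul0r (_ : _ `&` _ = set0) ?pr_set0//.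
  apply/seteqP; split => w //= [[_ h] _]; move: y0; rewrite -h.
  by rewrite bs0 eqxx.
have mm0' i : (N <= i < N + r)%N -> m i = m0.
  by move=> /andP[Ni iN]; apply: mm0; rewrite Ni addnS ltnS ltnW.
(* If the first r terms sum to p, the term of index N + r must be y - p. It is prescribed as the
   first entry of a window of length [K.+1], which is what the induction hypothesis accepts. *)
pose B (p : 'I_y.1.+1 * 'I_y.2.+1) : set T :=
  (E `&` [set w | block_sum N r w = (val p.1, val p.2)]) `&`
  [set w | forall i, (N + r <= i < N + r + K.+1)%N -> V i w =
     if i == (N + r)%N then (y.1 - p.1, y.2 - p.2)%N else z i].
rewrite (@pr_fin_disj _ _ _ _ _ _ B); last 3 first.
- move=> p; apply: measurableI; last exact: cyl_measurable.
  by apply: measurableI => //; exact: block_sum_discrete.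
- have bsS w : block_sum N r.+1 w =
      ((block_sum N r w).1 + (V (N + r) w).1, (block_sum N r w).2 + (V (N + r) w).2)%N.
    by rewrite /block_sum !big_ord_recr.
  move=> w; split.
  + move=> [[Ew]] /=; rewrite bsS => yE hz.
    have h1 : ((block_sum N r w).1 < y.1.+1)%N by rewrite -yE ltnS leq_addr.
    have h2 : ((block_sum N r w).2 < y.2.+1)%N by rewrite -yE ltnS leq_addr.
    exists (Ordinal h1, Ordinal h2); split; first by split => //=; case: block_sum.
    move=> i /andP[i1 i2] /=; case: ifPn => [/eqP ->|iN].
      by rewrite -yE /= !addKn; case: (V _ _).
    apply: hz; rewrite addnS ltn_neqAle eq_sym iN i1/=; lia.
  + move=> [[a b]] [[Ew ba] hz] /=; split.
      split => //=; rewrite bsS ba /=.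
      have -> := hz (N + r)%N; last by rewrite leqnn; lia.
      rewrite eqxx /= (subnKC (leq_ord a)) (subnKC (leq_ord b)).
      by case: (y).
    move=> i /andP[i1 i2]; rewrite hz; last by apply/andP; split; lia.
    by case: ifP => // /eqP iN; lia.
- move=> [a b] [a' b'] w [[_ /= h] _] [[_ /= h'] _].
  by move: h'; rewrite h => -[/val_inj -> /val_inj ->].
rewrite -(pair_big xpredT xpredT (fun a b => pr P (B (a, b)))) /=.
rewrite /pair_conv mulr_sumr mulr_suml; apply: eq_bigr => a _.
rewrite mulr_sumr mulr_suml; apply: eq_bigr => b _.
rewrite /B (IH mm0') /=.
rewrite big_ltn ?addnS ?ltnS ?leq_addr// eqxx mm0; last by lia.
rewrite addSn !mulrA; congr (_ * _); apply: eq_big_nat => i /andP[iN _].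
by case: ifP => // /eqP iE; move: iN; rewrite iE; lia.
Qed.

Lemma before0 : before 0 setT 1.
Proof.
split => // K y; rewrite setTI mul1r big_mkord -V_atoms.
by congr pr; apply/seteqP; split => w /= h i; exact: h.
Qed.

(** The blocks are appended one after the other by [before_block], starting from the sure event; the
    final window of future terms is empty. *)
Lemma block_law (mj : nat -> nat * nat -> R) (L J : nat) (y : nat -> nat * nat) :
  (forall j i, (j * L <= i < j * L + L)%N -> m i = mj j) ->
  pr P [set w | forall j, (j < J)%N -> block_sum (j * L) L w = y j] =
  \prod_(j < J) pair_convn (mj j) L (y j).
Proof.
move=> mmj.
suff [_ /(_ 0%N (fun=> (0, 0)%N))] : before (J * L)
   [set w | forall j, (j < J)%N -> block_sum (j * L) L w = y j]
   (\prod_(j < J) pair_convn (mj j) L (y j)).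
  rewrite addn0 big_geq// mulr1 => <-; congr pr; apply/seteqP; split => w /=.
    by move=> h; split => // i; lia.
  by case.
elim: J => [|J IH].
  rewrite mul0n big_ord0 (_ : [set w | _] = setT); first exact: before0.
  by apply/seteqP; split.
rewrite big_ord_recr /= mulSn addnC.
rewrite (_ : [set w | _] =
  [set w | forall j, (j < J)%N -> block_sum (j * L) L w = y j] `&`
  [set w | block_sum (J * L) L w = y J]).
  by apply: before_block => // i iJ; exact: mmj.
apply/seteqP; split => w /=.
  by move=> h; split => [j jJ|]; apply: h => //; exact: ltnW.
by move=> [h1 h2] j; rewrite ltnS leq_eqVlt => /predU1P[->//|]; exact: h1.
Qed.

End block_sums.

(** * Independence of a sequence from the law of its atoms *)

Section independent_sequence.
Context d (T : measurableType d) (R : realType) (P : probability T R).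
Variables (U : countType) (V : nat -> T -> U).
Hypothesis V_discrete : forall i, discrete (V i).
Hypothesis V_atoms : forall N (y : nat -> U),
  pr P [set w | forall i, (i < N)%N -> V i w = y i] =
  \prod_(i < N) pr P [set w | V i w = y i].

Lemma indep_prefix (N : nat) (B : nat -> set U) :
  pr P [set w | forall i, (i < N)%N -> B i (V i w)] =
  \prod_(i < N) pr P [set w | B i (V i w)].
Proof.
(* Coordinates are freed one at a time: those below K carry arbitrary sets, the others singletons.
   Each value of coordinate K is covered by the induction hypothesis, and [pr_atoms] sums over these
   values. *)
suff H K : (K <= N)%N -> forall B : nat -> set U,
    (forall i, (K <= i < N)%N -> exists y, B i = [set y]) ->
    pr P [set w | forall i, (i < N)%N -> B i (V i w)] =
    \prod_(i < N) pr P [set w | B i (V i w)].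
  by apply: (H N) => // i /andP[]; lia.
elim: K => [_ {}B HB|K IH KN {}B HB].
  have [y By] : exists y : nat -> U, forall i, (i < N)%N -> B i = [set y i].
    have /choice[y Hy] : forall i, exists y, (i < N)%N -> B i = [set y].
      move=> i; have [iN|] := boolP (i < N)%N; last first.
        by move=> _; have [->|/set0P[y _]] := eqVneq (B i) set0; [exists (V 0%N point)|exists y].
      by have [//|y By] := HB i; exists y.
    by exists y.
  under eq_bigr do rewrite By//.
  rewrite -V_atoms; congr pr; apply/seteqP; split => w /= h i iN.
    by have := h i iN; rewrite By.
  by rewrite By//; exact: h.
pose C := [set w | forall i, (i < N)%N -> (if i == K then setT else B i) (V i w)].
have mC : measurable C.
  exact: (@discrete_forall _ _ _ _ V (fun i => if i == K then setT else B i)).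
have E : [set w | forall i, (i < N)%N -> B i (V i w)] = C `&` [set w | B K (V K w)].
  apply/seteqP; split => w /=.
    by move=> h; split; [move=> i iN; case: ifP => // _; exact: h|exact: h].
  move=> [h hK] i iN; have := h i iN; case: eqP => // -> _; exact: hK.
have prodE (A : set U) : \prod_(i < N) pr P [set w | (if val i == K then A else B i) (V i w)] =
    pr P [set w | A (V K w)] * \prod_(i < N | i != Ordinal KN) pr P [set w | B i (V i w)].
  rewrite (bigD1 (Ordinal KN)) //= eqxx; congr (_ * _); apply: eq_bigr => i iK.
  by rewrite ifN.
pose c := \prod_(i < N | i != Ordinal KN) pr P [set w | B i (V i w)].
have c0 : 0 <= c by apply: prodr_ge0 => i _; exact: pr_ge0.
rewrite E; have := @pr_atoms _ _ _ P _ (V K) (V K) C setT c (B K) (V_discrete K) (V_discrete K) mC measurableT c0.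
rewrite setTI => -> => [|u].
  rewrite mulrC -prodE; apply: eq_bigr => i _; case: eqP => // -> //.
rewrite setTI mulrC -(prodE [set u]) -(IH (ltnW KN) (fun i => if i == K then [set u] else B i)).
- congr pr; apply/seteqP; split => w /=.
  + move=> [h hu] i iN; case: eqP => [->//|iK]; have := h i iN; by case: eqP.
  + move=> h; split; last by have := h K KN; rewrite eqxx.
    by move=> i iN; have := h i iN; case: eqP.
- move=> i /andP[Ki iN]; case: eqP => [_|/eqP iK]; first by exists u.
  by apply: HB; rewrite iN andbT ltn_neqAle eq_sym iK.
Qed.

(** A finite set of indices is a prefix in which the missing coordinates are unconstrained. *)
Lemma indep_uniq (s : seq nat) (B : nat -> set U) : uniq s ->
  pr P [set w | forall i, i \in s -> B i (V i w)] =
  \prod_(i <- s) pr P [set w | B i (V i w)].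
Proof.
move=> us; pose N := (\max_(i <- s) i).+1.
have sN i : i \in s -> (i < N)%N by move=> is_; rewrite ltnS; exact: leq_bigmax_seq.
transitivity (\prod_(i < N) pr P [set w | (if val i \in s then B i else setT) (V i w)]).
  rewrite -(indep_prefix N (fun i => if i \in s then B i else setT)).
  congr pr; apply/seteqP; split => w /= h i.
    by move=> iN; case: ifP => // is_; exact: h.
  by move=> is_; have := h i (sN i is_); rewrite is_.
rewrite -(big_mkord xpredT (fun i => pr P [set w | (if i \in s then B i else setT) (V i w)])).
rewrite (bigID (mem s)) /= [X in _ * X]big1 ?mulr1; last first.
  by move=> i /negbTE ->; exact: pr_setT.
rewrite -big_filter.
under eq_big_seq => i do [rewrite mem_filter => /andP[-> _]; over].
apply: perm_big; apply: uniq_perm => //; first by rewrite filter_uniq// iota_uniq.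
move=> i; rewrite mem_filter mem_index_iota /= andb_idr//; exact: sN.
Qed.

End independent_sequence.

Lemma pr_mutually_independent d (T : measurableType d) (R : realType)
    (P : probability T R) (V : nat -> T -> nat) :
  (forall i, discrete (V i)) ->
  (forall s (B : nat -> set nat), uniq s ->
    pr P [set w | forall i, i \in s -> B i (V i w)] =
    \prod_(i <- s) pr P [set w | B i (V i w)]) ->
  mutually_independent P V.
Proof.
move=> mV H s B us _.
have E : \big[setI/setT]_(i <- s) (V i @^-1` B i) = [set w | forall i, i \in s -> B i (V i w)].
  by rewrite -bigcap_seq; apply/seteqP; split => w /= h i; exact: h.
rewrite E prE; last by rewrite -E; apply: bigsetI_measurable => i _; exact: discrete_pre.
rewrite H// -prodEFin; apply: eq_bigr => i _.
by rewrite prE//; exact: (discrete_pre (B i) (mV i)).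
Qed.

(** * Splitting a counting process *)

(* [Z b m j w] is the part of the [m]-th jump, of size [j], that goes to
   component [b]; [W j a] is the probability that [a] out of [j] go to the first
   component. *)
Record splitting_rule d (T : measurableType d) (R : realType)
    (P : probability T R) (M : R -> T -> nat) (W : nat -> nat -> R)
    (Z : bool -> nat -> nat -> T -> nat) : Prop := {
  rule_sum : forall m j w, (Z true m j w + Z false m j w)%N = j;
  rule_discrete : forall b m j, discrete (Z b m j);
  rule_W0 : W 0%N 0%N = 1;
  rule_law : forall E (I : seq nat) (r j a : nat -> nat),
    sigma_process nonneg_times M E -> uniq I -> {in I &, injective r} ->
    pr P (E `&` [set w | forall i, i \in I -> Z true (r i) (j i) w = a i]) =
    pr P E * \prod_(i <- I) W (j i) (a i) }.

(** A GCP without its rates. The joint law of the split increments uses only this; rates enter later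
    as limits at 0. *)
Record levy_counting d (T : measurableType d) (R : realType)
    (P : probability T R) (M : R -> T -> nat) : Prop := {
  levy_counting_process : counting_process M;
  levy_start : forall w, M 0 w = 0%N;
  levy_independent : independent_increments P M;
  levy_stationary : stationary_increments P M }.

Section split.
Context d (T : measurableType d) (R : realType) (P : probability T R).
Variables (M : R -> T -> nat) (W : nat -> nat -> R).
Variable (Z : bool -> nat -> nat -> T -> nat).
Hypothesis hM : levy_counting P M.
Hypothesis hZ : splitting_rule P M W Z.

Let M_mono w (s t : R) : 0 <= s -> s <= t -> (M s w <= M t w)%N.
Proof. exact: (cp_nondecreasing (levy_counting_process hM)). Qed.

Let M_rc w (t : R) : 0 <= t -> M s w @[s --> t^'+] --> M t w.
Proof. exact: (cp_right_continuous (levy_counting_process hM)). Qed.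

Lemma levy_discrete (t : R) : 0 <= t -> discrete (M t).
Proof.
by move=> t0; apply/measurable_fun_discrete/(cp_measurable (levy_counting_process hM)).
Qed.

Definition law (t : R) (n : nat) : R := pr P [set w | M t w = n].

Lemma rule_size0 b m w : Z b m 0%N w = 0%N.
Proof. by have := rule_sum hZ m 0%N w; case: b; lia. Qed.

Definition split_component b (t : R) (w : T) : nat :=
  path_sum (M ^~ w) (fun m j => Z b m j w) t.

Notation X := split_component.

Lemma split_mono b w (s t : R) : s <= t -> (X b s w <= X b t w)%N.
Proof. exact: (path_sum_mono (@M_mono w)). Qed.

Lemma split_rc b w (t : R) : 0 <= t -> X b s w @[s --> t^'+] --> X b t w.
Proof. exact: (path_sum_rc (@M_mono w) (@M_rc w)). Qed.

Lemma split_start b w : X b 0 w = 0%N.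
Proof. exact: path_sum_start. Qed.

Section times.
Variable (s : nat -> R).
Hypotheses (s0 : s 0%N = 0) (sS : forall j, s j <= s j.+1).

Let tau := grid s.

Let s_ge0 j : 0 <= s j.
Proof. by rewrite -s0 times_mono. Qed.

Let tau0 n : tau n 0%N = 0.
Proof. by have := grid_block s n 0; rewrite mul0n s0. Qed.

Let tau_ge0 n i : 0 <= tau n i.
Proof. by rewrite -(tau0 n); apply: times_mono => //; exact: grid_mono. Qed.

Definition cell_inc (n i : nat) (w : T) : nat := grid_inc (M ^~ w) (tau n) i.
Definition cell_rank (n i : nat) (w : T) : nat := grid_rank (M ^~ w) (tau n) i.

Definition cell_split (n i : nat) (w : T) : nat * nat :=
  (Z true (cell_rank n i w) (cell_inc n i w) w,
   Z false (cell_rank n i w) (cell_inc n i w) w).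

Lemma cell_inc_discrete n i : discrete (cell_inc n i).
Proof. by apply: discrete_comp2; exact: levy_discrete. Qed.

Lemma cell_rank_discrete n i : discrete (cell_rank n i).
Proof.
apply: (@discrete_sum _ _ i.+1 (fun i w => nat_of_bool (0 < cell_inc n i w)%N)).
by move=> k _; exact: (discrete_comp (fun x : nat => nat_of_bool (0 < x)%N) (cell_inc_discrete n k)).
Qed.

Lemma cell_split_discrete n i : discrete (cell_split n i).
Proof.
have h b : discrete (fun w => Z b (cell_rank n i w) (cell_inc n i w) w).
  apply: (@discrete_bind _ _ _ _ _ (fun r w => Z b r (cell_inc n i w) w) (cell_rank_discrete n i)) => r.
  apply: (@discrete_bind _ _ _ _ _ (fun j w => Z b r j w) (cell_inc_discrete n i)) => j.
  exact: rule_discrete hZ _ _ _.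
by apply: discrete_comp2; exact: h.
Qed.

Lemma cell_inc_law n N (j : nat -> nat) :
  pr P [set w | forall i, (i < N)%N -> cell_inc n i w = j i] =
  \prod_(i < N) law (tau n i.+1 - tau n i) (j i).
Proof.
have tauS := grid_mono sS n.
have := levy_independent hM (tau_ge0 n 0) tauS (B := fun i => [set j i]) (iota_uniq 0 N) (fun=> I).
rewrite (_ : \big[setI/setT]_(i <- _) _ =
   [set w | forall i, (i < N)%N -> cell_inc n i w = j i]); last first.
  rewrite -bigcap_seq; apply/seteqP; split => w /= h i.
    by move=> iN; apply: h; rewrite /= mem_iota.
  by rewrite /= mem_iota => /andP[_ iN]; exact: h.
rewrite prE; last by apply: (@discrete_forall _ _ _ _ (cell_inc n) (fun i => [set j i])) => i; exact: cell_inc_discrete.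
rewrite -(big_mkord xpredT (fun i => law (tau n i.+1 - tau n i) (j i))) /index_iota subn0.
move=> H; apply: EFin_inj; rewrite H -prodEFin; apply: eq_bigr => i _.
have h0 : 0 <= tau n i.+1 - tau n i by rewrite subr_ge0.
rewrite -prE; last exact: levy_discrete.
have := levy_stationary hM (tau_ge0 n i) (lexx 0) h0 [set j i].
rewrite addrC subrK add0r => ->; congr (P _); apply/seteqP; split => w /=.
  by rewrite (levy_start hM) subn0.
by rewrite (levy_start hM) subn0.
Qed.

Lemma cell_inc_sigma n N (j : nat -> nat) :
  sigma_process nonneg_times M [set w | forall i, (i < N)%N -> cell_inc n i w = j i].
Proof.
pose G := [set M i @^-1` B | i in nonneg_times & B in @measurable _ nat].
(* The measurability lemmas are read over the sigma-algebra generated by M, where being measurable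
   is the same as belonging to [sigma_process]. *)
pose T' := g_sigma_algebraType G.
have mM (t : R) : 0 <= t -> discrete (T := T') (M t).
  by move=> t0 u; apply: sub_sigma_algebra; exists t => //; exists [set u].
apply: (@discrete_forall _ T' N _ (cell_inc n) (fun i => [set j i])) => i.
by apply: (@discrete_comp2 _ T'); exact: mM.
Qed.

(** The measure written mu_h in the overview. *)
Definition thin (h : R) (y : nat * nat) : R :=
  law h (y.1 + y.2)%N * W (y.1 + y.2)%N y.1.

(** On the event that every cell increment is [j i], the sum of the two prescribed parts, the rank
    of cell i is the fixed number [r i]. These numbers increase strictly along the nonempty cells,
    so [rule_law] applies to those cells; empty cells contribute the factor W 0 0 = 1. *)
Lemma cell_split_law n N (y : nat -> nat * nat) :
  pr P [set w | forall i, (i < N)%N -> cell_split n i w = y i] =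
  \prod_(i < N) thin (tau n i.+1 - tau n i) (y i).
Proof.
pose j i := ((y i).1 + (y i).2)%N.
pose r i := (\sum_(i' < i.+1) (0 < j i'))%N.
pose I := [seq i <- iota 0 N | (0 < j i)%N].
have uI : uniq I by rewrite filter_uniq// iota_uniq.
have rinj : {in I &, injective r}.
  have rlt i i' : (0 < j i')%N -> (i < i')%N -> (r i < r i')%N.
    move=> j0 ii'; rewrite /r [in X in (_ < X)%N]big_ord_recr /= j0 addn1 ltnS.
    rewrite -!(big_mkord xpredT (fun i => nat_of_bool (0 < j i)%N)).
    by rewrite (big_cat_nat (n := i.+1) (p := i'))//= leq_addr.
  move=> i i'; rewrite !mem_filter => /andP[ji _] /andP[ji' _] rr.
  case: (ltngtP i i') => // ii'.
    by have := rlt _ _ ji' ii'; rewrite rr ltnn.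
  by have := rlt _ _ ji ii'; rewrite rr ltnn.
have := rule_law hZ j (fun i => (y i).1) (cell_inc_sigma n N j) uI rinj.
rewrite (_ : _ `&` _ = [set w | forall i, (i < N)%N -> cell_split n i w = y i]).
  move=> ->; rewrite cell_inc_law /thin big_split /=; congr (_ * _).
  rewrite -(big_mkord xpredT (fun i => W (j i) (y i).1)) /index_iota subn0.
  rewrite big_filter [RHS](bigID (fun i => (0 < j i)%N)) /= [X in _ * X]big1 ?mulr1//.
  move=> i; rewrite -leqNgt leqn0 addn_eq0 => /andP[/eqP y1 /eqP y2].
  by rewrite /j y1 y2 (rule_W0 hZ).
have rE w : (forall i, (i < N)%N -> cell_inc n i w = j i) ->
    forall i, (i < N)%N -> cell_rank n i w = r i.
  move=> h i iN; rewrite /cell_rank /grid_rank /r; apply: eq_bigr => i' _.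
  by rewrite -/(cell_inc n i' w) h// (leq_ltn_trans _ iN)// -ltnS.
apply/seteqP; split => w /=.
  move=> [h1 h2] i iN; rewrite /cell_split (rE w h1)// h1//.
  have ZE : Z true (r i) (j i) w = (y i).1.
    have [j0|] := posnP (j i); last by move=> j0; apply: h2; rewrite mem_filter j0 mem_iota.
    by rewrite j0 rule_size0; move: j0; rewrite /j; lia.
  have := rule_sum hZ (r i) (j i) w; rewrite ZE /j => /addnI ->.
  by case: (y i).
move=> h.
have h1 i : (i < N)%N -> cell_inc n i w = j i.
  by move=> iN; rewrite /j -h// /cell_split /= (rule_sum hZ).
split => // i; rewrite mem_filter mem_iota => /andP[_ /andP[_ iN]].
by have := h i iN; rewrite /cell_split (rE w h1)// h1// => <-.
Qed.

Definition increment (j : nat) (w : T) : nat * nat :=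
  ((X true (s j.+1) w - X true (s j) w)%N, (X false (s j.+1) w - X false (s j) w)%N).

Lemma block_sum_increment (J : nat) (w : T) : exists N, forall n, (N <= n)%N ->
  forall j, (j < J)%N -> block_sum (cell_split n) (j * n.+1) n.+1 w = increment j w.
Proof.
have [N HN] := path_sum_grid_eventually (@M_mono w) (@M_rc w) s0 sS J.
exists N => n Nn j jJ; rewrite /increment /split_component.
have h b : (path_sum (M^~ w) (fun m j => Z b m j w) (s j.+1) -
    path_sum (M^~ w) (fun m j => Z b m j w) (s j) =
    \sum_(i < n.+1) Z b (cell_rank n (j * n.+1 + i) w) (cell_inc n (j * n.+1 + i) w) w)%N.
  have phi0 m : Z b m 0%N w = 0%N by exact: rule_size0.
  rewrite (HN n Nn (fun m j => Z b m j w) phi0 j.+1 jJ).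
  rewrite (HN n Nn (fun m j => Z b m j w) phi0 j (ltnW jJ)).
  rewrite mulSn addnC big_split_ord /= addKn; exact: eq_bigr.
by rewrite !h.
Qed.

(** For each outcome the grid event eventually agrees with the event on the increments, so the
    probabilities given by [block_law] converge. The measurability of events about the components is
    obtained here as well. *)
Lemma split_increment_limit (J : nat) (y : nat -> nat * nat) :
  measurable [set w | forall j, (j < J)%N -> increment j w = y j] /\
  (\prod_(j < J) pair_convn (thin ((s j.+1 - s j) / n.+1%:R)) n.+1 (y j))
    @[n --> \oo] -->
  pr P [set w | forall j, (j < J)%N -> increment j w = y j].
Proof.
have [||mA cA] := @pr_lim _ _ _ P
  (fun n => [set w | forall j, (j < J)%N -> block_sum (cell_split n) (j * n.+1) n.+1 w = y j])
  [set w | forall j, (j < J)%N -> increment j w = y j].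
- move=> n; apply: (@discrete_forall _ _ J _ (fun j => block_sum (cell_split n) (j * n.+1) n.+1) (fun j => [set y j])) => j.
  by apply: block_sum_discrete => i; exact: cell_split_discrete.
- move=> w; have [N HN] := block_sum_increment J w; exists N => n Nn /=.
  by split => h j jJ; have := h j jJ; rewrite HN.
split => //; apply: cvg_trans cA; apply: near_eq_cvg; near=> n.
have := @block_law _ _ _ P (cell_split n) (fun i => thin (tau n i.+1 - tau n i))
  (cell_split_discrete n) (cell_split_law n) (fun j => thin ((s j.+1 - s j) / n.+1%:R)) n.+1 J y.
apply => j i /andP[ji ij]; congr thin; rewrite /tau grid_step.
suff -> : (i %/ n.+1 = j)%N by [].
by apply/eqP; rewrite eqn_leq leq_divRL// ji andbT -ltnS ltn_divLR// mulSn addnC.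
Unshelve. all: by end_near. Qed.

End times.
End split.

Lemma cvg_prod_ord (R : realType) (J : nat) (f : nat -> nat -> R) (l : nat -> R) :
  (forall j, (j < J)%N -> f j n @[n --> \oo] --> l j) ->
  (\prod_(j < J) f j n) @[n --> \oo] --> \prod_(j < J) l j.
Proof.
elim: J => [|J IH] H.
  by rewrite big_ord0; apply: cvg_near_cst; apply: nearW => n; rewrite big_ord0.
rewrite big_ord_recr /= (_ : (fun n => _) = fun n => (\prod_(j < J) f j n) * f J n); last first.
  by apply/funext => n; rewrite big_ord_recr.
by apply: cvgM; [apply: IH => j jJ; apply: H; exact: ltnW|exact: H].
Qed.

(** * Joint law of the split increments *)

Section split_law.
Context d (T : measurableType d) (R : realType) (P : probability T R).
Variables (M : R -> T -> nat) (W : nat -> nat -> R).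
Variable (Z : bool -> nat -> nat -> T -> nat).
Hypothesis hM : levy_counting P M.
Hypothesis hZ : splitting_rule P M W Z.

Notation X := (split_component M Z).

Definition split_pair (t : R) (w : T) : nat * nat := (X true t w, X false t w).

Definition split_inc (u v : R) (w : T) : nat * nat :=
  ((X true v w - X true u w)%N, (X false v w - X false u w)%N).

Definition split_law (h : R) (y : nat * nat) : R := pr P [set w | split_pair h w = y].

Let step_times (h : R) (n : nat) : R := if n is 0%N then 0 else h.

Lemma split_pair_measure (h : R) (y : nat * nat) : 0 <= h ->
  measurable [set w | split_pair h w = y] /\
  pair_convn (thin P M W (h / n.+1%:R)) n.+1 y @[n --> \oo] --> split_law h y.
Proof.
move=> h0; have sS j : step_times h j <= step_times h j.+1 by case: j.
have [] := @split_increment_limit _ _ _ P M W Z hM hZ (step_times h) erefl sS 1 (fun=> y).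
rewrite (_ : [set w | _] = [set w | split_pair h w = y]).
  move=> mA; rewrite (_ : (fun n => _) = fun n => pair_convn (thin P M W (h / n.+1%:R)) n.+1 y) //.
  by apply/funext => n; rewrite big_ord1 /step_times subr0.
have E w : increment M Z (step_times h) 0 w = split_pair h w.
  by rewrite /increment !split_start// !subn0.
apply/seteqP; split => w /=; first by move=> /(_ 0%N isT); rewrite E.
by move=> wy [|//]; rewrite E.
Qed.

Lemma split_pair_discrete (h : R) : 0 <= h -> discrete (split_pair h).
Proof. by move=> h0 y; have [] := split_pair_measure y h0. Qed.

Lemma split_discrete b (h : R) : 0 <= h -> discrete (X b h).
Proof.
move=> h0; have := split_pair_discrete h0; case: b.
- by move=> /(discrete_comp fst).
- by move=> /(discrete_comp snd).
Qed.

Lemma split_inc_discrete (u v : R) : 0 <= u -> 0 <= v -> discrete (split_inc u v).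
Proof.
by move=> u0 v0; apply: discrete_comp2; apply: discrete_comp2; exact: split_discrete.
Qed.

Lemma split_law_limit (h : R) (y : nat * nat) : 0 <= h ->
  pair_convn (thin P M W (h / n.+1%:R)) n.+1 y @[n --> \oo] --> split_law h y.
Proof. by move=> h0; have [] := split_pair_measure y h0. Qed.

(** The limit of a product is the product of the limits, and each factor converges by the case of
    one interval starting at 0. As a factor depends on the length of its interval only, stationarity
    is contained in the formula. *)
Lemma split_joint_law (s : nat -> R) (J : nat) (y : nat -> nat * nat) :
  s 0%N = 0 -> (forall j, s j <= s j.+1) ->
  pr P [set w | forall j, (j < J)%N -> split_inc (s j) (s j.+1) w = y j] =
  \prod_(j < J) split_law (s j.+1 - s j) (y j).
Proof.
move=> s0 sS; have [_ H] := split_increment_limit hM hZ s0 sS J y.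
apply: (cvg_unique _ H) => //.
apply: (@cvg_prod_ord _ _ (fun j n => pair_convn (thin P M W ((s j.+1 - s j) / n.+1%:R)) n.+1 (y j))
  (fun j => split_law (s j.+1 - s j) (y j))) => j jJ.
by apply: split_law_limit; rewrite subr_ge0.
Qed.

(** The grid needs times starting at 0, while increments are also considered along times starting
    later. *)
Definition cons_time (t : nat -> R) (n : nat) : R := if n is n'.+1 then t n' else 0.

Lemma cons_time_mono (t : nat -> R) : 0 <= t 0%N -> (forall j, t j <= t j.+1) ->
  forall j, cons_time t j <= cons_time t j.+1.
Proof. by move=> t0 tS []. Qed.

(* The position at time [t 0] is summed out by countable additivity. *)
Lemma split_inc_joint_law (t : nat -> R) (J : nat) (y : nat -> nat * nat) :
  0 <= t 0%N -> (forall j, t j <= t j.+1) ->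
  pr P [set w | forall j, (j < J)%N -> split_inc (t j) (t j.+1) w = y j] =
  \prod_(j < J) split_law (t j.+1 - t j) (y j).
Proof.
move=> t0 tS; have cS := cons_time_mono t0 tS.
have t_ge0 j : 0 <= t j by rewrite (le_trans t0)// times_mono.
set C := [set w | _]; set c := \prod_(j < J) _.
have mC : measurable C.
  by apply: (@discrete_forall _ _ J _ (fun j => split_inc (t j) (t j.+1)) (fun j => [set y j])) => j; exact: split_inc_discrete.
have c0 : 0 <= c by apply: prodr_ge0 => j _; exact: pr_ge0.
have mV := split_pair_discrete t0.
have := @pr_atoms _ _ _ P _ _ _ C setT c setT mV mV mC measurableT c0.
rewrite (_ : [set w | _] = setT) ?setIT ?pr_setT ?mulr1; last by apply/seteqP; split.
apply => u; rewrite setTI.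
have := @split_joint_law (cons_time t) J.+1 (fun j => if j is j'.+1 then y j' else u) erefl cS.
rewrite big_ord_recl /= subr0 mulrC /c => <-; congr pr.
have E w : split_inc 0 (t 0%N) w = split_pair (t 0%N) w.
  by rewrite /split_inc !split_start// !subn0.
apply/seteqP; split => w /=.
  by move=> [h hu] [|j] /= jJ; rewrite ?E//; exact: h.
move=> h; split; first by move=> j jJ; exact: (h j.+1).
by rewrite -E; exact: (h 0%N).
Qed.

Lemma split_inc_law (u v : R) (y : nat * nat) : 0 <= u -> u <= v ->
  pr P [set w | split_inc u v w = y] = split_law (v - u) y.
Proof.
move=> u0 uv; pose t n : R := if n is 0%N then u else v.
have := @split_inc_joint_law t 1 (fun=> y) u0; rewrite big_ord1 /= => <-; last by case.
congr pr; apply/seteqP; split => w /=; first by move=> h [].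
by move=> /(_ 0%N isT).
Qed.

Section increments.
Variable (t : nat -> R).
Hypotheses (t0 : 0 <= t 0%N) (tS : forall j, t j <= t j.+1).

Let t_ge0 j : 0 <= t j.
Proof. by rewrite (le_trans t0)// times_mono. Qed.

Let V j := split_inc (t j) (t j.+1).

Let V_discrete j : discrete (V j).
Proof. exact: split_inc_discrete. Qed.

Lemma split_inc_atoms N (y : nat -> nat * nat) :
  pr P [set w | forall i, (i < N)%N -> V i w = y i] =
  \prod_(i < N) pr P [set w | V i w = y i].
Proof.
rewrite split_inc_joint_law//; apply: eq_bigr => i _.
by rewrite split_inc_law.
Qed.

Lemma split_inc_indep (s : seq nat) (B : nat -> set (nat * nat)) : uniq s ->
  pr P [set w | forall i, i \in s -> B i (V i w)] =
  \prod_(i <- s) pr P [set w | B i (V i w)].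
Proof. exact: (indep_uniq V_discrete split_inc_atoms). Qed.

End increments.

Definition side (b : bool) (y : nat * nat) : nat := if b then y.1 else y.2.

Lemma side_split_inc b u v w : side b (split_inc u v w) = (X b v w - X b u w)%N.
Proof. by case: b. Qed.

Lemma split_independent_increments b : independent_increments P (X b).
Proof.
move=> t t0 tS.
have t_ge0 j : 0 <= t j by rewrite (le_trans t0)// times_mono.
apply: pr_mutually_independent => [i|s B us].
  by apply: discrete_comp2; exact: split_discrete.
have := split_inc_indep t0 tS (fun i => [set y | B i (side b y)]) us.
rewrite (_ : [set w | _] = [set w | forall i, i \in s ->
  B i (X b (t i.+1) w - X b (t i) w)%N]); last first.
  by apply/seteqP; split => w /= h i si; have := h i si; rewrite side_split_inc.
move=> ->; apply: eq_bigr => i _; congr pr.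
by apply/seteqP; split => w /=; rewrite side_split_inc.
Qed.

Lemma split_stationary_increments b : stationary_increments P (X b).
Proof.
move=> s t h s0 t0 h0 B.
have mE (u : R) : 0 <= u ->
    measurable [set w | B (X b (u + h)%R w - X b u w)%N].
  move=> u0; apply: (@discrete_pre _ _ _ (fun w => X b (u + h)%R w - X b u w)%N B).
  by apply: discrete_comp2; apply: split_discrete; rewrite ?addr_ge0.
rewrite (prE _ (mE _ s0)) (prE _ (mE _ t0)); congr (_%:E).
have E u : [set w | B (X b (u + h)%R w - X b u w)%N] =
    [set w | (fun y => B (side b y)) (split_inc u (u + h) w)].
  by apply/seteqP; split => w /=; rewrite side_split_inc.
rewrite !E; apply: (@pr_law_eq _ _ _ P _ (split_inc s (s + h)) (split_inc t (t + h)) (fun y => B (side b y))).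
- by apply: split_inc_discrete; rewrite ?addr_ge0.
- by apply: split_inc_discrete; rewrite ?addr_ge0.
- by move=> y; rewrite !split_inc_law ?lerDl// !(addrC _ h) !addrK.
Qed.

Lemma split_counting b : counting_process (X b).
Proof.
split.
- by move=> t t0; apply/discrete_measurable_fun/split_discrete.
- by move=> w s t _; exact: (split_mono Z hM).
- by move=> w t t0; exact: (split_rc hM t0).
Qed.

Lemma split_sum (t : R) w : 0 <= t -> (X true t w + X false t w)%N = M t w.
Proof.
move=> t0; have M_mono : forall s t : R, 0 <= s -> s <= t -> (M s w <= M t w)%N.
  by move=> s s'; exact: (cp_nondecreasing (levy_counting_process hM)).
have M_rc : forall t : R, 0 <= t -> M s w @[s --> t^'+] --> M t w.
  by move=> s; exact: (cp_right_continuous (levy_counting_process hM)).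
have := path_sum_size M_mono M_rc t0; rewrite (levy_start hM) subn0 => <-.
rewrite /split_component /path_sum -fsbig_split/=; last exact: jump_times_finite.
by apply: eq_fsbigr => s _; rewrite /= (rule_sum hZ).
Qed.

End split_law.

(** * Coin flips *)

Lemma bigsetI_seq (T : Type) (I : eqType) (s : seq I) (F : I -> set T) :
  \big[setI/setT]_(i <- s) F i = [set w | forall i, i \in s -> F i w].
Proof.
elim: s => [|a s IH]; first by rewrite big_nil; apply/seteqP; split.
rewrite big_cons IH; apply/seteqP; split => w /=.
  by move=> [Fa h] i; rewrite inE => /predU1P[->//|]; exact: h.
by move=> h; split => [|i si]; apply: h; rewrite inE ?eqxx// si orbT.
Qed.

Section flips.
Context d (T : measurableType d) (R : realType) (P : probability T R).
Variables (p : R) (M : R -> T -> nat).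
Hypothesis M_meas : forall t : R, 0 <= t -> measurable_fun setT (M t).

Lemma sigma_process_measurable E : sigma_process nonneg_times M E -> measurable E.
Proof.
apply: smallest_sub; first exact: sigma_algebra_measurable.
by move=> _ [t t0 [B mB <-]]; have := M_meas t0 measurableT mB; rewrite setTI.
Qed.

Section one_family.
Variables (I : eqType) (xi : I -> T -> bool).
Hypothesis hxi : coin_flips P p M xi.

Lemma flip_discrete i : discrete (xi i).
Proof. by move=> c; have := flip_measurable hxi i measurableT (Y := [set c]) Logic.I; rewrite setTI. Qed.

Lemma flip_prob i c : pr P [set w | xi i w = c] = if c then p else 1 - p.
Proof.
have h : pr P [set w | xi i w = true] = p by rewrite /pr (flip_head hxi).
case: c => //; rewrite -[in RHS]h -prC; last exact: flip_discrete.
by congr pr; apply/seteqP; split => w /=; case: (xi i w).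
Qed.

Lemma flips_law (s : seq I) (B : I -> set bool) E :
  sigma_process nonneg_times M E -> uniq s ->
  pr P (E `&` [set w | forall x, x \in s -> B x (xi x w)]) =
  pr P E * \prod_(x <- s) pr P [set w | B x (xi x w)].
Proof.
move=> sE us; have mE := sigma_process_measurable sE.
set F := [set w | _].
have FE : F = \big[setI/setT]_(x <- s) (xi x @^-1` B x).
  by rewrite bigsetI_seq.
have sF : sigma_process [set: I] xi F.
  pose G := [set xi i @^-1` B | i in [set: I] & B in @measurable _ bool].
  have : measurable (F : set (g_sigma_algebraType G)).
    rewrite FE; apply: bigsetI_measurable => x _; apply: sub_sigma_algebra.
    by exists x => //; exists (B x).
  by [].
have mB x : measurable [set w | B x (xi x w)] by apply: discrete_pre; exact: flip_discrete.
have mF : measurable F by rewrite FE; apply: bigsetI_measurable => x _; exact: mB.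
apply: EFin_inj; rewrite -prE; last exact: measurableI.
rewrite (flip_process_independent hxi sE sF) EFinM -prE//; congr (_ * _)%E.
rewrite FE (flip_independent hxi)// -prodEFin; apply: eq_bigr => x _.
by rewrite prE//; exact: mB.
Qed.

Lemma flips_atoms (s : seq I) (c : I -> bool) E :
  sigma_process nonneg_times M E -> uniq s ->
  pr P (E `&` [set w | forall x, x \in s -> xi x w = c x]) =
  pr P E * \prod_(x <- s) (if c x then p else 1 - p).
Proof.
move=> sE us; rewrite (flips_law (fun x => [set c x]) sE us); congr (_ * _).
by apply: eq_bigr => x _; exact: flip_prob.
Qed.

End one_family.

Definition typeI_rule (eta : nat -> T -> bool) (b : bool) (m j : nat) (w : T) : nat :=
  if eta m w == b then j else 0%N.

Definition typeI_weight (j a : nat) : R := p * (a == j)%:R + (1 - p) * (a == 0%N)%:R.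

Lemma typeI_splitting_rule eta : coin_flips P p M eta ->
  splitting_rule P M typeI_weight (typeI_rule eta).
Proof.
move=> heta; split.
- by move=> m j w; rewrite /typeI_rule; case: (eta m w); rewrite ?addn0.
- move=> b m j; exact: (discrete_comp (fun c : bool => if c == b then j else 0%N) (flip_discrete heta m)).
- by rewrite /typeI_weight eqxx !mulr1 addrC subrK.
move=> E I r j a sE uI rinj.
pose B i := [set c : bool | (if c then j i else 0%N) = a i].
(* A left inverse of [r] on [I]: a condition on cell i becomes a condition on the flip of index
   [r i]. Outside the image of [r] the default value is never consulted. *)
pose inv m := nth 0%N I (index m (map r I)).
have rK i : i \in I -> inv (r i) = i.
  move=> iI; have lt_idx : (index (r i) (map r I) < size I)%N.
    by rewrite -(size_map r) index_mem map_f.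
  by apply: rinj; rewrite ?mem_nth// -(nth_map 0%N 0%N r lt_idx) nth_index ?map_f.
have us : uniq (map r I) by rewrite map_inj_in_uniq.
have := flips_law heta (fun m => B (inv m)) sE us.
rewrite big_map (_ : [set w | _] =
   [set w | forall i, i \in I -> typeI_rule eta true (r i) (j i) w = a i]); last first.
  apply/seteqP; split => w /= h.
    by move=> i iI; have := h (r i) (map_f r iI); rewrite rK// /typeI_rule eqb_id.
  by move=> m /mapP[i iI ->]; rewrite rK//; have := h i iI; rewrite /typeI_rule eqb_id.
(* The probability is split along the two outcomes of the flip, each counted when compatible with
   [a i]. For a jump of size 0 both are compatible, and the weight is p + (1 - p). *)
move=> ->; congr (_ * _); apply: eq_big_seq => i iI; rewrite rK//.
rewrite (@pr_fin_disj _ _ _ P bool _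
   (fun c => if (if c then j i else 0%N) == a i then [set w | eta (r i) w = c] else set0)).
- rewrite big_bool /typeI_weight /= !(eq_sym (a i)); congr (_ + _).
  + by case: ifP => _; rewrite ?pr_set0 ?mulr0// mulr1 (flip_prob heta).
  + by case: ifP => _; rewrite ?pr_set0 ?mulr0// mulr1 (flip_prob heta).
- by move=> c; case: ifP => // _; exact: flip_discrete.
- move=> w; rewrite /B /=; split.
    by move=> h; exists (eta (r i) w); rewrite h eqxx.
  by move=> [c]; case: ifP => // /eqP ac /= ->.
- by move=> c c' w; case: ifP => // _; case: ifP => // _ /= -> ->.
Qed.

Definition typeII_rule (xi : nat * nat -> T -> bool) (b : bool) (m j : nat) (w : T) : nat :=
  (\sum_(i < j) (xi (m, nat_of_ord i) w == b))%N.

Definition typeII_weight (j a : nat) : R := 'C(j, a)%:R * p ^+ a * (1 - p) ^+ (j - a).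

Lemma typeII_weightS j a : typeII_weight j.+1 a =
  (if a is a'.+1 then typeII_weight j a' * p else 0) + typeII_weight j a * (1 - p).
Proof.
rewrite /typeII_weight; case: a => [|a].
  by rewrite !bin0 !subn0 exprS add0r; ring.
(* For j <= a the truncated exponent [j - a.+1] is off by one, but its binomial coefficient
   vanishes. *)
rewrite binS natrD subSS; have [ja|ja] := leqP j a.
  have -> : 'C(j, a.+1) = 0%N by rewrite bin_small.
  by rewrite exprS; ring.
by rewrite -[(j - a)%N]prednK ?subn_gt0// subnS !exprS; ring.
Qed.

Lemma typeII_rule_discrete xi b m j : coin_flips P p M xi -> discrete (typeII_rule xi b m j).
Proof.
move=> hxi.
apply: (@discrete_sum _ _ j (fun i w => nat_of_bool (xi (m, i) w == b))) => i _.
exact: (discrete_comp (fun c : bool => nat_of_bool (c == b)) (flip_discrete hxi _)).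
Qed.

Lemma typeII_ruleS xi m n w :
  typeII_rule xi true m n.+1 w = (typeII_rule xi true m n w + xi (m, n) w)%N.
Proof. by rewrite /typeII_rule big_ord_recr /= eqb_id. Qed.

(** E has probability e and is independent of the flips outside [used]. Adding the first n flips of
    batch m keeps this form, with these flips counted as used; the weight grows by Pascal's rule as
    the flips are revealed one by one. *)
Lemma typeII_batch xi (E : set T) (e : R) (used : pred (nat * nat)) (m n a : nat) :
  coin_flips P p M xi -> measurable E ->
  (forall s c, uniq s -> {in s, forall x, ~~ used x} ->
    pr P (E `&` [set w | forall x, x \in s -> xi x w = c x]) =
    e * \prod_(x <- s) (if c x then p else 1 - p)) ->
  (forall l, ~~ used (m, l)) ->
  forall s c, uniq s -> {in s, forall x, ~~ (used x || (x.1 == m) && (x.2 < n)%N)} ->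
    pr P (E `&` [set w | typeII_rule xi true m n w = a] `&`
          [set w | forall x, x \in s -> xi x w = c x]) =
    e * typeII_weight n a * \prod_(x <- s) (if c x then p else 1 - p).
Proof.
move=> hxi mE HE hm; have mcyl (s : seq (nat * nat)) (c : nat * nat -> bool) :
    measurable [set w | forall x, x \in s -> xi x w = c x].
  rewrite (_ : [set w | _] = \big[setI/setT]_(x <- s) [set w | xi x w = c x]).
    by apply: bigsetI_measurable => x _; exact: flip_discrete.
  by rewrite bigsetI_seq.
elim: n a => [|n IH] a s c us hs.
  have r0 w : typeII_rule xi true m 0 w = 0%N by rewrite /typeII_rule big_ord0.
  case: a => [|a].
    rewrite /typeII_weight bin0 !expr0 !mulr1 -HE//; last first.
      by move=> x /hs; rewrite negb_or => /andP[].
    congr pr; apply/seteqP; split => w /=; first by move=> [[]].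
    by move=> [Ew h]; rewrite r0.
  rewrite /typeII_weight bin0n/= !mul0r mulr0 mul0r (_ : _ `&` _ = set0) ?pr_set0//.
  by apply/seteqP; split => w //= [[_]]; rewrite r0.
(* The flip (m, n) is moved into the prescribed outcomes, with value b, so that the induction
   hypothesis for the first n flips applies. *)
pose c' b x := if x == (m, n) then b else c x.
have mns : (m, n) \notin s.
  by apply/negP => /hs; rewrite /= eqxx ltnS leqnn orbT.
pose F a' b := E `&` [set w | typeII_rule xi true m n w = a'] `&`
          [set w | forall x, x \in (m, n) :: s -> xi x w = c' b x].
have FE a' b : pr P (F a' b) = e * typeII_weight n a' *
   ((if b then p else 1 - p) * \prod_(x <- s) (if c x then p else 1 - p)).
  rewrite /F IH; last 2 first.
  - by rewrite /= mns.
  - move=> x; rewrite inE => /predU1P[->|xs]; first by rewrite /= ltnn andbF orbF.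
    by apply: contra (hs _ xs) => /orP[->//|/andP[-> h]]; rewrite (leqW h) orbT.
  rewrite big_cons /c' eqxx; congr (_ * (_ * _)); apply: eq_big_seq => x xs.
  by case: eqP => // xE; rewrite -xE xs in mns.
have cE b w : (forall x, x \in (m, n) :: s -> xi x w = c' b x) <->
    xi (m, n) w = b /\ forall x, x \in s -> xi x w = c x.
  split.
    move=> h; split; first by rewrite h ?inE ?eqxx// /c' eqxx.
    move=> x xs; rewrite h ?inE ?xs ?orbT// /c'.
    by case: eqP => // xE; rewrite -xE xs in mns.
  move=> [h1 h2] x; rewrite inE /c' => /predU1P[->|xs]; first by rewrite eqxx.
  by case: eqP => [->//|_]; exact: h2.
rewrite (@pr_fin_disj _ _ _ P bool _
  (fun b => if b then (if a is a'.+1 then F a' true else set0) else F a false)).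
- rewrite big_bool /= typeII_weightS FE; case: (a) => [|a'].
    by rewrite pr_set0; ring.
  by rewrite FE; ring.
- have mF a' b : measurable (F a' b).
    by apply: measurableI => //; apply: measurableI => //; exact: typeII_rule_discrete.
  by move=> [|] //; case: (a).
- move=> w; split.
  + move=> [[Ew]] /=; rewrite typeII_ruleS => aE hw; exists (xi (m, n) w).
    move: aE; case: (a) => [|a'] aE; case E0 : (xi (m, n) w) aE => aE.
    * by move: aE; rewrite addn1.
    * by split; [split => //; rewrite -aE addn0|apply/cE].
    * by split; [split => //=; apply/succn_inj; rewrite -aE addn1|apply/cE].
    * by split; [split => //; rewrite -aE addn0|apply/cE].
  + move=> [[|]].
      case: (a) => [//|a'] [[Ew /= aE]] /cE[x1 hs']; split => //; split => //=.
      by rewrite typeII_ruleS aE x1 addn1.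
    move=> [[Ew /= aE]] /cE[x1 hs']; split => //; split => //=.
    by rewrite typeII_ruleS aE x1 addn0.
- have h a' b w : F a' b w -> xi (m, n) w = b by move=> [_ /cE[]].
  move=> [] [] w //.
    by case: (a) => [|a'] // /h h1 /h; rewrite h1.
  by case: (a) => [|a'] // /h h1 /h; rewrite h1.
Qed.

Lemma typeII_splitting_rule xi : coin_flips P p M xi ->
  splitting_rule P M typeII_weight (typeII_rule xi).
Proof.
move=> hxi; split.
- move=> m j w; rewrite /typeII_rule -big_split /= -[RHS]card_ord -sum1_card.
  by apply: eq_bigr => i _; case: (xi _ _).
- by move=> b m j; exact: typeII_rule_discrete.
- by rewrite /typeII_weight bin0 !mulr1.
move=> E I r j a sE; have mE := sigma_process_measurable sE.
(* The induction on the list of cells also asserts independence from the flips of all other batches.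
   Since [r] is injective on [I], the next batch is among those. *)
suff H : uniq I -> {in I &, injective r} -> 
    measurable (E `&` [set w | forall i, i \in I -> typeII_rule xi true (r i) (j i) w = a i]) /\
    forall s c, uniq s -> {in s, forall x, ~~ (x.1 \in map r I)} ->
    pr P (E `&` [set w | forall i, i \in I -> typeII_rule xi true (r i) (j i) w = a i] `&`
       [set w | forall x, x \in s -> xi x w = c x]) =
    (pr P E * \prod_(i <- I) typeII_weight (j i) (a i)) *
    \prod_(x <- s) (if c x then p else 1 - p).
  move=> uI rinj; have [_ /(_ [::] (fun=> true) erefl)] := H uI rinj.
  rewrite big_nil mulr1 => <- //; congr pr; apply/seteqP; split => w /=; last by case.
  by move=> h; split.
elim: I => [|i I IH] /=.
  move=> _ _; have EE : E `&` [set w | forall i, i \in [::] -> typeII_rule xi true (r i) (j i) w = a i] = E.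
    by apply/seteqP; split => w /=; [case|split].
  rewrite EE; split => // s c us _; rewrite big_nil mulr1; exact: flips_atoms.
move=> /andP[iI uI] rinj.
have rinjI : {in I &, injective r}.
  by move=> x y xI yI; apply: rinj; rewrite inE ?xI ?yI orbT.
have [mEI HE] := IH uI rinjI.
have riI : r i \notin map r I.
  apply/negP => /mapP[i' i'I /rinj]; rewrite !inE eqxx i'I orbT => /(_ isT isT) ii'.
  by rewrite ii' i'I in iI.
have EE : E `&` [set w | forall i', i' \in i :: I -> typeII_rule xi true (r i') (j i') w = a i'] =
  E `&` [set w | forall i, i \in I -> typeII_rule xi true (r i) (j i) w = a i] `&`
  [set w | typeII_rule xi true (r i) (j i) w = a i].
  apply/seteqP; split => w /=.
    move=> [Ew h]; split; last by apply: h; rewrite inE eqxx.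
    by split => // i' i'I; apply: h; rewrite inE i'I orbT.
  by move=> [[Ew h] hi]; split => // i'; rewrite inE => /predU1P[->//|]; exact: h.
rewrite EE; split; first by apply: measurableI => //; exact: typeII_rule_discrete.
move=> s c us hs; rewrite big_cons.
rewrite (typeII_batch (used := fun x => x.1 \in map r I) _ hxi mEI HE) //.
  by ring.
move=> x xs; apply: contra (hs x xs); rewrite inE => /orP[->|/andP[-> _]//].
by rewrite orbT.
Qed.

End flips.

(** * Independence of generated sigma-algebras *)

Section pi_systems.
Context d (T : measurableType d) (R : realType) (P : probability T R).

Lemma sigma_sub_measurable (G : set (set T)) :
  (forall A, G A -> measurable A) -> forall A, <<s G >> A -> measurable A.
Proof.
by move=> GT A; apply: smallest_sub => //; exact: sigma_algebra_measurable.
Qed.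

(** The events satisfying the product formula with a fixed C form a Dynkin system. *)
Lemma indep_sigma_left (G : set (set T)) (C : set T) :
  setI_closed G -> (forall A, G A -> measurable A) -> measurable C ->
  (forall A, G A -> pr P (A `&` C) = pr P A * pr P C) ->
  forall A, <<s G >> A -> pr P (A `&` C) = pr P A * pr P C.
Proof.
move=> GI GT mC HG A sA; have mG := sigma_sub_measurable GT.
have HC (S : set T) : measurable S -> pr P (S `&` C) = pr P S * pr P C ->
    pr P (~` S `&` C) = pr P (~` S) * pr P C.
  move=> mS IH; have mSC := measurableI _ _ mS mC.
  have -> : ~` S `&` C = C `\` (S `&` C).
    apply/seteqP; split => w /=; first by move=> [nS Cw]; split => // -[].
    by move=> [Cw nSC]; split => // Sw; exact: nSC.
  have SC : S `&` C `<=` C by move=> w [].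
  rewrite (pr_setD _ mC mSC SC).
  by rewrite prC// IH; ring.
have HU (F : nat -> set T) : (forall n, measurable (F n)) -> trivIset setT F ->
    (forall n, pr P (F n `&` C) = pr P (F n) * pr P C) ->
    pr P (\bigcup_n F n `&` C) = pr P (\bigcup_n F n) * pr P C.
  move=> mF tF IH; have mFC n : measurable (F n `&` C) by exact: measurableI.
  have mU : measurable (\bigcup_n F n) by exact: bigcup_measurable.
  apply: EFin_inj; rewrite mulrC EFinM -!prE//; last exact: measurableI.
  rewrite setI_bigcupl !measure_semi_bigcup//; last 2 first.
  - exact: trivIset_setIr.
  - by rewrite -setI_bigcupl; exact: measurableI.
  rewrite [in RHS](prE P mC) -nneseriesZl//; apply: eq_eseriesr => n _.
  transitivity ((pr P C)%:E * (pr P (F n))%:E)%E; last first.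
    by congr (_ * _)%E; apply/esym/prE; exact: mF.
  by rewrite [LHS](prE P (mFC n)) -EFinM IH mulrC.
apply: (@dynkin_induction _ (g_sigma_algebraType G) G
  (fun A => pr P (A `&` C) = pr P A * pr P C)) => //.
- by rewrite setTI pr_setT mul1r.
- by move=> S /mG; exact: HC.
- by move=> F mF; apply: HU => n; apply: mG; exact: mF.
Qed.

Lemma indep_sigma (G1 G2 : set (set T)) :
  setI_closed G1 -> setI_closed G2 ->
  (forall A, G1 A -> measurable A) -> (forall A, G2 A -> measurable A) ->
  (forall A B, G1 A -> G2 B -> pr P (A `&` B) = pr P A * pr P B) ->
  forall A B, <<s G1 >> A -> <<s G2 >> B -> pr P (A `&` B) = pr P A * pr P B.
Proof.
move=> G1I G2I G1T G2T H A B sA sB.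
have mA := sigma_sub_measurable G1T sA.
rewrite setIC mulrC; apply: (indep_sigma_left G2I G2T mA _ sB) => {sB}B GB.
rewrite setIC mulrC; apply: (indep_sigma_left G1I G1T (G2T _ GB) _ sA) => {sA mA}A GA.
exact: H.
Qed.

(** [pr_atoms] with a factor on each side: divide by c; if c = 0 and c' is nonzero, every atom of C'
    is null. *)
Lemma pr_atoms2 (U : countType) (V : T -> U) (C C' : set T) (c c' : R) :
  discrete V -> measurable C -> measurable C' -> 0 <= c -> 0 <= c' ->
  (forall u, c * pr P (C `&` [set w | V w = u]) = c' * pr P (C' `&` [set w | V w = u])) ->
  c * pr P C = c' * pr P C'.
Proof.
move=> mV mC mC' c0 c'0 H.
have VT : [set w | setT (V w)] = setT by apply/seteqP; split.
have sum (D D' : set T) k : measurable D -> measurable D' -> 0 <= k ->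
    (forall u, pr P (D `&` [set w | V w = u]) = k * pr P (D' `&` [set w | V w = u])) ->
    pr P D = k * pr P D'.
  move=> mD mD' k0 /(pr_atoms setT mV mV mD mD' k0).
  by rewrite VT !setIT.
have [cE|cN] := eqVneq c 0.
  have [->|c'N] := eqVneq c' 0; first by rewrite cE !mul0r.
  rewrite cE mul0r (sum C' C 0) ?mul0r ?mulr0// => u; apply/eqP.
  by rewrite mul0r -(mulrI_eq0 _ (lregP c'N)) -H cE mul0r.
rewrite (sum C C' (c^-1 * c'))//.
- by rewrite mulrA mulVKf.
- by rewrite mulr_ge0 ?invr_ge0.
- by move=> u; rewrite -mulrA -H mulKf.
Qed.

(** Summing the vanishing minors over v', and then over u', yields f u v = P(A = u) P(B = v). Minors
    are a convenient hypothesis because they pass to limits and products without control of any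
    factors. *)
Lemma rank_one_indep (U U' : countType) (A : T -> U) (B : T -> U')
    (SA : set U) (SB : set U') : discrete A -> discrete B ->
  let f u v := pr P [set w | A w = u /\ B w = v] in
  (forall u u' v v', f u v * f u' v' = f u v' * f u' v) ->
  pr P ([set w | SA (A w)] `&` [set w | SB (B w)]) =
  pr P [set w | SA (A w)] * pr P [set w | SB (B w)].
Proof.
move=> mA mB f H.
have f0 u v : 0 <= f u v by exact: pr_ge0.
have H1 u u' v : f u v * pr P [set w | A w = u'] = f u' v * pr P [set w | A w = u].
  apply: (pr_atoms2 mB) => // v'.
  by have := H u u' v v'; rewrite /f /setI/= => ->; rewrite mulrC.
have H2 u v : f u v = pr P [set w | A w = u] * pr P [set w | B w = v].
  have := @pr_atoms2 _ A setT [set w | B w = v] (f u v) (pr P [set w | A w = u]) mA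
    measurableT (mB v) (f0 _ _) (pr_ge0 _ _).
  rewrite pr_setT mulr1; apply => u'; rewrite setTI H1 mulrC; congr (_ * _).
  by rewrite /f; congr pr; apply/seteqP; split => w /= [].
apply: (pr_indep_atoms SB mB); first exact: discrete_pre.
move=> v; rewrite setIC mulrC; apply: (pr_indep_atoms SA mA (mB v)) => u.
by rewrite mulrC -H2 /f; congr pr; apply/seteqP; split => w /= [].
Qed.

End pi_systems.

(** * Asymptotic independence of whole-jump splitting *)

Section convolution_bounds.
Context (R : realType).
Implicit Types (m n F : nat * nat -> R) (y : nat * nat).

(** A convolution evaluated at y involves only the points below y, so these finite sums replace l^1
    norms. *)
Definition box_sum F y : R := \sum_(a < y.1.+1) \sum_(b < y.2.+1) F (val a, val b).

Lemma box_sum_rev F y :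
  \sum_(a < y.1.+1) \sum_(b < y.2.+1) F (y.1 - a, y.2 - b)%N = box_sum F y.
Proof.
rewrite /box_sum (reindex_inj rev_ord_inj); apply: eq_bigr => a _.
rewrite (reindex_inj rev_ord_inj); apply: eq_bigr => b _ /=.
by rewrite !subSS !subKn// -ltnS.
Qed.

Lemma pair_convn_ge0 m r y : (forall y, 0 <= m y) -> 0 <= pair_convn m r y.
Proof.
move=> m0; elim: r y => [|r IH] y /=; first exact: ler0n.
by apply: sumr_ge0 => a _; apply: sumr_ge0 => b _; apply: mulr_ge0.
Qed.

Lemma pair_convn_le1 m r y : (forall y, 0 <= m y) -> (forall y, box_sum m y <= 1) ->
  pair_convn m r y <= 1.
Proof.
move=> m0 m1; elim: r y => [|r IH] y /=; first by case: (_ == _).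
apply: le_trans (m1 y); rewrite -box_sum_rev; apply: ler_sum => a _.
by apply: ler_sum => b _; rewrite ler_piMl.
Qed.

(** The factors are exchanged one at a time, through m^(r+1) - n^(r+1) = m^r (m - n) + (m^r - n^r) n
    for convolution powers. Each exchange costs at most e, as the powers of m are bounded by 1 and n
    has mass at most 1. *)
Lemma pair_convn_diff m n e r y :
  (forall y, 0 <= m y) -> (forall y, box_sum m y <= 1) ->
  (forall y, 0 <= n y) -> (forall y, box_sum n y <= 1) ->
  (forall y, box_sum (fun y => `|m y - n y|) y <= e) ->
  `|pair_convn m r y - pair_convn n r y| <= r%:R * e.
Proof.
move=> m0 m1 n0 n1 mn; have e0 : 0 <= e.
  by apply: le_trans (mn (0, 0)%N); apply: sumr_ge0 => a _; apply: sumr_ge0.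
elim: r y => [|r IH] y; first by rewrite subrr normr0 mul0r.
rewrite /= /pair_conv -sumrB.
under eq_bigr do rewrite -sumrB.
apply: (@le_trans _ _ (\sum_(a < y.1.+1) \sum_(b < y.2.+1)
   (`|m (y.1 - a, y.2 - b)%N - n (y.1 - a, y.2 - b)%N| +
    r%:R * e * n (y.1 - a, y.2 - b)%N))).
  apply: (le_trans (ler_norm_sum _ _ _)); apply: ler_sum => a _.
  apply: (le_trans (ler_norm_sum _ _ _)); apply: ler_sum => b _.
  set y' := (_ - _, _)%N; set x := (val a, val b).
  rewrite (_ : _ - _ = pair_convn m r x * (m y' - n y') + (pair_convn m r x - pair_convn n r x) * n y'); last by ring.
  apply: (le_trans (ler_normD _ _)); rewrite !normrM; apply: lerD.
    by rewrite ler_piMl// ger0_norm ?pair_convn_ge0// pair_convn_le1.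
  by rewrite (ger0_norm (n0 y')) ler_wpM2r.
under eq_bigr do rewrite big_split /= -mulr_sumr.
rewrite big_split /= -mulr_sumr (box_sum_rev (fun y => `|m y - n y|)) box_sum_rev.
rewrite -natr1 mulrDl mul1r addrC; apply: lerD; last exact: mn.
by rewrite ler_piMr// mulr_ge0.
Qed.

Lemma pair_convn_product (f g : nat -> R) r : exists F G : nat -> R,
  forall y, pair_convn (fun y => f y.1 * g y.2) r y = F y.1 * G y.2.
Proof.
elim: r => [|r [F [G FG]]].
  exists (fun a => (a == 0%N)%:R), (fun b => (b == 0%N)%:R) => -[a b] /=.
  by rewrite xpair_eqE -natrM mulnb.
exists (fun x => \sum_(a < x.+1) F a * f (x - a)%N),
  (fun x => \sum_(b < x.+1) G b * g (x - b)%N) => y /=.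
rewrite /pair_conv big_distrl; apply: eq_bigr => a _; rewrite big_distrr.
by apply: eq_bigr => b _; rewrite FG /=; ring.
Qed.

Lemma box_sum_product (f g : nat -> R) y : box_sum (fun y => f y.1 * g y.2) y =
  (\sum_(a < y.1.+1) f a) * (\sum_(b < y.2.+1) g b).
Proof. by rewrite big_distrl; apply: eq_bigr => a _; rewrite big_distrr. Qed.

End convolution_bounds.

Lemma mesh_cvg (R : realType) (h : R) : 0 < h -> h / n.+1%:R @[n --> \oo] --> 0^'+.
Proof.
move=> h0 A [e /= e0 He].
have : h / n.+1%:R @[n --> \oo] --> h * 0 by apply: cvgMr; exact: cvg_harmonic.
rewrite mulr0 => /cvgrPdist_lt/(_ e e0) H.
change (\forall n \near \oo, A (h / n.+1%:R)).
by apply: filterS H => n Hn; apply: He => //=; rewrite divr_gt0.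
Qed.

Section law_facts.
Context d (T : measurableType d) (R : realType) (P : probability T R).
Variable (M : R -> T -> nat).
Hypothesis hM : levy_counting P M.

Lemma law_ge0 h n : 0 <= law P M h n. Proof. exact: pr_ge0. Qed.

Lemma law_sum_lt h N : 0 <= h -> \sum_(n < N) law P M h n = pr P [set w | (M h w < N)%N].
Proof.
move=> h0; have mM := levy_discrete hM h0.
rewrite (@pr_fin_disj _ _ _ P 'I_N _ (fun n => [set w | M h w = n])).
- by [].
- by move=> n; exact: mM.
- move=> w /=; split; first by move=> hN; exists (Ordinal hN).
  by move=> [n ->].
- by move=> i j w /= -> /val_inj.
Qed.

Lemma law_sum_le1 h N : 0 <= h -> \sum_(n < N) law P M h n <= 1.
Proof.
move=> h0; rewrite law_sum_lt//; apply: pr_le1.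
exact: (discrete_pre (fun n => (n < N)%N) (levy_discrete hM h0)).
Qed.

Lemma law0 n : law P M 0 n = (n == 0%N)%:R.
Proof.
rewrite /law; have [->|n0] := eqVneq n 0%N.
  rewrite (_ : [set w | _] = setT) ?pr_setT//.
  by apply/seteqP; split => // w _ /=; exact: levy_start hM w.
rewrite (_ : [set w | _] = set0) ?pr_set0//.
by apply/seteqP; split => // w /= E; move: n0; rewrite -E (levy_start hM).
Qed.

End law_facts.

Section typeI.
Context d (T : measurableType d) (R : realType) (P : probability T R).
Variables (M : R -> T -> nat) (p Lam : R) (Z : bool -> nat -> nat -> T -> nat).
Hypothesis hp : 0 <= p <= 1.
Hypothesis hM : levy_counting P M.
Hypothesis hZ : splitting_rule P M (typeI_weight p) Z.
Hypothesis no_jump_rate : (1 - law P M h 0%N) / h @[h --> 0^'+] --> Lam.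

Let q h n := law P M h n.
(** [f1] and [f2] are the marginals of [mu h]: a component receives the whole increment or nothing.
    [nu h] is their product. *)
Let f1 h a := p * q h a + (1 - p) * (a == 0%N)%:R.
Let f2 h b := (1 - p) * q h b + p * (b == 0%N)%:R.
Let nu h (y : nat * nat) := f1 h y.1 * f2 h y.2.
Let mu h := thin P M (typeI_weight p) h.

Lemma thinI h y : mu h y = p * q h y.1 * (y.2 == 0%N)%:R + (1 - p) * q h y.2 * (y.1 == 0%N)%:R.
Proof.
case: y => a b; rewrite /mu /thin /typeI_weight /q /=.
have -> : (a == a + b)%N = (b == 0%N) by lia.
by case: (eqVneq b 0%N) => [->|_]; case: (eqVneq a 0%N) => [->|_];
  rewrite /= ?addn0 ?add0n; ring.
Qed.

Let sum_delta (A : nat) : \sum_(a < A.+1) (val a == 0%N)%:R = 1 :> R.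
Proof. by rewrite big_ord_recl big1 ?addr0. Qed.

Lemma thinI_box h y : 0 <= h -> box_sum (mu h) y <= 1.
Proof.
move=> h0; have [p0 p1] := andP hp.
rewrite (_ : box_sum _ _ = p * (\sum_(a < y.1.+1) q h a) + (1 - p) * \sum_(b < y.2.+1) q h b).
  have h1 := law_sum_le1 hM y.1.+1 h0; have h2 := law_sum_le1 hM y.2.+1 h0.
  have e1 := ler_piMr p0 h1; have q0 : 0 <= 1 - p by rewrite subr_ge0.
  by have e2 := ler_piMr q0 h2; rewrite /q; lra.
transitivity (\sum_(a < y.1.+1) \sum_(b < y.2.+1) (p * q h a * (val b == 0%N)%:R +
   (1 - p) * q h b * (val a == 0%N)%:R)).
  by apply: eq_bigr => a _; apply: eq_bigr => b _; rewrite thinI.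
under eq_bigr do rewrite big_split /= -mulr_sumr sum_delta mulr1 -mulr_suml.
by rewrite big_split /= -!mulr_sumr sum_delta mulr1.
Qed.

Let f_sum h A (x : R) : 0 <= h -> 0 <= x <= 1 ->
  \sum_(a < A.+1) (x * q h a + (1 - x) * (val a == 0%N)%:R) <= 1.
Proof.
move=> h0 /andP[x0 x1]; rewrite big_split /= -!mulr_sumr sum_delta mulr1.
by have e := ler_piMr x0 (law_sum_le1 hM A.+1 h0); rewrite /q; lra.
Qed.

Lemma nu_box h y : 0 <= h -> box_sum (nu h) y <= 1.
Proof.
move=> h0; have [p0 p1] := andP hp; rewrite box_sum_product.
have s1 := f_sum y.1 h0 hp.
have := @f_sum h y.2 (1 - p) h0; rewrite subKr => s2.
apply: mulr_ile1 => //.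
- apply: sumr_ge0 => a _; rewrite addr_ge0// mulr_ge0// ?law_ge0 ?subr_ge0 ?ler0n//.
- apply: sumr_ge0 => a _; rewrite addr_ge0// mulr_ge0// ?law_ge0 ?subr_ge0 ?ler0n//.
- by apply: s2; rewrite subr_ge0 p1 gerBl.
Qed.

(** The mass 1 - q 0 appears once at 0 and at most once more over the positive values. The factor 2
    becomes 4 in the product of the two components. *)
Let dist_delta h A : 0 <= h ->
  \sum_(a < A.+1) `|q h a - (val a == 0%N)%:R| <= 2 * (1 - q h 0%N).
Proof.
move=> h0; rewrite big_ord_recl /=.
have := law_sum_le1 hM A.+1 h0; rewrite big_ord_recl /= -/(q h 0%N).
have q1 : q h 0%N <= 1 by have := law_sum_le1 hM 1 h0; rewrite big_ord1.
have -> : \sum_(i < A) `|q h (bump 0 i) - (bump 0 i == 0%N)%:R| = \sum_(i < A) law P M h (bump 0 i).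
  by apply: eq_bigr => i _; rewrite subr0 ger0_norm// law_ge0.
rewrite ler0_norm ?subr_le0//; lra.
Qed.

(* [mu - nu] factors as [- p (1 - p) (q a - (a == 0)) (q b - (b == 0))]. *)
Lemma thinI_nu h y : 0 <= h ->
  box_sum (fun y => `|mu h y - nu h y|) y <= 4 * (1 - q h 0%N) ^+ 2.
Proof.
move=> h0; have [p0 p1] := andP hp.
have E y' : `|mu h y' - nu h y'| = p * (1 - p) *
    (`|q h y'.1 - (y'.1 == 0%N)%:R| * `|q h y'.2 - (y'.2 == 0%N)%:R|).
  rewrite thinI /nu /f1 /f2 -normrM -[p * (1 - p)]ger0_norm ?mulr_ge0 ?subr_ge0//.
  by rewrite -normrM -normrN; congr `|_|; case: (_ == _); case: (_ == _); ring.
rewrite /box_sum; under eq_bigr do under eq_bigr do rewrite E.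
rewrite /=; under eq_bigr do rewrite -mulr_sumr -mulr_sumr.
rewrite -mulr_sumr -mulr_suml.
have h1 := dist_delta y.1 h0; have h2 := dist_delta y.2 h0.
have n1 : 0 <= \sum_(a < y.1.+1) `|q h a - (val a == 0%N)%:R| by apply: sumr_ge0.
have n2 : 0 <= \sum_(a < y.2.+1) `|q h a - (val a == 0%N)%:R| by apply: sumr_ge0.
apply: (@le_trans _ _ (1 * (2 * (1 - q h 0%N) * (2 * (1 - q h 0%N))))); last first.
  by rewrite mul1r le_eqVlt; apply/orP; left; apply/eqP; ring.
apply: ler_pM => //.
- by rewrite mulr_ge0// subr_ge0.
- by rewrite mulr_ge0.
- by rewrite mulr_ile1// ?subr_ge0// gerBl.
- exact: ler_pM.
Qed.

(** With u = h / (n + 1), the expression equals 4 h ((1 - q u 0) / u)^2 u; the quotient converges to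
    [Lam] and u tends to 0. *)
Lemma mesh_error (h : R) : 0 <= h ->
  n.+1%:R * (4 * (1 - q (h / n.+1%:R) 0%N) ^+ 2) @[n --> \oo] --> 0.
Proof.
rewrite le_eqVlt => /predU1P[<-|h0].
  apply: cvg_near_cst; apply: nearW => n.
  by rewrite mul0r /q law0// eqxx subrr expr0n !mulr0.
have c1 := cvg_comp _ _ (mesh_cvg h0) no_jump_rate.
have c0 : h / n.+1%:R @[n --> \oo] --> 0.
  by apply: (cvg_trans (mesh_cvg h0)); exact: cvg_within.
have := cvgM (cvgM (cvg_cst (4 * h)) (cvgM c1 c1)) c0.
rewrite mulr0 => H; apply: cvg_trans (H _ _ _ _); apply: near_eq_cvg; apply: nearW => n /=.
rewrite /q /GRing.mul_fun /=; field.
by rewrite gt_eqF//= gt_eqF.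
Qed.

(** By [mesh_error] the convolution powers of [nu] have the same limit as those of [mu]. They are
    products, so their minors vanish, hence those of the limit vanish too. *)
Lemma split_law_rank_one h a b a' b' : 0 <= h ->
  let rho := split_law P M Z h in
  rho (a, b) * rho (a', b') = rho (a, b') * rho (a', b).
Proof.
move=> h0 rho; have [p0 p1] := andP hp.
have mesh0 n : 0 <= h / n.+1%:R by rewrite divr_ge0.
have c y : pair_convn (nu (h / n.+1%:R)) n.+1 y @[n --> \oo] --> rho y.
  have c1 : pair_convn (mu (h / n.+1%:R)) n.+1 y @[n --> \oo] --> rho y.
    exact: (split_law_limit hM hZ h0).
  suff c2 : pair_convn (nu (h / n.+1%:R)) n.+1 y - pair_convn (mu (h / n.+1%:R)) n.+1 y @[n --> \oo] --> 0.
    have := cvgD c2 c1; rewrite add0r => H; apply: cvg_trans (H _); apply: near_eq_cvg.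
    by apply: nearW => n /=; rewrite /GRing.add_fun /= subrK.
  apply/cvgr0Pnorm_lt => e e0.
  have /cvgr0Pnorm_lt/(_ e e0) := mesh_error h0; apply: filterS => n.
  apply: le_lt_trans; rewrite (ger0_norm (x := _ * _)); last first.
    by rewrite mulr_ge0// mulr_ge0// sqr_ge0.
  rewrite distrC; apply: pair_convn_diff => y'.
  - rewrite thinI; apply: addr_ge0; rewrite !mulr_ge0 ?law_ge0 ?subr_ge0 ?ler0n//.
  - exact: thinI_box.
  - by rewrite mulr_ge0// addr_ge0// mulr_ge0 ?law_ge0 ?subr_ge0 ?ler0n.
  - exact: nu_box.
  - exact: thinI_nu.
pose C n y := pair_convn (nu (h / n.+1%:R)) n.+1 y.
have L : C n (a, b) * C n (a', b') @[n --> \oo] --> rho (a, b) * rho (a', b').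
  exact: cvgM (c _) (c _).
have L' : C n (a, b') * C n (a', b) @[n --> \oo] --> rho (a, b') * rho (a', b).
  exact: cvgM (c _) (c _).
apply: (cvg_unique _ L) => //; apply: cvg_trans L'; apply: near_eq_cvg.
apply: nearW => n /=; have [F [G FG]] := pair_convn_product (f1 (h / n.+1%:R)) (f2 (h / n.+1%:R)) n.+1.
by rewrite /C !FG /=; ring.
Qed.

End typeI.

(** * From rank-one increment laws to independent processes *)

Section split_independence.
Context d (T : measurableType d) (R : realType) (P : probability T R).
Variables (M : R -> T -> nat) (W : nat -> nat -> R).
Variable (Z : bool -> nat -> nat -> T -> nat).
Hypothesis hM : levy_counting P M.
Hypothesis hZ : splitting_rule P M W Z.

Notation X := (split_component M Z).
Notation rho := (split_law P M Z).

Hypothesis rank_one : forall h a b a' b', 0 <= h ->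
  rho h (a, b) * rho h (a', b') = rho h (a, b') * rho h (a', b).

Section increment_vectors.
Variable (s : nat -> R).
Hypotheses (s0 : s 0%N = 0) (sS : forall j, s j <= s j.+1).

(** As finite sequences the increments take values in a countable type, so [rank_one_indep] can be
    applied to whole vectors. *)
Definition inc_vector b (J : nat) (w : T) : seq nat :=
  [seq side b (split_inc M Z (s j) (s j.+1) w) | j <- iota 0 J].

Lemma split_from_vector b J k w : (k <= J)%N ->
  X b (s k) w = (\sum_(j < k) nth 0%N (inc_vector b J w) j)%N.
Proof.
move=> kJ; elim: k kJ => [|k IH] kJ; first by rewrite big_ord0 s0 split_start.
rewrite big_ord_recr /= -IH; last exact: ltnW.
rewrite (nth_map 0%N) ?size_iota// nth_iota// add0n side_split_inc subnKC//.
exact: (split_mono Z hM).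
Qed.

Lemma inc_vector_discrete b J : discrete (inc_vector b J).
Proof.
have s_ge0 j : 0 <= s j by rewrite -s0 times_mono.
apply: (@discrete_map _ _ _ (fun j w => side b (split_inc M Z (s j) (s j.+1) w))) => j _.
exact: (discrete_comp (side b) (split_inc_discrete hM hZ (s_ge0 _) (s_ge0 _))).
Qed.

Lemma inc_vector_law J (a b : seq nat) :
  pr P [set w | inc_vector true J w = a /\ inc_vector false J w = b] =
  if (size a == J) && (size b == J) then
    \prod_(j < J) rho (s j.+1 - s j) (nth 0%N a j, nth 0%N b j) else 0.
Proof.
case: ifPn => [/andP[/eqP aJ /eqP bJ]|nJ]; last first.
  rewrite (_ : [set w | _] = set0) ?pr_set0//; apply/seteqP; split => w //= -[wa wb].
  by move: nJ; rewrite -wa -wb !size_map !size_iota eqxx.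
rewrite -(split_joint_law hM hZ J (fun j => (nth 0%N a j, nth 0%N b j)) s0 sS).
congr pr; apply/seteqP; split => w /=.
  move=> [<- <-] j jJ.
  by rewrite !(nth_map 0%N) ?size_iota// nth_iota// add0n; case: split_inc.
move=> h; split; apply: (@eq_from_nth _ 0%N); rewrite size_map size_iota ?aJ ?bJ// => j jJ.
  by rewrite (nth_map 0%N) ?size_iota// nth_iota// add0n h.
by rewrite (nth_map 0%N) ?size_iota// nth_iota// add0n h.
Qed.

Lemma inc_vector_indep J (SA SB : set (seq nat)) :
  pr P ([set w | SA (inc_vector true J w)] `&` [set w | SB (inc_vector false J w)]) =
  pr P [set w | SA (inc_vector true J w)] * pr P [set w | SB (inc_vector false J w)].
Proof.
apply: rank_one_indep; try exact: inc_vector_discrete.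
move=> a a' b b'; rewrite !inc_vector_law.
(* A vector of wrong length has probability 0 and annihilates both sides; otherwise the minor
   identity is multiplied over the intervals. *)
case: (size a == J); case: (size a' == J); case: (size b == J); case: (size b' == J);
  rewrite ?mul0r ?mulr0//= -!big_split /=.
by apply: eq_bigr => j _; rewrite rank_one// subr_ge0.
Qed.

End increment_vectors.

Definition cylinder b (C : set T) : Prop := exists (l : seq R) (B : R -> set nat),
  (forall t, t \in l -> 0 <= t) /\ C = [set w | forall t, t \in l -> B t (X b t w)].

Lemma cylinder_measurable b C : cylinder b C -> measurable C.
Proof.
move=> [l [B [l0 ->]]].
rewrite (_ : [set w | _] = \big[setI/setT]_(t <- l) (if t \in l then [set w | B t (X b t w)] else setT)).
  apply: bigsetI_measurable => t _; case: ifP => // /l0 t0.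
  by apply: (@discrete_pre _ _ _ (X b t) (B t)); apply: (split_discrete hM hZ).
rewrite bigsetI_seq; apply/seteqP; split => w /= h t tl.
  by rewrite tl; exact: h.
by have := h t tl; rewrite tl.
Qed.

Lemma cylinder_setI b : setI_closed (cylinder b).
Proof.
move=> _ _ [l1 [B1 [h1 ->]]] [l2 [B2 [h2 ->]]].
exists (l1 ++ l2), (fun t => [set x | (t \in l1 -> B1 t x) /\ (t \in l2 -> B2 t x)]).
split; first by move=> t; rewrite mem_cat => /orP[/h1|/h2].
apply/seteqP; split => w /=.
  by move=> [w1 w2] t _; split; [exact: w1|exact: w2].
by move=> h; split => t tl; have := h t; rewrite mem_cat tl ?orbT => /(_ isT) [H1 H2]; [exact: H1|exact: H2].
Qed.

(** The two cylinders may look at different times. Merging and sorting these times makes both events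
    functions of increments over the same intervals. *)
Lemma cylinder_indep A1 A2 : cylinder true A1 -> cylinder false A2 ->
  pr P (A1 `&` A2) = pr P A1 * pr P A2.
Proof.
move=> [l1 [B1 [h1 AE]]] [l2 [B2 [h2 BE]]].
(* Past its end the sorted list is continued by its last value, which keeps the infinite sequence
   nondecreasing. *)
pose S := sort <=%O (l1 ++ l2); pose t i := nth (last 0 S) S i.
have memS x : (x \in S) = (x \in l1) || (x \in l2) by rewrite mem_sort mem_cat.
have S0 x : x \in S -> 0 <= x by rewrite memS => /orP[/h1|/h2].
have last0 : 0 <= last 0 S.
  by have := mem_last 0 S; rewrite inE => /predU1P[->//|/S0].
have t0 i : 0 <= t i.
  rewrite /t; have [iS|iS] := ltnP i (size S); first exact/S0/mem_nth.
  by rewrite nth_default.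
have tS i : t i <= t i.+1.
  rewrite /t; have [iS|iS] := ltnP i.+1 (size S).
    apply: sorted_leq_nth => //; [exact: le_trans|exact: sort_le_sorted|by rewrite inE ltnW].
  rewrite [X in _ <= X]nth_default//; have [iS'|iS'] := ltnP i (size S).
    have -> : i = (size S).-1 by lia.
    by rewrite nth_last; case: (S) iS'.
  by rewrite nth_default.
have cS := cons_time_mono (t0 0%N) tS.
have XE b x w : x \in S -> X b x w =
    (\sum_(j < (index x S).+1) nth 0%N (inc_vector (cons_time t) b (size S) w) j)%N.
  move=> xS; rewrite -split_from_vector//; last by rewrite ltn_neqAle index_size andbT neq_ltn index_mem xS.
  by rewrite /= /t nth_index.
(* The upper index has a successor because [cons_time] puts 0 in front of the sorted times. *)
pose SB (l : seq R) (B : R -> set nat) := [set v : seq nat | forall x, x \in l ->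
  B x (\sum_(j < (index x S).+1) nth 0%N v j)%N].
have E b (l : seq R) (B : R -> set nat) : {subset l <= S} -> [set w | forall x, x \in l -> B x (X b x w)] =
   [set w | SB l B (inc_vector (cons_time t) b (size S) w)].
  by move=> lS; apply/seteqP; split => w /= h x xl; have := h x xl; rewrite XE//; exact: lS.
rewrite AE BE !E; last 2 first.
- by move=> x xl; rewrite memS xl orbT.
- by move=> x xl; rewrite memS xl.
by rewrite inc_vector_indep.
Qed.

Lemma split_independent_processes :
  independent_processes P nonneg_times (X true) nonneg_times (X false).
Proof.
have sub b : sigma_process nonneg_times (X b) `<=` <<s cylinder b >>.
  apply: smallest_sub; first exact: smallest_sigma_algebra.
  move=> _ [t t0 [B _ <-]]; apply: sub_sigma_algebra.
  exists [:: t], (fun=> B); split; first by move=> x; rewrite inE => /eqP ->.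
  apply/seteqP; split => w /=; first by move=> h x; rewrite inE => /eqP ->.
  by apply; rewrite inE.
move=> A B /sub sA /sub sB.
have mA := sigma_sub_measurable (@cylinder_measurable true) sA.
have mB := sigma_sub_measurable (@cylinder_measurable false) sB.
rewrite (prE P (measurableI _ _ mA mB)) (prE P mA) (prE P mB) -EFinM; congr (_%:E).
apply: (indep_sigma _ _ _ _ cylinder_indep sA sB).
- exact: cylinder_setI.
- exact: cylinder_setI.
- exact: cylinder_measurable.
- exact: cylinder_measurable.
Qed.

End split_independence.

(** * Infinitesimal rates *)

Section little_o.
Context (R : realType).

Lemma le_id_cvg (f : R -> R) :
  (f h / h @[h --> 0^'+] --> 0) <->
  (forall e, 0 < e -> \forall h \near 0^'+, `|f h| <= e * `|h|).
Proof.
split=> [/cvgr0Pnorm_le H e e0|H]; last apply/cvgr0Pnorm_le => e e0.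
  have {}H := H e e0; near=> h; have h0 : 0 < h by near: h; exact: nbhs_right_gt.
  have : `|f h / h| <= e by near: h.
  by rewrite normrM normfV ler_pdivrMr// normr_gt0 gt_eqF.
have {}H := H e e0.
near=> h; have h0 : 0 < h by near: h; exact: nbhs_right_gt.
rewrite normrM normfV ler_pdivrMr ?normr_gt0 ?gt_eqF//.
by near: h.
Unshelve. all: by end_near. Qed.

Lemma addo_id_cvg (f g : R -> R) :
  (forall h, f h = g h +o_(h \near 0^'+) h) <->
  ((f h - g h) / h @[h --> 0^'+] --> 0).
Proof.
split=> [H|/le_id_cvg H].
  have /eqaddoP/le_id_cvg// : f = g +o_ (0^'+) (fun h : R => h).
  by apply/funext => h; exact: H.
have /eqaddoP E : forall e : R, 0 < e -> \forall h \near 0^'+, `|(f - g) h| <= e * `|h| by [].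
by move=> h; exact: (congr1 (fun F => F h) E).
Qed.

Lemma eqo_id_cvg (f : R -> R) :
  (forall h, f h =o_(h \near 0^'+) h) <-> (f h / h @[h --> 0^'+] --> 0).
Proof.
split=> [H|/le_id_cvg H].
  have /eqoP/le_id_cvg// : f =o_ (0^'+) (fun h : R => h).
  by apply/funext => h; exact: H.
have /eqoP E : forall e : R, 0 < e -> \forall h \near 0^'+, `|f h| <= e * `|h| by [].
by move=> h; exact: (congr1 (fun F => F h) E).
Qed.

Lemma cvg_rate (f : R -> R) (l : R) :
  ((f h - l * h) / h @[h --> 0^'+] --> 0) <-> (f h / h @[h --> 0^'+] --> l).
Proof.
have E : \forall h \near (0 : R)^'+, (f h - l * h) / h = f h / h - l.
  near=> h; have h0 : 0 < h by near: h; exact: nbhs_right_gt.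
  by rewrite mulrBl mulfK ?gt_eqF.
split=> [H|H].
  apply/subr_cvg0; apply: cvg_trans H; apply: near_eq_cvg.
  by apply: filterS E => h ->.
move/subr_cvg0 : H => H; apply: cvg_trans H; apply: near_eq_cvg.
by apply: filterS E => h ->.
Unshelve. all: by end_near. Qed.

Lemma cvg_rate0 (f : R -> R) (l : R) :
  ((f h - (1 - l * h)) / h @[h --> 0^'+] --> 0) <->
  ((1 - f h) / h @[h --> 0^'+] --> l).
Proof.
have E : (fun h => (1 - f h - l * h) / h) = - (fun h => (f h - (1 - l * h)) / h).
  apply/funext => h; change ((1 - f h - l * h) / h = - ((f h - (1 - l * h)) / h)).
  by rewrite -[RHS]mulNr; congr (_ * _); ring.
split => [H|/cvg_rate H].
  by apply/cvg_rate; rewrite E -[X in _ --> X]oppr0; apply/cvgNP.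
by move: H; rewrite E -[X in _ --> X -> _]oppr0 => /cvgNP.
Qed.

Lemma cvg_sum_seq (F : set_system R) (FF : Filter F) (I : eqType) (s : seq I)
    (f : I -> R -> R) (l : I -> R) (Q : pred I) :
  (forall i, i \in s -> Q i -> f i h @[h --> F] --> l i) ->
  \sum_(i <- s | Q i) f i h @[h --> F] --> \sum_(i <- s | Q i) l i.
Proof.
move=> H; rewrite (_ : (fun h => _) = \sum_(i <- s | Q i) f i); last first.
  by apply/funext => h; rewrite fct_sumE.
rewrite big_seq_cond [X in _ --> X]big_seq_cond; apply: (big_ind2 (fun (g : R -> R) (x : R) => g h @[h --> F] --> x)).
- exact: cvg_cst.
- by move=> *; exact: cvgD.
- by move=> i /andP[]; exact: H.
Qed.

Lemma cvg_sum_ord (F : set_system R) (FF : Filter F) (n : nat)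
    (f : nat -> R -> R) (l : nat -> R) (Q : pred nat) :
  (forall i, (i < n)%N -> Q i -> f i h @[h --> F] --> l i) ->
  \sum_(i < n | Q i) f i h @[h --> F] --> \sum_(i < n | Q i) l i.
Proof. by move=> H; apply: cvg_sum_seq => i _; exact: H. Qed.

End little_o.

Section rates.
Context d (T : measurableType d) (R : realType) (P : probability T R).
Variables (k : nat) (N : R -> T -> nat).
Hypothesis hN : levy_counting P N.

Definition tail (h : R) : R := pr P [set w | (k < N h w)%N].

Lemma tailE h : 0 <= h -> tail h = 1 - \sum_(n < k.+1) law P N h n.
Proof.
move=> h0; rewrite (law_sum_lt hN)// -prC.
  by rewrite /tail; congr pr; apply/seteqP; split => w /=; rewrite ltnS ltnNge => /negP.
exact: (discrete_pre (fun n => (n < k.+1)%N) (levy_discrete hN h0)).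
Qed.

(** The infinitesimal conditions without conditioning: by independence and stationarity of the
    increments, the conditional probabilities of [is_GCP] are values of [law]. *)
Definition GCP_rates (lam : nat -> R) : Prop :=
  (forall j, (1 <= j <= k)%N -> law P N h j / h @[h --> 0^'+] --> lam j) /\
  (tail h / h @[h --> 0^'+] --> 0).

Lemma levy_inc_law t h n j : 0 <= t -> 0 <= h ->
  pr P [set w | N t w = n /\ N (t + h) w = (n + j)%N] = law P N t n * law P N h j.
Proof.
move=> t0 h0; pose s i : R := if i is i'.+1 then (if i' is 0%N then t else t + h) else 0.
have sS i : s i <= s i.+1 by case: i => [//|[|i]] /=; rewrite ?lerDl.
have s0 : 0 <= s 0%N by [].
have th0 : 0 <= t + h by exact: addr_ge0.
have mono := cp_nondecreasing (levy_counting_process hN).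
pose B i := if i is 0%N then [set n] else [set j].
have := levy_independent hN s0 sS (B := B) (s := [:: 0%N; 1%N]) isT (fun=> I).
rewrite !big_cons !big_nil setIT mule1 /=.
have m0 := levy_discrete hN t0 n.
have -> : (fun w => (N t w - N 0 w)%N) @^-1` [set n] = [set w | N t w = n].
  by apply/seteqP; split => w /=; rewrite (levy_start hN) subn0.
have := levy_stationary hN t0 (lexx 0) h0 [set j]; rewrite add0r.
have -> : [set w | [set j] (N h w - N 0 w)%N] = [set w | N h w = j].
  by apply/seteqP; split => w /=; rewrite (levy_start hN) subn0.
move=> ->.
have -> : [set w | N t w = n] `&` ((fun w => (N (t + h) w - N t w)%N) @^-1` [set j]) =
   [set w | N t w = n /\ N (t + h) w = (n + j)%N].
  have le w : (N t w <= N (t + h) w)%N by apply: mono; rewrite ?lerDl.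
  apply/seteqP; split => w /= [E1 h1]; split => //.
    by have := le w; lia.
  by rewrite h1 E1 addKn.
move=> E.
have mI : measurable [set w | N t w = n /\ N (t + h) w = (n + j)%N].
  rewrite (_ : [set w | _] = [set w | N t w = n] `&` [set w | N (t + h) w = (n + j)%N]) //.
  by apply: measurableI => //; exact: (levy_discrete hN th0).
apply: EFin_inj; rewrite EFinM -(prE P mI) -(prE P m0) -(prE P (levy_discrete hN h0 j)).
exact: E.
Qed.

Lemma cond_prob_law t h n j : 0 <= t -> 0 <= h -> P [set w | N t w = n] != 0%E ->
  cond_prob P [set w | N (t + h) w = (n + j)%N] [set w | N t w = n] = law P N h j.
Proof.
move=> t0 h0 Pn0.
change (pr P ([set w | N (t + h) w = (n + j)%N] `&` [set w | N t w = n]) / law P N t n = law P N h j).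
rewrite (_ : _ `&` _ = [set w | N t w = n /\ N (t + h) w = (n + j)%N]); last first.
  by apply/seteqP; split => w /= [].
rewrite levy_inc_law// mulrAC divff ?mul1r//.
apply: contra_neq Pn0 => E; rewrite (prE P (levy_discrete hN t0 n)); congr (_%:E); exact: E.
Qed.

Lemma GCP_no_jump_rate lam : GCP_rates lam ->
  (1 - law P N h 0%N) / h @[h --> 0^'+] --> \sum_(1 <= i < k.+1) lam i.
Proof.
move=> [Hj Ht].
have H1 : \sum_(i < k) (law P N h i.+1 / h) @[h --> 0^'+] --> \sum_(i < k) lam i.+1.
  apply: (@cvg_sum_ord R _ _ k (fun i h => law P N h i.+1 / h) (fun i => lam i.+1) xpredT) => i ik _.
  exact: Hj.
have H : tail h / h + \sum_(i < k) (law P N h i.+1 / h) @[h --> 0^'+] --> 0 + \sum_(i < k) lam i.+1.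
  exact: cvgD.
rewrite big_add1 big_mkord -[X in _ --> X]add0r; apply: cvg_trans H; apply: near_eq_cvg; near=> h.
have h0 : 0 < h by near: h; exact: nbhs_right_gt.
rewrite tailE ?(ltW h0)// big_ord_recl /= -mulr_suml -mulrDl; congr (_ / _); ring.
Unshelve. all: by end_near. Qed.

Lemma GCP_of_rates lam : (0 < k)%N -> (forall j, (1 <= j <= k)%N -> 0 < lam j) ->
  GCP_rates lam -> is_GCP P k lam N.
Proof.
move=> k0 lam0 H; have [Hj Ht] := H.
have near_law t n j : 0 <= t -> P [set w | N t w = n] != 0%E ->
    \forall h \near 0^'+, law P N h j =
      cond_prob P [set w | N (t + h) w = (n + j)%N] [set w | N t w = n].
  move=> t0 Pn; near=> h; rewrite cond_prob_law//.
split => //.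
- exact: levy_counting_process hN.
- exact: levy_start hN.
- exact: levy_independent hN.
- exact: levy_stationary hN.
- move=> t n t0 Pn; apply/addo_id_cvg/cvg_rate0.
  apply: cvg_trans (GCP_no_jump_rate H); apply: near_eq_cvg.
  by have := near_law t n 0%N t0 Pn; apply: filterS => h ->; rewrite addn0.
- move=> t n j t0 jk Pn; apply/addo_id_cvg/cvg_rate.
  apply: cvg_trans (Hj j jk); apply: near_eq_cvg.
  by have := near_law t n j t0 Pn; apply: filterS => h ->.
- move=> t n j t0 jk Pn; apply/eqo_id_cvg.
  apply: (@squeeze_cvgr _ _ _ _ (fun=> 0) (fun h => tail h / h)) => //; last exact: cvg_cst.
  near=> h; have h0 : 0 < h by near: h; exact: nbhs_right_gt.
  rewrite cond_prob_law ?(ltW h0)// divr_ge0 ?pr_ge0 ?(ltW h0)//=.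
  rewrite ler_pM2r ?invr_gt0//; apply: pr_le.
  + exact: (levy_discrete hN (ltW h0)).
  + exact: (discrete_pre (fun n => (k < n)%N) (levy_discrete hN (ltW h0))).
  + by move=> w /= ->.
Unshelve. all: by end_near. Qed.

Lemma rates_of_GCP lam : is_GCP P k lam N -> GCP_rates lam.
Proof.
move=> hG.
have P0 : P [set w | N 0 w = 0%N] != 0%E.
  rewrite (_ : [set w | _] = setT) ?probability_setT ?onee_eq0//.
  by apply/seteqP; split => // w _; exact: levy_start hN w.
have near_law j : \forall h \near 0^'+,
    cond_prob P [set w | N (0 + h) w = (0 + j)%N] [set w | N 0 w = 0%N] = law P N h j.
  near=> h; rewrite cond_prob_law//.
have Hj j : (1 <= j <= k)%N -> law P N h j / h @[h --> 0^'+] --> lam j.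
  move=> jk; have /addo_id_cvg/cvg_rate H := gcp_jump hG (lexx 0) jk P0.
  apply: cvg_trans H; apply: near_eq_cvg.
  by apply: filterS (near_law j) => h ->.
split => //.
(* The definition treats each large size separately, and infinitely many o(h) need not add up to
   o(h). The tail is instead 1 minus the masses of 0, ..., k, whose first-order terms cancel. *)
have H0 : (1 - law P N h 0%N) / h @[h --> 0^'+] --> \sum_(1 <= i < k.+1) lam i.
  have /addo_id_cvg/cvg_rate0 H := gcp_no_jump hG (lexx 0) P0.
  apply: cvg_trans H; apply: near_eq_cvg.
  by apply: filterS (near_law 0%N) => h <-.
have H1 : \sum_(i < k) (law P N h i.+1 / h) @[h --> 0^'+] --> \sum_(i < k) lam i.+1.
  apply: (@cvg_sum_ord R _ _ k (fun i h => law P N h i.+1 / h) (fun i => lam i.+1) xpredT) => i ik _.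
  exact: Hj.
have H : (1 - law P N h 0%N) / h - \sum_(i < k) (law P N h i.+1 / h) @[h --> 0^'+] -->
    \sum_(1 <= i < k.+1) lam i - \sum_(i < k) lam i.+1.
  exact: cvgB.
rewrite big_add1 big_mkord subrr in H; apply: cvg_trans H; apply: near_eq_cvg; near=> h.
have h0 : 0 < h by near: h; exact: nbhs_right_gt.
rewrite tailE ?(ltW h0)// big_ord_recl /= -mulr_suml -mulrBl; congr (_ / _); ring.
Unshelve. all: by end_near. Qed.

End rates.

Lemma levy_of_GCP d (T : measurableType d) (R : realType) (P : probability T R)
  k lam (N : R -> T -> nat) : is_GCP P k lam N -> levy_counting P N.
Proof.
by move=> h; split; [exact: gcp_counting h|exact: gcp_start h|exact: gcp_independent h|exact: gcp_stationary h].
Qed.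

(** * Binomial splitting *)

(** The rectangle is summed along n = a + b. For fixed a the range of n may be extended to all of 0,
    ..., A + B: for n < a the first binomial vanishes, for n > a + B the second. Vandermonde's
    identity then sums over a. *)
Lemma vandermonde_antidiagonals (R : pzRingType) (G : nat -> R) (A B : nat) :
  \sum_(a < A.+1) \sum_(b < B.+1)
    G (a + b)%N * ('C(a + b, a) * 'C(A + B - (a + b), A - a))%:R =
  (\sum_(n < (A + B).+1) G n) * 'C(A + B, A)%:R.
Proof.
pose H a n := G n * ('C(n, a) * 'C(A + B - n, A - a))%:R.
transitivity (\sum_(a < A.+1) \sum_(n < (A + B).+1) H a n).
  apply: eq_bigr => a _; have aA : (a <= A)%N by rewrite -ltnS.
  rewrite -(big_mkord xpredT (H a)) (big_cat_nat (n := a)) //=; last by lia.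
  rewrite [X in _ = X + _]big_nat [X in _ = X + _]big1 ?add0r; last first.
    by move=> n na; rewrite /H bin_small ?mul0n ?mulr0//; lia.
  rewrite (big_cat_nat (n := (a + B.+1)%N)) //=; [|by lia|by lia].
  rewrite [X in _ = _ + X]big_nat [X in _ = _ + X]big1 ?addr0; last first.
    by move=> n nn; rewrite /H [X in (_ * X)%N]bin_small ?muln0 ?mulr0//; lia.
  transitivity (\sum_(0 + a <= i < a + B.+1) H a i); last by [].
  by rewrite big_addn addKn big_mkord; apply: eq_bigr => b _; rewrite /H addnC.
rewrite exchange_big big_distrl; apply: eq_bigr => n _ /=.
rewrite -big_distrr /= -natr_sum binomial.Vandermonde subnKC//.
by rewrite -ltnS.
Qed.

Lemma law_conv d (T : measurableType d) (R : realType) (P : probability T R)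
    (M : R -> T -> nat) (g h : R) (n : nat) : levy_counting P M -> 0 <= g -> 0 <= h ->
  law P M (g + h) n = \sum_(i < n.+1) law P M g i * law P M h (n - i)%N.
Proof.
move=> hM g0 h0; have gh0 : 0 <= g + h by exact: addr_ge0.
have le w : (M g w <= M (g + h)%R w)%N.
  by apply: (cp_nondecreasing (levy_counting_process hM)); rewrite ?lerDl.
under eq_bigr do rewrite -levy_inc_law//.
rewrite /law; apply: pr_fin_disj.
- move=> i; rewrite (_ : [set w | _] = [set w | M g w = i] `&` [set w | M (g + h) w = (i + (n - i))%N]) //.
  by apply: measurableI; exact: (levy_discrete hM).
- move=> w /=; split.
    move=> E; have := le w; rewrite E -ltnS => in_; exists (Ordinal in_) => /=.
    by rewrite subnKC // -ltnS.
  by move=> [i [_ ->]]; rewrite subnKC// -ltnS.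
- by move=> i j w [/= -> _] [/val_inj].
Qed.

Section typeII_law.
Context d (T : measurableType d) (R : realType) (P : probability T R).
Variables (M : R -> T -> nat) (p : R).
Variable (Z : bool -> nat -> nat -> T -> nat).
Hypothesis hM : levy_counting P M.
Hypothesis hZ : splitting_rule P M (typeII_weight p) Z.

Notation X := (split_component M Z).
Notation mu := (thin P M (typeII_weight p)).

(** The powers of p and 1 - p multiply to p^A (1 - p)^B for every way of dividing (A, B), which
    leaves only binomial coefficients. *)
Lemma thinII_conv g h y : 0 <= g -> 0 <= h -> pair_conv (mu g) (mu h) y = mu (h + g) y.
Proof.
move=> g0 h0; case: y => A B; rewrite /pair_conv /thin /= law_conv//.
pose G n := law P M h n * law P M g (A + B - n)%N.
transitivity ((p ^+ A * (1 - p) ^+ B) * \sum_(a < A.+1) \sum_(b < B.+1)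
    G (a + b)%N * ('C(a + b, a) * 'C(A + B - (a + b), A - a))%:R).
  rewrite mulr_sumr; apply: eq_bigr => a _; rewrite mulr_sumr; apply: eq_bigr => b _.
  have aA : (a <= A)%N by rewrite -ltnS.
  have bB : (b <= B)%N by rewrite -ltnS.
  rewrite /G /typeII_weight.
  have -> : (A - a + (B - b) = A + B - (a + b))%N by lia.
  have -> : (a + b - a = b)%N by lia.
  have -> : (A + B - (a + b) - (A - a) = B - b)%N by lia.
  rewrite natrM -[in p ^+ A](subnKC aA) -[in (1 - p) ^+ B](subnKC bB) !exprD; ring.
by rewrite vandermonde_antidiagonals /typeII_weight addKn; ring.
Qed.

Lemma thinII_convn u r y : 0 <= u -> pair_convn (mu u) r y = mu (r%:R * u) y.
Proof.
move=> u0; elim: r y => [|r IH] y.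
  rewrite mul0r /thin (law0 hM); case: y => a b; rewrite /= xpair_eqE addn_eq0.
  case: (eqVneq a 0%N) => [->|_]; last by rewrite mul0r.
  case: (eqVneq b 0%N) => [->|_]; last by rewrite mul0r.
  by rewrite /typeII_weight bin0 !mulr1.
have -> : pair_convn (mu u) r.+1 y = pair_conv (mu u) (mu (r%:R * u)) y.
  by rewrite /= /pair_conv; apply: eq_bigr => a _; apply: eq_bigr => b _; rewrite IH.
by rewrite thinII_conv ?mulr_ge0// -natr1 mulrDl mul1r.
Qed.

(** The approximating sequence is constant: n + 1 cells of length h / (n + 1) convolve to [mu h]. *)
Lemma typeII_law h y : 0 <= h -> split_law P M Z h y = mu h y.
Proof.
move=> h0; apply: (cvg_unique _ (split_law_limit hM hZ h0)) => //.
apply: cvg_near_cst; apply: nearW => n; rewrite thinII_convn ?divr_ge0//.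
by rewrite mulrC divfK.
Qed.

Definition side_pair (b : bool) (a m : nat) : nat * nat :=
  if b then (a, m - a)%N else (m - a, a)%N.

Definition side_prob (b : bool) : R := if b then p else 1 - p.

Lemma thinII_side b h a m : (a <= m)%N ->
  mu h (side_pair b a m) = law P M h m * typeII_weight (side_prob b) m a.
Proof.
move=> am; rewrite /thin /typeII_weight; case: b => /=; rewrite ?subnKC ?subnK//.
by rewrite bin_sub// subKn// subKr; ring.
Qed.

Lemma split_levy b : levy_counting P (X b).
Proof.
split.
- exact: (split_counting hM hZ).
- by move=> w; exact: split_start.
- exact: (split_independent_increments hM hZ).
- exact: (split_stationary_increments hM hZ).
Qed.

Hypothesis hp : 0 < p < 1.
Variables (k : nat) (lam : nat -> R).

Definition typeII_rate (b : bool) (a : nat) : R :=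
  \sum_(a <= j < k.+1) typeII_weight (side_prob b) j a * lam j.

Lemma typeII_weight_gt0 b m a : (a <= m)%N -> 0 < typeII_weight (side_prob b) m a.
Proof.
have [p0 p1] := andP hp; move=> am; rewrite /typeII_weight.
have q0 : 0 < side_prob b by case: b => //=; rewrite subr_gt0.
have q1 : 0 < 1 - side_prob b by case: b {q0} => /=; [rewrite subr_gt0|rewrite subKr].
by rewrite mulr_gt0 ?exprn_gt0// mulr_gt0 ?exprn_gt0// ltr0n bin_gt0.
Qed.

Lemma typeII_weight_ge0 b m a : 0 <= typeII_weight (side_prob b) m a.
Proof.
have [am|am] := leqP a m; first exact/ltW/typeII_weight_gt0.
by rewrite /typeII_weight bin_small// !mul0r.
Qed.

(** Rates are known for totals up to k only. The remainder r collects the outcomes with [M h] above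
    k; its bound [tail] is o(h), so it does not affect the rate. *)
Lemma typeII_marginal b h a : 0 <= h -> exists2 r, 0 <= r <= tail P k M h &
  law P (X b) h a =
  \sum_(a <= m < k.+1) law P M h m * typeII_weight (side_prob b) m a + r.
Proof.
move=> h0.
have mM := levy_discrete hM h0; have mX := split_pair_discrete hM hZ h0.
have mXb := split_discrete hM hZ b h0.
have mtail : measurable [set w | (k < M h w)%N] := discrete_pre (fun n => (k < n)%N) mM.
have sumE w : (side true (split_pair M Z h w) + side false (split_pair M Z h w))%N = M h w.
  exact: (split_sum hM hZ).
have sideE w : side b (split_pair M Z h w) = X b h w by case: b {mXb}.
pose Rm := [set w | X b h w = a] `&` [set w | (k < M h w)%N].
exists (pr P Rm).
  rewrite pr_ge0 pr_le//; first exact: measurableI.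
  by move=> w [].
pose E := [set w | X b h w = a] `&` [set w | (M h w <= k)%N].
have mE : measurable E.
  by apply: measurableI => //; exact: (discrete_pre (fun n => (n <= k)%N) mM).
have -> : law P (X b) h a = pr P E + pr P Rm.
  rewrite -prU//; last 2 first.
  - exact: measurableI.
  - by apply/seteqP; split => w //= [[_ h1] [_ h2]]; have := leq_trans h2 h1; rewrite ltnn.
  rewrite /law; congr pr; apply/seteqP; split => w /=; last by move=> [[]|[]].
  by move=> Xa; have [Mk|Mk] := leqP (M h w) k; [left|right].
congr (_ + _).
pose B (m : 'I_k.+1) := if (a <= m)%N then [set w | split_pair M Z h w = side_pair b a m] else set0.
have BE w (m : 'I_k.+1) : B m w <-> X b h w = a /\ M h w = m.
  rewrite /B -sumE -sideE; case: ifPn => am; last first.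
    by split => // -[h1 h2]; move: am; rewrite -h1 -h2; case: (b) => /=; rewrite ?leq_addr ?leq_addl.
  rewrite [X in X <-> _]/=; move: (split_pair M Z h w) => [x y]; case: (b) => /=; split.
  - by move=> [-> ->]; rewrite subnKC.
  - by move=> [-> <-]; rewrite addKn.
  - by move=> [-> ->]; rewrite subnK.
  - by move=> [-> <-]; rewrite addnK.
rewrite (@pr_fin_disj _ _ _ P _ _ B).
- rewrite big_geq_mkord [RHS]big_mkcond /=; apply: eq_bigr => m _; rewrite /B.
  by case: ifPn => am; rewrite ?pr_set0// -thinII_side// -typeII_law.
- by move=> m; rewrite /B; case: ifP => // _; exact: mX.
- move=> w; split.
    by move=> [/= h1 h2]; exists (Ordinal (h2 : (M h w < k.+1)%N)); apply/BE.
  by move=> [m /BE[h1 h2]]; split => //=; rewrite h2 -ltnS.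
- by move=> i j w /BE[_ h1] /BE[_ h2]; apply/val_inj; rewrite /= -h1.
Qed.

Hypothesis hG : GCP_rates P k M lam.

Lemma typeII_rates b : GCP_rates P k (X b) (typeII_rate b).
Proof.
have [Hj Ht] := hG; split.
- move=> a /andP[a1 ak].
  have H : \sum_(m < k.+1 | (a <= m)%N) (law P M h m / h * typeII_weight (side_prob b) m a)
      @[h --> 0^'+] --> \sum_(m < k.+1 | (a <= m)%N) lam m * typeII_weight (side_prob b) m a.
    apply: (@cvg_sum_ord R _ _ k.+1 (fun m h => law P M h m / h * typeII_weight (side_prob b) m a)
      (fun m => lam m * typeII_weight (side_prob b) m a) (fun m => (a <= m)%N)) => m mk am.
    by apply: cvgMl; apply: Hj; rewrite (leq_trans a1).
  have H' : \sum_(m < k.+1 | (a <= m)%N) (law P M h m / h * typeII_weight (side_prob b) m a) + tail P k M h / h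
      @[h --> 0^'+] --> \sum_(m < k.+1 | (a <= m)%N) lam m * typeII_weight (side_prob b) m a + 0.
    exact: cvgD.
  have -> : typeII_rate b a = \sum_(m < k.+1 | (a <= m)%N) lam m * typeII_weight (side_prob b) m a.
    by rewrite /typeII_rate big_geq_mkord; apply: eq_bigr => m _; rewrite mulrC.
  rewrite addr0 in H'.
  apply: (@squeeze_cvgr _ _ _ _ _ _ _ _ _ H H').
  near=> h; have h0 : 0 < h by near: h; exact: nbhs_right_gt.
  have [r /andP[r0 rt] ->] := typeII_marginal b a (ltW h0).
  have -> : \sum_(m < k.+1 | (a <= m)%N) (law P M h m / h * typeII_weight (side_prob b) m a) =
    (\sum_(a <= m < k.+1) law P M h m * typeII_weight (side_prob b) m a) / h.
    by rewrite big_geq_mkord mulr_suml; apply: eq_bigr => m _; rewrite mulrAC.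
  by rewrite mulrDl lerDl lerD2l divr_ge0 ?(ltW h0)//= ler_pM2r ?invr_gt0.
- apply: (@squeeze_cvgr _ _ _ _ (fun=> 0) (fun h => tail P k M h / h)) => //; last exact: cvg_cst.
  near=> h; have h0 : 0 < h by near: h; exact: nbhs_right_gt.
  rewrite divr_ge0 ?pr_ge0 ?(ltW h0)//= ler_pM2r ?invr_gt0//; apply: pr_le.
  + exact: (discrete_pre (fun n => (k < n)%N) (split_discrete hM hZ b (ltW h0))).
  + exact: (discrete_pre (fun n => (k < n)%N) (levy_discrete hM (ltW h0))).
  + move=> w /=; rewrite -(split_sum hM hZ w (ltW h0)); case: (b) => h1; lia.
Unshelve. all: by end_near. Qed.

Lemma typeII_GCP b : (0 < k)%N -> (forall j, (1 <= j <= k)%N -> 0 < lam j) ->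
  is_GCP P k (typeII_rate b) (X b).
Proof.
move=> k0 lam0; apply: (GCP_of_rates (split_levy b)) => //; last exact: typeII_rates.
(* The last term j = k occurs for every a <= k and is positive; the others are nonnegative. *)
move=> a /andP[a1 ak]; rewrite /typeII_rate big_nat_recr//=.
apply: ltr_wpDl; last by rewrite mulr_gt0 ?typeII_weight_gt0// lam0// k0 leqnn.
rewrite big_nat; apply: sumr_ge0 => j /andP[aj jk].
by rewrite mulr_ge0 ?typeII_weight_ge0// ltW// lam0// (leq_trans a1 aj) ltnW.
Qed.

End typeII_law.

(** * Expectations of integer-valued random variables *)

Section nat_expectation.
Context d (T : measurableType d) (R : realType) (P : probability T R).

(** Extended values are used because finiteness of the moments is only learned from [Ex_limit]. *)
Definition Ex (X : T -> nat) : \bar R := (\int[P]_w ((X w)%:R : R)%:E)%E.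

Lemma Ex_measurable (X : T -> nat) : discrete X ->
  measurable_fun setT (EFin \o (fun w => (X w)%:R : R)).
Proof.
move=> mX _ Y _; rewrite setTI.
exact: (discrete_pre (fun n : nat => Y ((n%:R : R)%:E)) mX).
Qed.

Lemma Ex_le (X Y : T -> nat) : discrete X -> discrete Y ->
  (forall w, X w <= Y w)%N -> (Ex X <= Ex Y)%E.
Proof.
move=> mX mY XY; apply: ge0_le_integral => //.
- exact: Ex_measurable.
- exact: Ex_measurable.
- by move=> w _; rewrite lee_fin ler_nat.
Qed.

Lemma Ex_sum (I : Type) (s : seq I) (X : I -> T -> nat) :
  (forall i, discrete (X i)) ->
  Ex (fun w => \sum_(i <- s) X i w)%N = (\sum_(i <- s) Ex (X i))%E.
Proof.
move=> mX; rewrite -ge0_integral_sum//; last by move=> i; exact: Ex_measurable.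
by apply: eq_integral => w _; rewrite natr_sum sumEFin.
Qed.

Lemma Ex_indicator (c : nat) (A : set T) : measurable A ->
  Ex (fun w => c * `[< A w >])%N = (c%:R * pr P A)%:E.
Proof.
move=> mA; rewrite EFinM -prE// -[A in P A]setIT -integral_indic// -ge0_integralZl_EFin//.
- apply: eq_integral => w _; rewrite natrM EFinM indicE.
  by have [Aw|nAw] := pselect (A w); [rewrite asboolT// mem_set|rewrite asboolF// memNset].
- exact/measurable_EFinP/measurable_indic.
Qed.

Lemma Ex_law (U : countType) (V : T -> U) (g : U -> nat) (s : seq U) :
  discrete V -> uniq s -> (forall u, u \notin s -> g u = 0%N) ->
  Ex (fun w => g (V w)) = (\sum_(u <- s) (g u)%:R * pr P [set w | V w = u])%:E.
Proof.
move=> mV us g0.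
have gE w : g (V w) = (\sum_(u <- s) g u * `[< [set w | V w = u] w >])%N.
  have [Vs|Vs] := boolP (V w \in s).
    rewrite (bigD1_seq (V w))//= big1 ?addn0.
      by case: asboolP => [_|//]; rewrite muln1.
    move=> u uV; case: asboolP => [E|_]; last by rewrite muln0.
    by rewrite E eqxx in uV.
  rewrite g0// big_seq big1// => u us'; case: asboolP => [E|_]; last by rewrite muln0.
  by rewrite E us' in Vs.
under [in LHS]eq_fun do rewrite gE.
rewrite Ex_sum; last first.
  by move=> u; exact: (discrete_comp (fun v => (g u * `[< v = u >])%N) mV).
by rewrite -sumEFin; apply: eq_bigr => u _; exact: Ex_indicator.
Qed.

(* Convergence in probability from below is enough for convergence of the
   expectations: no uniform integrability is required. *)
Lemma Ex_limit (X : T -> nat) (S : nat -> T -> nat) (e : nat -> R) (L : R) :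
  discrete X -> (forall n, discrete (S n)) ->
  (forall n w, S n w <= X w)%N ->
  pr P [set w | S n w <> X w] @[n --> \oo] --> 0 ->
  (forall n, Ex (S n) = (e n)%:E) -> e n @[n --> \oo] --> L -> Ex X = L%:E.
Proof.
move=> mX mS SX SP SE eL; apply/eqP; rewrite eq_le; apply/andP; split; last first.
  apply: (@cvge_to_le _ \oo _ _ (fun n => (e n)%:E) (Ex X) L%:E).
    by apply: cvg_EFin => //; exact: nearW.
  by apply: nearW => n; rewrite -SE; exact: Ex_le.
(* The bound min(X, K) <= S n + K 1_{S n <> X} gives E min(X, K) <= L as n grows; monotone
   convergence in K then gives E X <= L. *)
pose Y K w := minn (X w) K.
have mY K : discrete (Y K) by exact: (discrete_comp (fun n => minn n K) mX).
have mD n : measurable [set w | S n w <> X w].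
  have := discrete_comp2 (fun a b : nat => a != b) (mS n) mX => /(_ true).
  by rewrite (_ : [set w | _] = [set w | S n w <> X w])//; apply/seteqP; split => w /= /eqP.
have YL K : (Ex (Y K) <= L%:E)%E.
  have c : e n + K%:R * pr P [set w | S n w <> X w] @[n --> \oo] --> L + K%:R * 0.
    by apply: cvgD => //; apply: cvgM => //; exact: cvg_cst.
  rewrite mulr0 addr0 in c.
  apply: (@cvge_to_ge _ \oo _ _ (fun n => (e n + K%:R * pr P [set w | S n w <> X w])%:E)).
    by apply: cvg_EFin => //; exact: nearW.
  apply: nearW => n; rewrite EFinD -SE -Ex_indicator//.
  pose D w := (K * `[< S n w <> X w >])%N.
  have mD' : discrete D.
    exact: (@discrete_comp2 _ _ _ _ _ _ _ (fun a b : nat => (K * `[< a <> b >])%N) (mS n) mX).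
  apply: (@le_trans _ _ (Ex (fun w => S n w + D w)%N)).
    apply: Ex_le => //; first exact: discrete_comp2.
    move=> w; rewrite /Y /D; case: asboolP => [_|]; first by rewrite muln1; lia.
    by move=> /contrapT ->; rewrite muln0 addn0 geq_minl.
  rewrite /Ex -ge0_integralD//; try exact: Ex_measurable.
  by apply: ge0_le_integral => //; [exact: Ex_measurable (discrete_comp2 addn (mS n) mD')|
    by apply: emeasurable_funD; exact: Ex_measurable|by move=> w _; rewrite -EFinD -natrD].
have limY w : limn (fun K => ((Y K w)%:R : R)%:E) = ((X w)%:R : R)%:E.
  apply: lim_near_cst => //; near=> K; rewrite /Y (minn_idPl _)//.
  by near: K; exact: nbhs_infty_ge.
have -> : Ex X = (\int[P]_w limn (fun K => ((Y K w)%:R : R)%:E))%E.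
  by apply: eq_integral => w _; rewrite limY.
apply: (@cvge_to_le _ \oo _ _ (fun K => Ex (Y K))).
  apply: cvg_monotone_convergence => //.
  - by move=> K; exact: Ex_measurable.
  - by move=> w _ K K' KK'; rewrite lee_fin ler_nat /Y; lia.
by apply: nearW => K; exact: YL.
Unshelve. all: by end_near. Qed.

Lemma Ex_covariance (X Y : T -> nat) (x y xy : R) : discrete X -> discrete Y ->
  Ex X = x%:E -> Ex Y = y%:E -> Ex (fun w => X w * Y w)%N = xy%:E ->
  covariance P (fun w => (X w)%:R) (fun w => (Y w)%:R) = (xy - x * y)%:E.
Proof.
move=> mX mY EX EY EXY.
have L1 (Z : T -> nat) z : discrete Z -> Ex Z = z%:E -> (fun w => (Z w)%:R : R) \in Lfun P 1.
  move=> mZ EZ; apply/Lfun1_integrable/integrableP; split; first exact: Ex_measurable.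
  have <- : Ex Z = (\int[P]_w `|(EFin \o (fun w => (Z w)%:R : R)) w|)%E.
    by apply: eq_integral => w _ /=; rewrite ger0_norm.
  by rewrite EZ ltry.
have mXY : discrete (fun w => X w * Y w)%N by exact: discrete_comp2.
have E : ((fun w => (X w)%:R) * (fun w => (Y w)%:R) : T -> R) = fun w => (X w * Y w)%:R.
  by apply/funext => w; rewrite natrM.
rewrite covarianceE ?E.
- by rewrite unlock; rewrite /Ex in EX EY EXY; rewrite EX EY EXY -EFinM -EFinB.
- exact: L1 EX.
- exact: L1 EY.
- exact: (L1 (fun w => X w * Y w)%N _ mXY EXY).
Qed.

End nat_expectation.

(** * Covariance of the split components *)

Lemma mesh_rate (R : realType) (f : R -> R) (l t : R) :
  f h / h @[h --> 0^'+] --> l -> f 0 = 0 -> 0 <= t ->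
  n.+1%:R * f (t / n.+1%:R) @[n --> \oo] --> l * t.
Proof.
move=> fl f0; rewrite le_eqVlt => /predU1P[<-|t0].
  by apply: cvg_near_cst; apply: nearW => n; rewrite mul0r f0 !mulr0.
have c : f (t / n.+1%:R) / (t / n.+1%:R) @[n --> \oo] --> l.
  exact: (cvg_comp _ _ (mesh_cvg t0) fl).
have c' : f (t / n.+1%:R) / (t / n.+1%:R) * t @[n --> \oo] --> l * t.
  by apply: cvgM => //; exact: cvg_cst.
apply: cvg_trans c'; apply: near_eq_cvg; apply: nearW => n; field.
by rewrite gt_eqF//= gt_eqF.
Qed.

Lemma pr_union_bound d (T : measurableType d) (R : realType) (P : probability T R)
    (N : nat) (B : nat -> set T) : (forall i, measurable (B i)) ->
  measurable [set w | exists2 i, (i < N)%N & B i w] /\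
  pr P [set w | exists2 i, (i < N)%N & B i w] <= \sum_(i < N) pr P (B i).
Proof.
move=> mB; elim: N => [|N [mA IH]].
  rewrite (_ : [set w | _] = set0) ?pr_set0 ?big_ord0//.
  by apply/seteqP; split => w //= [].
set A := [set w | _] in mA IH; have -> : [set w | exists2 i, (i < N.+1)%N & B i w] = A `|` B N.
  apply/seteqP; split => w /=.
    by move=> [i]; rewrite ltnS leq_eqVlt => /predU1P[->|iN] Bi; [right|left; exists i].
  by move=> [[i iN Bi]|BN]; [exists i => //; exact: ltnW|exists N].
have mU : measurable (A `|` B N) by exact: measurableU.
split => //; rewrite big_ord_recr /=; apply: le_trans (lerD IH (lexx _)).
rewrite -lee_fin EFinD -!prE//; exact: measureU2.
Qed.

Definition pairs (k : nat) : seq (nat * nat) :=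
  [seq (a, m - a)%N | m <- iota 0 k.+1, a <- iota 0 m.+1].

Lemma mem_pairs k u : (u \in pairs k) = (u.1 + u.2 <= k)%N.
Proof.
apply/allpairsPdep/idP => [[m [a [mk am ->]]] /=|uk].
  by move: mk am; rewrite !mem_iota; lia.
exists (u.1 + u.2)%N, u.1; rewrite !mem_iota /= addKn; split => //; try lia.
by case: (u).
Qed.

Lemma pairs_uniq k : uniq (pairs k).
Proof.
apply: allpairs_uniq_dep; [exact: iota_uniq|by move=> m _; exact: iota_uniq|].
move=> u v /allpairsPdep[m [a [_ am ->]]] /allpairsPdep[m' [a' [_ am' ->]]] /= [aa mm].
move: am am'; rewrite aa in mm *; rewrite !mem_iota => am am'.
by have -> : m = m' by lia.
Qed.

Lemma sum_pairs (R : nmodType) (k : nat) (F : nat * nat -> R) :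
  \sum_(u <- pairs k) F u = \sum_(0 <= m < k.+1) \sum_(0 <= a < m.+1) F (a, m - a)%N.
Proof. by rewrite big_allpairs_dep. Qed.

Section typeII_covariance.
Context d (T : measurableType d) (R : realType) (P : probability T R).
Variables (M : R -> T -> nat) (p : R).
Variable (Z : bool -> nat -> nat -> T -> nat).
Hypothesis hM : levy_counting P M.
Hypothesis hZ : splitting_rule P M (typeII_weight p) Z.
Variables (k : nat) (lam : nat -> R).
Hypothesis hG : GCP_rates P k M lam.

Notation X := (split_component M Z).
Notation rho := (split_law P M Z).
Implicit Types c : nat * nat -> nat.

Definition truncated c (u : nat * nat) : nat := if (u.1 + u.2 <= k)%N then c u else 0%N.

Definition cell_mean c (h : R) : R := \sum_(u <- pairs k) (c u)%:R * rho h u.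

(** Mean of [c] per unit of time when a jump with parts u occurs at rate [typeII_weight p (u.1 +
    u.2) u.1 * lam (u.1 + u.2)]. *)
Definition mean_rate c : R := \sum_(u <- pairs k)
  (c u)%:R * (typeII_weight p (u.1 + u.2) u.1 * lam (u.1 + u.2)%N).

(** The pair (0, 0) has probability close to 1, not of order h. The condition on [c] removes it, and
    with it the meaningless value [lam 0]. *)
Lemma cell_mean_rate c : c (0, 0)%N = 0%N ->
  cell_mean c h / h @[h --> 0^'+] --> mean_rate c.
Proof.
move=> c0; have [Hj _] := hG.
have H : \sum_(u <- pairs k) (c u)%:R * (typeII_weight p (u.1 + u.2) u.1 *
    (law P M h (u.1 + u.2)%N / h)) @[h --> 0^'+] --> mean_rate c.
  apply: (@cvg_sum_seq R _ _ _ (pairs k) (fun u h => (c u)%:R * (typeII_weight p (u.1 + u.2) u.1 *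
    (law P M h (u.1 + u.2)%N / h))) _ xpredT) => u; rewrite mem_pairs => uk _.
  have [u0|u0] := posnP (u.1 + u.2); last first.
    apply: cvgM; first exact: cvg_cst.
    by apply: cvgM; [exact: cvg_cst|apply: Hj; rewrite u0].
  have -> : u = (0, 0)%N by case: (u) u0 => a b /=; case: a; case: b.
  by rewrite c0 mul0r; apply: cvg_near_cst; apply: nearW => x; rewrite mul0r.
apply: cvg_trans H; apply: near_eq_cvg; near=> h.
have h0 : 0 < h by near: h; exact: nbhs_right_gt.
rewrite /cell_mean mulr_suml; apply: eq_bigr => u _.
by rewrite (typeII_law hM hZ _ (ltW h0)) /thin -!mulrA; congr (_ * _); ring.
Unshelve. all: by end_near. Qed.

Lemma cell_mean0 c : c (0, 0)%N = 0%N -> cell_mean c 0 = 0.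
Proof.
move=> c0; rewrite /cell_mean big1// => -[a b] _.
rewrite (typeII_law hM hZ)// /thin (law0 hM) /= addn_eq0.
case: (eqVneq a 0%N) => [->|_]; last by rewrite mul0r mulr0.
case: (eqVneq b 0%N) => [->|_]; last by rewrite mul0r mulr0.
by rewrite c0 mul0r.
Qed.

Section mesh.
Variables (t : R) (n : nat).
Hypothesis t0 : 0 <= t.

Let h := t / n.+1%:R.
Let h0 : 0 <= h. Proof. by rewrite divr_ge0. Qed.
Let tt (i : nat) : R := i%:R * h.
Let tt0 : 0 <= tt 0. Proof. by rewrite /tt mul0r. Qed.
Let ttS i : tt i <= tt i.+1. Proof. by rewrite ler_wpM2r// ler_nat. Qed.
Let tt_ge0 i : 0 <= tt i. Proof. by rewrite mulr_ge0. Qed.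

Definition mesh_inc (i : nat) : T -> nat * nat := split_inc M Z (tt i) (tt i.+1).

Lemma mesh_inc_discrete i : discrete (mesh_inc i).
Proof. exact: (split_inc_discrete hM hZ (tt_ge0 _) (tt_ge0 _)). Qed.

Lemma mesh_inc_law i u : pr P [set w | mesh_inc i w = u] = rho h u.
Proof.
rewrite (split_inc_law hM hZ)//; congr (split_law _ _ _ _ _).
by rewrite /tt -natr1 mulrDl mul1r addrAC subrr add0r.
Qed.

Definition mesh_sum c (w : T) : nat := (\sum_(i < n.+1) truncated c (mesh_inc i w))%N.

Lemma mesh_sum_discrete c : discrete (mesh_sum c).
Proof.
apply: (@discrete_sum _ _ n.+1 (fun i w => truncated c (mesh_inc i w))) => i _.
exact: (discrete_comp (truncated c) (mesh_inc_discrete i)).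
Qed.

Lemma mesh_side b w : (\sum_(i < n.+1) side b (mesh_inc i w))%N = X b t w.
Proof.
suff H N : (\sum_(i < N) side b (mesh_inc i w))%N = X b (tt N) w.
  by rewrite H /tt /h mulrC divfK.
elim: N => [|N IH]; first by rewrite big_ord0 /tt mul0r split_start.
by rewrite big_ord_recr /= IH side_split_inc subnKC//; exact: (split_mono Z hM).
Qed.

Lemma truncated_le c u : (truncated c u <= c u)%N.
Proof. by rewrite /truncated; case: ifP. Qed.

Lemma mesh_sum_le b w : (mesh_sum (side b) w <= X b t w)%N.
Proof. by rewrite -mesh_side; apply: leq_sum => i _; exact: truncated_le. Qed.

Definition large_cell : set T :=
  [set w | exists2 i, (i < n.+1)%N & (k < (mesh_inc i w).1 + (mesh_inc i w).2)%N].

Lemma mesh_sum_eq b w : ~ large_cell w -> mesh_sum (side b) w = X b t w.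
Proof.
move=> nl; rewrite -mesh_side; apply: eq_bigr => i _; rewrite /truncated.
by case: leqP => // ki; exfalso; apply: nl; exists i.
Qed.

(** A union bound over n + 1 cells; as [tail] is o(h), it vanishes when the mesh is refined. *)
Lemma large_cell_pr : measurable large_cell /\ pr P large_cell <= n.+1%:R * tail P k M h.
Proof.
have mB i : measurable [set w | (k < (mesh_inc i w).1 + (mesh_inc i w).2)%N].
  exact: (discrete_pre (fun u : nat * nat => (k < u.1 + u.2)%N) (mesh_inc_discrete i)).
have [mL HL] := pr_union_bound P n.+1 mB; split => //; apply: (le_trans HL).
rewrite (eq_bigr (fun=> tail P k M h)); first by rewrite sumr_const card_ord mulr_natl.
move=> i _; have mV := split_pair_discrete hM hZ h0.
rewrite (@pr_law_eq _ _ _ P _ (mesh_inc i) (split_pair M Z h) (fun u => (k < u.1 + u.2)%N))//.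
- rewrite /tail; congr pr; apply/seteqP.
  by split => w /=; rewrite (split_sum hM hZ w h0).
- exact: mesh_inc_discrete.
- by move=> u; rewrite mesh_inc_law.
Qed.

Lemma truncated_supp c u : u \notin pairs k -> truncated c u = 0%N.
Proof. by rewrite mem_pairs /truncated => /negbTE ->. Qed.

Lemma truncated_sum c (F : nat * nat -> R) :
  \sum_(u <- pairs k) (truncated c u)%:R * F u = \sum_(u <- pairs k) (c u)%:R * F u.
Proof. by apply: eq_big_seq => u; rewrite mem_pairs /truncated => ->. Qed.

Lemma Ex_truncated c i : Ex P (fun w => truncated c (mesh_inc i w)) = (cell_mean c h)%:E.
Proof.
rewrite (Ex_law P (mesh_inc_discrete i) (pairs_uniq k) (truncated_supp c)); congr (_%:E).
by under eq_bigr do rewrite mesh_inc_law; exact: truncated_sum.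
Qed.

Lemma Ex_mesh_sum c : Ex P (mesh_sum c) = (n.+1%:R * cell_mean c h)%:E.
Proof.
rewrite (Ex_sum P (index_enum 'I_n.+1) (X := fun i w => truncated c (mesh_inc i w))).
  under eq_bigr do rewrite Ex_truncated.
  by rewrite sumEFin sumr_const card_ord mulr_natl.
by move=> i; exact: (discrete_comp (truncated c) (mesh_inc_discrete i)).
Qed.

Lemma mesh_inc_indep i j u v : i != j ->
  pr P [set w | (mesh_inc i w, mesh_inc j w) = (u, v)] = rho h u * rho h v.
Proof.
move=> ij; have us : uniq [:: i; j] by rewrite /= inE ij.
have := split_inc_indep hM hZ tt0 ttS (fun l => if l == i then [set u] else [set v]) us.
rewrite !big_cons big_nil mulr1 eqxx (eq_sym j i) (negbTE ij) -(mesh_inc_law i) -(mesh_inc_law j).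
move=> <-; congr pr; apply/seteqP; split => w /=.
  by move=> [iu jv] l; rewrite !inE => /orP[/eqP ->|/eqP ->]; rewrite ?eqxx// eq_sym (negbTE ij).
move=> H; have := H i; have := H j.
by rewrite !inE !eqxx orbT (eq_sym j i) (negbTE ij) => /(_ isT) /= <- /(_ isT) /= <-.
Qed.

Lemma Ex_truncated_mul c c' i j :
  Ex P (fun w => truncated c (mesh_inc i w) * truncated c' (mesh_inc j w))%N =
  (if i == j then cell_mean (fun u => c u * c' u)%N h
   else cell_mean c h * cell_mean c' h)%:E.
Proof.
case: eqVneq => [->|ij].
  rewrite -(Ex_truncated _ j); congr (Ex P); apply/funext => w.
  by rewrite /truncated; case: ifP; rewrite ?mul0n.
have mV : discrete (fun w => (mesh_inc i w, mesh_inc j w)).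
  by apply: discrete_comp2; exact: mesh_inc_discrete.
pose s := [seq (u, v) | u <- pairs k, v <- pairs k].
have us : uniq s by apply: allpairs_uniq; rewrite ?pairs_uniq// => -[? ?] [? ?].
pose g (uv : (nat * nat) * (nat * nat)) := (truncated c uv.1 * truncated c' uv.2)%N.
have gs uv : uv \notin s -> g uv = 0%N.
  case: uv => u v uvs; rewrite /g /=.
  have [us'|/truncated_supp ->] := boolP (u \in pairs k); last by rewrite mul0n.
  have [vs'|/truncated_supp ->] := boolP (v \in pairs k); last by rewrite muln0.
  by move: uvs; rewrite allpairs_f.
rewrite (Ex_law P (g := g) mV us gs); congr (_%:E).
rewrite big_allpairs /cell_mean -(truncated_sum c) -(truncated_sum c') big_distrl; apply: eq_bigr => u _.
rewrite big_distrr; apply: eq_bigr => v _ /=.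
by rewrite mesh_inc_indep// /g natrM /=; ring.
Qed.

Lemma Ex_mesh_sum_mul c c' : Ex P (fun w => mesh_sum c w * mesh_sum c' w)%N =
  (n.+1%:R * (cell_mean (fun u => c u * c' u)%N h + n%:R * (cell_mean c h * cell_mean c' h)))%:E.
Proof.
have mt c1 i : discrete (fun w => truncated c1 (mesh_inc i w)).
  exact: (discrete_comp (truncated c1) (mesh_inc_discrete i)).
have -> : (fun w => mesh_sum c w * mesh_sum c' w)%N = fun w =>
    (\sum_(ij <- [seq (i, j) | i <- iota 0 n.+1, j <- iota 0 n.+1])
      truncated c (mesh_inc ij.1 w) * truncated c' (mesh_inc ij.2 w))%N.
  apply/funext => w; rewrite big_allpairs /mesh_sum.
  rewrite -!(big_mkord xpredT (fun i => truncated _ (mesh_inc i w))) /index_iota subn0.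
  rewrite big_distrl; apply: eq_bigr => i _; rewrite big_distrr; exact: eq_bigr.
rewrite Ex_sum; last by move=> ij; exact: discrete_comp2.
under eq_bigr do rewrite Ex_truncated_mul.
rewrite sumEFin big_allpairs; congr (_%:E).
(* Row i of the double sum has one diagonal term, where the same cell is used twice, and n terms
   with independent cells. *)
have E i : (i \in iota 0 n.+1) -> \sum_(j <- iota 0 n.+1)
   (if i == j then cell_mean (fun u => c u * c' u)%N h else cell_mean c h * cell_mean c' h) =
   cell_mean (fun u => c u * c' u)%N h + n%:R * (cell_mean c h * cell_mean c' h).
  move=> iN; rewrite (bigD1_seq i) ?iota_uniq//= eqxx; congr (_ + _).
  rewrite (eq_bigr (fun=> cell_mean c h * cell_mean c' h)); last by move=> j; rewrite eq_sym => /negbTE ->.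
  rewrite big_const_seq iter_addr_0 mulr_natl; congr (_ *+ _).
  have := count_predC (pred1 i) (iota 0 n.+1).
  rewrite size_iota (count_uniq_mem _ (iota_uniq 0 n.+1)) iN add1n => -[cE].
  by rewrite -[RHS]cE; apply: eq_count => j.
rewrite big_seq (eq_bigr _ E) -big_seq big_const_seq iter_addr_0 count_predT size_iota.
by rewrite [RHS]mulr_natl.
Qed.

End mesh.

Lemma large_cell_cvg t : 0 <= t -> pr P (large_cell t n) @[n --> \oo] --> 0.
Proof.
move=> t0; have tail0 : tail P k M 0 = 0.
  rewrite /tail (_ : [set w | _] = set0) ?pr_set0//.
  by apply/seteqP; split => w //=; rewrite (levy_start hM).
have := mesh_rate hG.2 tail0 t0; rewrite mul0r => H.
apply: (@squeeze_cvgr _ _ _ _ (fun=> 0) _ _ _ _ (cvg_cst _) H).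
by apply: nearW => n; rewrite pr_ge0 (large_cell_pr n t0).2.
Qed.

Let cell_mean_mesh c t : c (0, 0)%N = 0%N -> 0 <= t ->
  n.+1%:R * cell_mean c (t / n.+1%:R) @[n --> \oo] --> mean_rate c * t.
Proof.
by move=> c0; apply: mesh_rate; [exact: cell_mean_rate|exact: cell_mean0].
Qed.

Let defect_cvg t (Y : T -> nat) (S : nat -> T -> nat) : 0 <= t ->
  discrete Y -> (forall n, discrete (S n)) ->
  (forall n w, ~ large_cell t n w -> S n w = Y w) ->
  pr P [set w | S n w <> Y w] @[n --> \oo] --> 0.
Proof.
move=> t0 mY mS H.
apply: (@squeeze_cvgr _ _ _ _ (fun=> 0) _ _ _ _ (cvg_cst _) (large_cell_cvg t0)).
apply: nearW => n; rewrite pr_ge0 pr_le//.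
- have := discrete_comp2 (fun a b : nat => a != b) (mS n) mY => /(_ true).
  by rewrite (_ : [set w | _] = [set w | S n w <> Y w])//; apply/seteqP; split => w /= /eqP.
- exact: (large_cell_pr n t0).1.
- by move=> w SY; apply: contrapT => /H.
Qed.

Lemma Ex_split b t : 0 <= t -> Ex P (X b t) = (mean_rate (side b) * t)%:E.
Proof.
move=> t0; have mX := split_discrete hM hZ b t0.
have mS n := mesh_sum_discrete n t0 (side b).
apply: (Ex_limit mX mS) (cell_mean_mesh _ t0).
- by move=> n w; exact: mesh_sum_le.
- by apply: (defect_cvg t0 mX mS) => n w; exact: mesh_sum_eq.
- by move=> n; exact: Ex_mesh_sum.
- by case: (b).
Qed.

Lemma Ex_split_mul t : 0 <= t -> Ex P (fun w => X true t w * X false t w)%N =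
  (mean_rate (fun u => u.1 * u.2)%N * t +
   mean_rate (side true) * t * (mean_rate (side false) * t))%:E.
Proof.
move=> t0; have mX b := split_discrete hM hZ b t0.
have mXY : discrete (fun w => X true t w * X false t w)%N by exact: discrete_comp2.
have mS n : discrete (fun w => mesh_sum t n (side true) w * mesh_sum t n (side false) w)%N.
  by apply: discrete_comp2; exact: mesh_sum_discrete.
apply: (Ex_limit mXY mS) (fun n => Ex_mesh_sum_mul n t0 (side true) (side false)) _.
- by move=> n w; apply: leq_mul; exact: mesh_sum_le.
- by apply: (defect_cvg t0 mXY mS) => n w nl; rewrite !mesh_sum_eq.
pose cm c n := cell_mean c (t / n.+1%:R).
have c1 : n.+1%:R * cm (side true) n @[n --> \oo] --> mean_rate (side true) * t.
  exact: cell_mean_mesh.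
have c2 : n.+1%:R * cm (side false) n @[n --> \oo] --> mean_rate (side false) * t.
  exact: cell_mean_mesh.
have c3 : n.+1%:R * cm (fun u => u.1 * u.2)%N n @[n --> \oo] --> mean_rate (fun u => u.1 * u.2)%N * t.
  exact: cell_mean_mesh.
have c0 : cm (side false) n @[n --> \oo] --> (0 : R).
  have H : n.+1%:R * cm (side false) n * n.+1%:R^-1 @[n --> \oo] --> mean_rate (side false) * t * 0.
    by apply: cvgM => //; exact: cvg_harmonic.
  rewrite mulr0 in H; apply: cvg_trans H; apply: near_eq_cvg; apply: nearW => n.
  by rewrite mulrAC divff ?mul1r.
(* The factor n of the independent pairs is written as (n + 1) - 1: the main part tends to the
   product of the means, and the correction vanishes because a single cell mean does. The covariance
   is therefore the diagonal contribution. *)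
have H : n.+1%:R * cm (fun u => u.1 * u.2)%N n +
   (n.+1%:R * cm (side true) n * (n.+1%:R * cm (side false) n) -
    n.+1%:R * cm (side true) n * cm (side false) n) @[n --> \oo] -->
   mean_rate (fun u => u.1 * u.2)%N * t +
   (mean_rate (side true) * t * (mean_rate (side false) * t) - mean_rate (side true) * t * 0).
  by apply: cvgD => //; apply: cvgB; apply: cvgM.
rewrite mulr0 subr0 in H; apply: cvg_trans H; apply: near_eq_cvg; apply: nearW => n.
by rewrite /cm -natr1 /side /=; ring.
Qed.

Lemma typeII_covariance t : 0 <= t ->
  covariance P (fun w => (X true t w)%:R) (fun w => (X false t w)%:R) =
  (mean_rate (fun u => u.1 * u.2)%N * t)%:E.
Proof.
move=> t0; have mX b := split_discrete hM hZ b t0.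
rewrite (Ex_covariance (mX true) (mX false) (Ex_split true t0) (Ex_split false t0) (Ex_split_mul t0)).
by rewrite addrK.
Qed.

End typeII_covariance.

Theorem mainTheorem5 (R : realType) (d : measure_display)
    (T : measurableType d) (P : probability T R)
    (k : nat) (lam : nat -> R) (p : R) (M : R -> T -> nat)
    (hp : 0 < p < 1) (hM : is_GCP P k lam M) :
  (forall xi : nat * nat -> T -> bool, coin_flips P p M xi ->
    let M1 := typeII_component true M xi in
    let M2 := typeII_component false M xi in
    [/\ is_GCP P k
          (fun j1 => \sum_(j1 <= j < k.+1)
             'C(j, j1)%:R * p ^+ j1 * (1 - p) ^+ (j - j1) * lam j) M1,
        is_GCP P k
          (fun j2 => \sum_(j2 <= j < k.+1)
             'C(j, j2)%:R * (1 - p) ^+ j2 * p ^+ (j - j2) * lam j) M2,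
        forall t : R, 0 <= t ->
          covariance P (fun w => (M1 t w)%:R) (fun w => (M2 t w)%:R) =
          (\sum_(1 <= j < k.+1) \sum_(0 <= j1 < j.+1)
             'C(j, j1)%:R * p ^+ j1 * (1 - p) ^+ (j - j1)
             * j1%:R * (j - j1)%:R * lam j * t)%:E,
        forall t : R, 0 < t ->
          covariance P (fun w => (M1 t w)%:R) (fun w => (M2 t w)%:R) = 0%E ->
          forall j j1 j2 : nat, (1 <= j <= k)%N -> (j1 + j2)%N = j ->
            j1 = 0%N \/ j2 = 0%N
      & (1 < k)%N ->
          ~ independent_processes P nonneg_times M1 nonneg_times M2]) /\
  (forall eta : nat -> T -> bool, coin_flips P p M eta ->
     independent_processes P
       nonneg_times (typeI_component true M eta)
       nonneg_times (typeI_component false M eta)).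
Proof.
have hL := levy_of_GCP hM; have [p0 p1] := andP hp.
have hR := rates_of_GCP hL hM.
have M_meas := cp_measurable (gcp_counting hM).
have k0 := gcp_k_gt0 hM; have lam0 := gcp_rate_gt0 hM.
split; last first.
  move=> eta heta; have hZ := typeI_splitting_rule M_meas heta.
  apply: (split_independent_processes hL hZ) => h a b a' b' h0.
  (* [GCP_no_jump_rate] supplies the finite limit of P(M(h) > 0) / h on which the mesh error
     estimate rests. *)
  apply: (split_law_rank_one _ hL hZ (GCP_no_jump_rate hL hR) a b a' b' h0).
  by rewrite (ltW p0) (ltW p1).
move=> xi hxi M1 M2; have hZ := typeII_splitting_rule M_meas hxi.
have G1 : is_GCP P k (typeII_rate p k lam true) M1 by exact: (typeII_GCP hL hZ hp hR).
have G2 : is_GCP P k (typeII_rate p k lam false) M2 by exact: (typeII_GCP hL hZ hp hR).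
pose w (j a : nat) := 'C(j, a)%:R * p ^+ a * (1 - p) ^+ (j - a) * a%:R * (j - a)%:R * lam j.
have cov t : 0 <= t ->
    covariance P (fun w => (M1 t w)%:R) (fun w => (M2 t w)%:R) =
    (\sum_(1 <= j < k.+1) \sum_(0 <= a < j.+1) w j a * t)%:E.
  move=> t0; have := typeII_covariance hL hZ hR t0; rewrite /mean_rate sum_pairs => ->.
  (* The total 0 belongs to [pairs] but not to the stated sum; its only term is zero because one
     part is 0. *)
  rewrite big_ltn//= big_nat1 muln0 mul0r add0r mulr_suml; congr (_%:E).
  apply: eq_bigr => j _; rewrite mulr_suml; apply: eq_big_nat => a /andP[_ aj].
  by rewrite subnKC// natrM /w /typeII_weight; ring.
have w_ge0 j a : (1 <= j <= k)%N -> (a <= j)%N -> 0 <= w j a.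
  move=> jk aj; rewrite /w !mulr_ge0// ?exprn_ge0 ?subr_ge0 ?ltW//; exact: lam0.
split => //.
- have -> // : (fun j2 => \sum_(j2 <= j < k.+1) 'C(j, j2)%:R * (1 - p) ^+ j2 * p ^+ (j - j2) * lam j)
    = typeII_rate p k lam false.
  apply/funext => a; apply: eq_bigr => j _.
  by rewrite /typeII_weight /side_prob subKr.
(* A vanishing sum of nonnegative terms has only zero terms. In each of them the binomial, the
   powers, the rate and t are positive, so one of the two parts must be 0. *)
- move=> t t0; rewrite cov ?ltW// => -[/eqP].
  rewrite big_nat psumr_eq0; last first.
    move=> j jk; rewrite big_nat; apply: sumr_ge0 => a /andP[_ aj].
    by rewrite mulr_ge0 ?w_ge0 ?ltW.
  move=> /allP H j a b jk abj; have := H j; rewrite mem_index_iota ltnS jk => /(_ isT) /=.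
  rewrite big_nat psumr_eq0; last first.
    by move=> c /andP[_ cj]; rewrite mulr_ge0 ?w_ge0 ?ltW.
  move=> /allP {}H; have aj : (a <= j)%N by rewrite -abj leq_addr.
  have := H a; rewrite mem_index_iota /= ltnS aj => /(_ isT).
  rewrite mulf_eq0 (gt_eqF t0) orbF /w -abj addKn.
  rewrite !mulf_eq0 !expf_eq0 !pnatr_eq0 (gt_eqF p0) subr_eq0 (gt_eqF p1) !andbF /=.
  rewrite (gt_eqF (lam0 _ _)) ?abj// orbF -!orbA eqn0Ngt bin_gt0 aj /=.
  by move=> /orP[/eqP|/eqP]; [left|right].
- move=> k1 hI.
  have sp b (h : R) n : 0 <= h -> sigma_process nonneg_times (split_component M (typeII_rule xi) b)
      (split_component M (typeII_rule xi) b h @^-1` [set n]).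
    by move=> h0; apply: sub_sigma_algebra; exists h => //; exists [set n].
  (* M1(h) = M2(h) = 1 means that [M h] is 2 and its two units are separated. If the components were
     independent, this probability would be the product of the marginal ones. *)
  have E (h : R) : 0 <= h -> law P M1 h 1%N * law P M2 h 1%N =
      law P M h 2 * typeII_weight p 2 1.
    move=> h0; rewrite -[RHS]/(thin P M (typeII_weight p) h (1, 1)%N) -(typeII_law hL hZ)//.
    have H := hI _ _ (sp true h 1%N h0) (sp false h 1%N h0).
    have m1 := split_discrete hL hZ true h0 1%N; have m2 := split_discrete hL hZ false h0 1%N.
    apply: EFin_inj; rewrite EFinM -(prE P m1) -(prE P m2).
    rewrite -(prE P (split_pair_discrete hL hZ h0 (1, 1)%N)) -[LHS]H; congr (P _).
    by apply/seteqP; split => v; rewrite /split_pair /=; [move=> [-> ->]|move=> [-> ->]].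
  have c1 : law P M1 h 1%N / h * (law P M2 h 1%N / h) * h @[h --> 0^'+] -->
     typeII_rate p k lam true 1%N * typeII_rate p k lam false 1%N * 0.
    have [r1 _] := rates_of_GCP (levy_of_GCP G1) G1.
    have [r2 _] := rates_of_GCP (levy_of_GCP G2) G2.
    apply: cvgM; last exact: cvg_within.
    by apply: cvgM; [apply: r1|apply: r2]; rewrite k0.
  have c2 : law P M h 2 / h * typeII_weight p 2 1 @[h --> 0^'+] --> lam 2 * typeII_weight p 2 1.
    by apply: cvgM; [apply: hR.1; rewrite k1|exact: cvg_cst].
  (* Dividing the identity by h and letting h tend to 0 yields two limits: the product side gives 0
     and the joint side the rate of a separated jump of size 2, which is positive since k > 1. *)
  have : lam 2 * typeII_weight p 2 1 = 0.
    rewrite -[RHS](mulr0 (typeII_rate p k lam true 1%N * typeII_rate p k lam false 1%N)).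
    apply: (cvg_unique _ c2) => //; apply: cvg_trans c1; apply: near_eq_cvg; near=> h.
    have h0 : 0 < h by near: h; exact: nbhs_right_gt.
    have -> : law P M h 2 / h * typeII_weight p 2 1 = law P M h 2 * typeII_weight p 2 1 / h by rewrite mulrAC.
    rewrite -(E _ (ltW h0)); field.
    by rewrite gt_eqF.
  apply/eqP; rewrite mulf_neq0// gt_eqF//; first by apply: lam0; rewrite k1.
  exact: (typeII_weight_gt0 hp true).
Unshelve. all: by end_near. Qed.
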